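(* Let $M$ be a compact complex manifold. Then the following are equivalent. (a) $M$ is Kobayashi hyperbolic. (b) For any given positive $(1,1)$-form $\omega$ on $M$, there are positive constants $c_0$ and $A$ such that for every holomorphic map $f:\bigtriangleup(1)\to M$, $\int_0^1\exp(cT_{f,\omega}(r))\,dr\le A$ for every $c<c_0$. (c) The class $\mathcal E_0(\bigtriangleup(1))$ is empty.
   Context: $\bigtriangleup(1)$ is the unit disc in $\mathbb C$. For a holomorphic map $f:\bigtriangleup(1)\to M$ and a positive $(1,1)$-form $\omega$ on $M$, $T_{f,\omega}(r)=\int_0^r\frac{dt}{t}\int_{|z|<t}f^*\omega$ for $0<r<1$. $\mathcal E_0(\bigtriangleup(1))=\bigcap_{c>0}\mathcal E_c$, where $\mathcal E_c$ is the set of holomorphic maps $f:\bigtriangleup(1)\to M$ with $\int_0^1\exp(cT_{f,\omega}(r))\,dr=\infty$; since $M$ is compact, $\mathcal E_0(\bigtriangleup(1))$ does not depend on the choice of the positive $(1,1)$-form $\omega$. *)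

(* Defs.v *)
From HB Require Import structures.
From mathcomp Require Import all_boot all_order all_algebra.
From mathcomp Require Import all_classical all_reals all_analysis.
From mathcomp Require Import complex.

Set Implicit Arguments.
Unset Strict Implicit.
Unset Printing Implicit Defensive.

Import Order.TTheory GRing.Theory Num.Theory.
Import numFieldNormedType.Exports.

Local Open Scope classical_set_scope.
Local Open Scope complex_scope.
Local Open Scope ring_scope.

(* MathComp-Analysis attaches the norm topology to terms of type numFieldType,
   not to the bare type R[i]; hence this name for the complex field.
   Differentiability and derivatives of maps between C-vector spaces are then
   complex ones. *)
Definition C (R : realType) : numClosedFieldType := R[i].

Definition mkC (R : realType) (x y : R) : C R := x +i* y.
Definition reC (R : realType) (z : C R) : R := complex.Re z.
Definition imC (R : realType) (z : C R) : R := complex.Im z.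

Definition disc (R : realType) (r : R) : set (C R) :=
  [set z | reC `|z| < r].

Definition adjoint (R : realType) (m n : nat) (A : 'M[C R]_(m, n)) :
  'M[C R]_(n, m) := map_mx Num.conj A^T.

(* A chart is a homeomorphism of an open set onto an open subset of C^n; both
   it and its inverse are represented by total functions, whose values outside
   [chart_dom] and outside the image of [chart_dom] are irrelevant. *)
Record chart (R : realType) (n : nat) (T : topologicalType) := Chart {
  chart_dom : set T;
  chart_map : T -> 'rV[C R]_n;
  chart_inv : 'rV[C R]_n -> T;
  chart_dom_open : open chart_dom;
  chart_img_open : open (chart_map @` chart_dom);
  chart_mapK : forall x, chart_dom x -> chart_inv (chart_map x) = x;
  chart_map_continuous :
    forall x, chart_dom x -> {for x, continuous chart_map};
  chart_inv_continuous :
    forall y, (chart_map @` chart_dom) y -> {for y, continuous chart_inv}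
}.

Definition transition (R : realType) (n : nat) (T : topologicalType)
    (phi psi : chart R n T) : 'rV[C R]_n -> 'rV[C R]_n :=
  chart_map psi \o chart_inv phi.

(* Connectedness is not required. *)
Record complexManifold (R : realType) (n : nat) := ComplexManifold {
  carrier :> topologicalType;
  manifold_hausdorff : hausdorff_space carrier;
  manifold_second_countable : @second_countable carrier;
  atlas : set (chart R n carrier);
  atlas_cover : forall x, exists2 phi, atlas phi & chart_dom phi x;
  atlas_holomorphic : forall phi psi x, atlas phi -> atlas psi ->
    chart_dom phi x -> chart_dom psi x ->
    differentiable (transition phi psi) (chart_map phi x)
}.

Definition chart_at (R : realType) (n : nat) (M : complexManifold R n)
  (x : M) : chart R n M := s2val (cid2 (atlas_cover x)).

(* Holomorphic maps from the unit disc; only the values of [disc_map] on the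
   disc matter. *)
Record discMap (R : realType) (n : nat) (M : complexManifold R n) := DiscMap {
  disc_map :> C R -> M;
  disc_map_continuous :
    forall z, disc 1 z -> {for z, continuous disc_map};
  disc_map_holomorphic : forall z phi, disc 1 z -> atlas phi ->
    chart_dom phi (disc_map z) -> derivable (chart_map phi \o disc_map) z 1
}.

Section Kobayashi.
Variables (R : realType) (n : nat) (M : complexManifold R n).

Definition poincare (a b : C R) : R :=
  let m := reC (`|a - b| / `|1 - a^* * b|) in ln ((1 + m) / (1 - m)).

(* [(f, a, b)] stands for the disc [f] with marked points [a] and [b]. *)
Fixpoint disc_chain (p : M) (s : seq (discMap M * C R * C R)) (q : M) : Prop :=
  match s with
  | [::] => p = q
  | (f, a, b) :: s' =>
      [/\ disc 1 a, disc 1 b, f a = p & disc_chain (f b) s' q]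
  end.

(* The value is +oo when no chain of discs joins [p] to [q], i.e. when they
   lie in different connected components. *)
Definition kobayashi (p q : M) : \bar R :=
  ereal_inf [set (\sum_(l <- s) poincare l.1.2 l.2)%:E
            | s in [set s | disc_chain p s q]].

Definition kobayashi_hyperbolic : Prop :=
  forall p q : M, kobayashi p q = 0%E -> p = q.

End Kobayashi.

(* C^oo in the real sense: all iterated directional derivatives exist and are
   differentiable at every point of [U], which is meant to be open. *)
Definition smooth_on (R : realType) (V : normedModType R) (U : set V)
    (u : V -> R) : Prop :=
  forall (s : seq V) (x : V), U x ->
    differentiable (foldr (fun v g => fun y => 'D_v g y) u s) x.

Definition of_reals (R : realType) (n : nat) (p : 'rV[R]_n * 'rV[R]_n) :
  'rV[C R]_n := \row_j mkC (p.1 0 j) (p.2 0 j).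

(* The form is (i/2) \sum_(j, k) h_jk dz_j /\ d(conj z_k) in the chart [phi],
   where h = [form_coef phi]. In the transformation rule, [jacobian] acts on
   row vectors from the right. *)
Record positiveForm (R : realType) (n : nat) (M : complexManifold R n) :=
  PositiveForm {
  form_coef : chart R n M -> M -> 'M[C R]_n;
  form_smooth : forall phi j k, atlas phi ->
    let U := @of_reals R n @^-1` (chart_map phi @` chart_dom phi) in
    let h p := form_coef phi (chart_inv phi (of_reals p)) j k in
    smooth_on U (fun p => reC (h p)) /\ smooth_on U (fun p => imC (h p));
  form_hermitian : forall phi x, atlas phi -> chart_dom phi x ->
    adjoint (form_coef phi x) = form_coef phi x;
  form_positive : forall phi x (v : 'rV[C R]_n), atlas phi ->
    chart_dom phi x -> v != 0 ->
    0 < (v *m form_coef phi x *m adjoint v) 0 0;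
  form_change : forall phi psi x, atlas phi -> atlas psi ->
    chart_dom phi x -> chart_dom psi x ->
    let J := jacobian (transition phi psi) (chart_map phi x) in
    form_coef phi x = J *m form_coef psi x *m adjoint J
}.

Section Characteristic.
Variables (R : realType) (n : nat) (M : complexManifold R n).
Variable omega : positiveForm M.

Local Notation mu := (@lebesgue_measure R).

(* The function g such that f^* omega = g(x + iy) dx /\ dy. By [form_change]
   it does not depend on the chart around [f z]. *)
Definition pullback_density (f : discMap M) (z : C R) : R :=
  let phi := chart_at (f z) in
  let v := derive1 (chart_map phi \o f) z in
  reC ((v *m form_coef omega phi (f z) *m adjoint v) 0 0).

Local Open Scope ereal_scope.

Definition pullback_integral (f : discMap M) (t : R) : \bar R :=
  \int[mu \x mu]_(p in [set p | disc t (mkC p.1 p.2)])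
    (pullback_density f (mkC p.1 p.2))%:E.

Definition characteristic (f : discMap M) (r : R) : \bar R :=
  \int[mu]_(t in `]0%R, r[) (t^-1%:E * pullback_integral f t).

Definition exp_integral (f : discMap M) (c : R) : \bar R :=
  \int[mu]_(r in `]0%R, 1%R[) expeR (c%:E * characteristic f r).

Definition class_E (c : R) : set (discMap M) :=
  [set f | exp_integral f c = +oo].

Definition class_E0 : set (discMap M) :=
  \bigcap_(c in [set c : R | (0 < c)%R]) class_E c.

End Characteristic.

(* Main.v *)
(* Fix a positive form and let [dens f z] be the density of its pull-back by [f]. The pivot is
   the existence of a bound K on [dens f 0] over all holomorphic discs f.
   By Moebius reparametrization K gives [dens f z <= K / (1 - |z|^2)^2], hence the Kobayashi
   distance separates points. Conversely, if M is hyperbolic, compactness forces discs centred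
   near a point to map a fixed smaller disc into a chart ball, and Cauchy's estimate bounds
   [dens f 0].
   Given K, the area of f over |z| < t is at most of order 1 / (1 - t), so
   T(r) <= 40 K log (1 / (1 - r)) and exp (c T) is integrable for c < 1 / (80 K).
   Without K, Brody rescaling yields an entire curve G with density 1 at 0. The curve
   u |-> G (exp (2 pi u) - 1) has period i, and composing it with z |-> (1 - z)^-2 puts about N^2
   pairwise disjoint pieces of equal area over |z| < 1 - 1 / (8 N). Thus T(r) grows like
   1 / (1 - r), and exp (c T) is integrable for no c > 0.
   The implication from (b) also needs some positive form on M, obtained from a partition of
   unity built with exp (- 1 / s). *)
From HB Require Import structures.
Require Import Defs.
From mathcomp Require Import all_boot all_order all_algebra.
From mathcomp Require Import all_classical all_reals all_analysis.
From mathcomp Require Import complex.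
From mathcomp Require Import measurable_realfun.
From mathcomp Require Import ring lra zify.

Set Implicit Arguments.
Unset Strict Implicit.
Unset Printing Implicit Defensive.

Import Order.TTheory GRing.Theory Num.Theory.
Import numFieldNormedType.Exports.

Local Open Scope classical_set_scope.
Local Open Scope ring_scope.

(** * Norms and differentials over C *)

Section ComplexNorm.
Variable R : realType.
Implicit Types (V W : normedModType (C R)) (z w : C R) (r : R).

(** A bound on [dens f 0] governs the whole disc because automorphisms of the disc act transitively
    and the density only picks up the factor |h'|^2 ([dens_comp]). The order of the pole decides the
    growth: a simple pole would put only about N translates of one piece over |z| < 1 - 1/N, and T
    would grow like log (1 / (1 - r)), the borderline at which exp (c T) diverges for large c only;
    a double pole gives about N^2 translates and divergence for all c. Limits are taken along
    ultrafilters. On a compact M a sequence of maps then has a limit at all points at once, and the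
    work shifts to the holomorphy of that limit, for which bounds may depend only on a radius and a
    sup norm. This is why the one-variable theory aims at [holo_taylor2], a second-order Taylor
    bound with explicit constant that survives pointwise limits; it comes from Goursat on
    rectangles, transported to circles by the exponential. The densities involve a choice of chart
    at each point, so integrals are compared as suprema over simple functions, against explicit
    measurable functions. *)

Definition nrm V (v : V) : R := reC `|v|.

Lemma mkC_eta z : mkC (reC z) (imC z) = z.
Proof. by case: z. Qed.

Lemma mkCP z w : reC z = reC w -> imC z = imC w -> z = w.
Proof. by case: z => a b; case: w => c d /= -> ->. Qed.

Definition rC (r : R) : C R := mkC r 0.

(** Nonnegativity in the order of [C R] forces the imaginary part to vanish. Every estimate on norms
    valued in [C R] can thus be moved to real numbers. *)
Lemma nrmE V (v : V) : `|v| = rC (nrm v).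
Proof.
have := normr_ge0 v; rewrite /nrm; case: `|v| => a b.
by rewrite lecE /= => /andP[/eqP-> _].
Qed.

Lemma ltrC r s : (rC r < rC s) = (r < s).
Proof. exact: ltcR. Qed.
Lemma lerC r s : (rC r <= rC s) = (r <= s).
Proof. exact: lecR. Qed.

Lemma rCD r s : rC (r + s) = rC r + rC s. Proof. by apply: mkCP => //=; rewrite addr0. Qed.
Lemma rCN r : rC (- r) = - rC r. Proof. by apply: mkCP => //=; rewrite oppr0. Qed.
Lemma rCB r s : rC (r - s) = rC r - rC s. Proof. by rewrite rCD rCN. Qed.
Lemma rCM r s : rC (r * s) = rC r * rC s.
Proof. by apply: mkCP => /=; rewrite ?(mulr0, mul0r, addr0, subr0). Qed.
Lemma rC1 : rC 1 = 1. Proof. by []. Qed.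
Lemma rC0 : rC 0 = 0. Proof. by []. Qed.
Lemma rC_eq0 r : (rC r == 0) = (r == 0).
Proof. by apply/eqP/eqP => [[]//|->]. Qed.
Lemma rCV r : rC r^-1 = (rC r)^-1.
Proof.
have [->|r0] := eqVneq r 0; first by rewrite invr0 rC0 invr0.
by apply: (mulfI (x := rC r)); rewrite ?rC_eq0// -rCM !mulfV ?rC_eq0.
Qed.

Lemma nrm_ge0 V (v : V) : 0 <= nrm v.
Proof. by rewrite -lerC -nrmE normr_ge0. Qed.
Lemma nrm0 V : nrm (0 : V) = 0. Proof. by rewrite /nrm normr0. Qed.
Lemma nrmN V (v : V) : nrm (- v) = nrm v. Proof. by rewrite /nrm normrN. Qed.
Lemma nrmC V (v w : V) : nrm (v - w) = nrm (w - v). Proof. by rewrite -nrmN opprB. Qed.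
Lemma nrmD V (v w : V) : nrm (v + w) <= nrm v + nrm w.
Proof. by rewrite -lerC rCD -!nrmE ler_normD. Qed.
Lemma nrmB V (v w : V) : nrm (v - w) <= nrm v + nrm w.
Proof. by rewrite -(nrmN w) nrmD. Qed.
Lemma nrm_tri V (u v w : V) : nrm (u - w) <= nrm (u - v) + nrm (v - w).
Proof. by have := nrmD (u - v) (v - w); rewrite addrA subrK. Qed.
Lemma nrmZ V z (v : V) : nrm (z *: v) = nrm z * nrm v.
Proof. by case: (rC_eq0 0) => _; have := normrZ z v; rewrite !nrmE -rCM => -[]. Qed.
Lemma nrmM z w : nrm (z * w) = nrm z * nrm w.
Proof. exact: nrmZ. Qed.
Lemma nrm_eq0 V (v : V) : (nrm v == 0) = (v == 0).
Proof. by rewrite -rC_eq0 -nrmE normr_eq0. Qed.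
Lemma nrm_gt0 V (v : V) : (0 < nrm v) = (v != 0).
Proof. by rewrite lt_neqAle nrm_ge0 andbT eq_sym nrm_eq0. Qed.
Lemma nrmV z : nrm z^-1 = (nrm z)^-1.
Proof. by have := normfV z; rewrite !nrmE -rCV => -[]. Qed.
Lemma nrm_rC r : nrm (rC r) = `|r|.
Proof. by rewrite /nrm normc_def /= expr0n addr0 sqrtr_sqr. Qed.
Lemma nrm1 : nrm (1 : C R) = 1. Proof. by rewrite /nrm normr1. Qed.
Lemma nrmX z k : nrm (z ^+ k) = nrm z ^+ k.
Proof. by elim: k => [|k IH]; rewrite ?expr0 ?nrm1// !exprS nrmM IH. Qed.
Lemma nrm_sqr z : nrm z ^+ 2 = reC z ^+ 2 + imC z ^+ 2.
Proof. by rewrite /nrm normc_def /= sqr_sqrtr // addr_ge0 ?sqr_ge0. Qed.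
Lemma nrm_mkC (a b : R) : nrm (mkC a b) = Num.sqrt (a ^+ 2 + b ^+ 2).
Proof. by rewrite /nrm normc_def. Qed.
Lemma nrm_conj z : nrm (z^*) = nrm z.
Proof. by rewrite /nrm norm_conjC. Qed.

Lemma reCD z w : reC (z + w) = reC z + reC w. Proof. by case: z; case: w. Qed.
Lemma imCD z w : imC (z + w) = imC z + imC w. Proof. by case: z; case: w. Qed.
Lemma reCB z w : reC (z - w) = reC z - reC w. Proof. by case: z; case: w. Qed.
Lemma imCB z w : imC (z - w) = imC z - imC w. Proof. by case: z; case: w. Qed.
Lemma reCM z w : reC (z * w) = reC z * reC w - imC z * imC w.
Proof. by case: z; case: w. Qed.
Lemma imCM z w : imC (z * w) = reC z * imC w + imC z * reC w.
Proof. by case: z; case: w. Qed.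
Lemma reC_conj z : reC z^* = reC z. Proof. by case: z. Qed.
Lemma imC_conj z : imC z^* = - imC z. Proof. by case: z. Qed.

Lemma re_le z : `|reC z| <= nrm z.
Proof.
rewrite -[nrm z]ger0_norm ?nrm_ge0// -ler_sqr ?nnegrE// !real_normK ?num_real//.
by rewrite nrm_sqr lerDl sqr_ge0.
Qed.
Lemma im_le z : `|imC z| <= nrm z.
Proof.
rewrite -[nrm z]ger0_norm ?nrm_ge0// -ler_sqr ?nnegrE// !real_normK ?num_real//.
by rewrite nrm_sqr lerDr sqr_ge0.
Qed.
Lemma nrm_le z : nrm z <= `|reC z| + `|imC z|.
Proof.
rewrite -[nrm z]ger0_norm ?nrm_ge0//.
rewrite -ler_sqr ?nnegrE ?addr_ge0// real_normK ?num_real// nrm_sqr.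
rewrite sqrrD !real_normK ?num_real// -addrA [_ *+ 2 + _]addrC addrA.
by rewrite lerDl mulrn_wge0 // mulr_ge0.
Qed.

Lemma nrm_nbhsP V (p : V) (P : set V) :
  nbhs p P <-> exists2 e : R, 0 < e & forall x, nrm (x - p) < e -> P x.
Proof.
split=> [/nbhs_normP[e /= e0 eP]|[e e0 eP]].
  have ee : e = rC (reC e).
    by move: e0; case: (e) => a b; rewrite ltcE /= => /andP[/eqP-> _].
  rewrite ee in e0 eP; exists (reC e); first by rewrite -ltrC.
  by move=> x xe; apply: eP; rewrite /= distrC nrmE ltrC.
apply/nbhs_normP; exists (rC e) => /=; first by rewrite -[0]rC0 ltrC.
by move=> x /=; rewrite distrC nrmE ltrC; exact: eP.
Qed.

Lemma real_nbhsP (V : normedModType R) (p : V) (P : set V) :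
  nbhs p P <-> exists2 e : R, 0 < e & forall x, `|x - p| < e -> P x.
Proof.
split=> [/nbhs_normP[e /= e0 eP]|[e e0 eP]].
  by exists e => // x xe; apply: eP; rewrite /= distrC.
by apply/nbhs_normP; exists e => // x /=; rewrite distrC; exact: eP.
Qed.

Lemma cvg_nrmP (T : Type) (F : set_system T) (FF : Filter F) V (f : T -> V) (l : V) :
  f @ F --> l <-> forall e : R, 0 < e -> \forall x \near F, nrm (f x - l) < e.
Proof.
split=> [fl e e0|fl P /nrm_nbhsP[e e0 eP]].
  have /fl : nbhs l [set v | nrm (v - l) < e] by apply/nrm_nbhsP; exists e.
  by [].
by apply: filterS (fl _ e0) => x /eP.
Qed.

Lemma continuous_realP V (f : V -> R) (p : V) : {for p, continuous f} <->
  forall e : R, 0 < e -> exists2 d : R, 0 < d & forall x, nrm (x - p) < d -> `|f x - f p| < e.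
Proof.
split=> [fp e e0|fp].
  apply/nrm_nbhsP; have /cvgrPdist_lt/(_ e e0) := fp.
  by apply: filterS => x; rewrite distrC.
apply/cvgrPdist_lt => e e0; apply/nrm_nbhsP; have [d d0 dP] := fp _ e0.
by exists d => // x /dP; rewrite distrC.
Qed.

Lemma nrm_ler_dist V (x v : V) : `|nrm x - nrm v| <= nrm (x - v).
Proof.
rewrite ler_norml lerBlDr.
have h1 := nrmD (x - v) v; have h2 := nrmD (v - x) x; rewrite !subrK in h1 h2.
by rewrite h1 andbT lerNl opprB lerBlDr nrmC.
Qed.

Lemma continuous_nrm V : continuous (@nrm V).
Proof.
move=> v; apply/continuous_realP => e e0; exists e => // x xv.
exact: le_lt_trans (nrm_ler_dist _ _) xv.
Qed.

Lemma continuous_reC : continuous (@reC R : C R -> R).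
Proof.
move=> v; apply/(@continuous_realP (C R)) => e e0; exists e => // x xv.
by apply: le_lt_trans xv; rewrite -reCB re_le.
Qed.
Lemma continuous_imC : continuous (@imC R : C R -> R).
Proof.
move=> v; apply/(@continuous_realP (C R)) => e e0; exists e => // x xv.
by apply: le_lt_trans xv; rewrite -imCB im_le.
Qed.
Lemma cvg_mkC (T : Type) (F : set_system T) (FF : Filter F) (f g : T -> R) (a b : R) :
  f @ F --> a -> g @ F --> b -> (fun t => mkC (f t) (g t)) @ F --> mkC a b.
Proof.
move=> /cvgrPdist_lt fa /cvgrPdist_lt gb; apply/cvg_nrmP => e e0.
have e2 : 0 < e / 2 by rewrite divr_gt0.
apply: filterS2 (fa _ e2) (gb _ e2) => t h1 h2.
apply: le_lt_trans (nrm_le _) _; rewrite reCB imCB /= [e]splitr.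
by rewrite ltrD // distrC.
Qed.

End ComplexNorm.

(** * Differentials and complex derivatives with real radii *)

Section Differentials.
Variable R : realType.

Lemma diff_near (K : numFieldType) (V W : normedModType K) (f : V -> W) (x : V) :
  differentiable f x -> forall e : K, 0 < e ->
  \forall h \near (0 : V), `|f (x + h) - f x - 'd f x h| <= e * `|h|.
Proof.
move=> df e e0; have [_ /eqaddoP/(_ e e0)] := (diff_locallyP x f).1 df.
apply: filterS => h; rewrite -[X in X <= _ -> _]/(`|f (h + x) - (f x + 'd f x h)|).
by rewrite [h + x]addrC opprD addrA.
Qed.

Lemma diff_of_near (K : numFieldType) (V W : normedModType K) (f : V -> W) (x : V)
    (L : {linear V -> W}) : continuous L ->
  (forall e : K, 0 < e ->
    \forall h \near (0 : V), `|f (x + h) - f x - L h| <= e * `|h|) ->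
  is_diff x f L.
Proof.
move=> cL H.
have E : f \o shift x = cst (f x) + L +o_ 0 id.
  apply/eqaddoP => e e0; apply: filterS (H e e0) => h.
  rewrite -[X in _ -> X <= _]/(`|f (h + x) - (f x + L h)|).
  by rewrite [h + x]addrC opprD addrA.
have dE := diff_unique cL E.
apply: DiffDef; last by rewrite dE.
by apply/diff_locallyP; rewrite dE.
Qed.

Section Complex.
Variables (V W : normedModType (C R)).
Implicit Types (f : V -> W) (L : V -> W).

Lemma cdiffP f x : differentiable f x -> forall e : R, 0 < e ->
  exists2 d : R, 0 < d & forall h, nrm h < d ->
    nrm (f (x + h) - f x - 'd f x h) <= e * nrm h.
Proof.
move=> df e e0.
have /nrm_nbhsP[d d0 dP] : \forall h \near (0 : V),
    `|f (x + h) - f x - 'd f x h| <= rC e * `|h|.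
  by apply: diff_near => //; rewrite -[0]rC0 ltrC.
by exists d => // h hd; have := dP h; rewrite subr0 !nrmE -rCM lerC; exact.
Qed.

Lemma bounded_linear_continuous (L : {linear V -> W}) :
  (exists B, forall h, nrm (L h) <= B * nrm h) -> continuous L.
Proof.
move=> [B LB] p; apply/cvg_nrmP => e e0; apply/nrm_nbhsP.
have B1 : 0 < `|B| + 1 by rewrite ltr_wpDl.
exists (e / (`|B| + 1)); first by rewrite divr_gt0.
move=> x; rewrite ltr_pdivlMr // mulrC => xp; rewrite -linearB.
apply: le_lt_trans (LB _) _; apply: le_lt_trans xp.
by rewrite ler_wpM2r ?nrm_ge0// (le_trans (ler_norm _)) // lerDl.
Qed.

Lemma linear_continuous_bounded (L : {linear V -> W}) :
  continuous L -> exists2 B, 0 < B & forall h, nrm (L h) <= B * nrm h.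
Proof.
move=> cL; have /cvg_nrmP/(_ 1 ltr01) := cL 0.
rewrite linear0 => /nrm_nbhsP[d d0 dP].
exists (2 / d); first by rewrite divr_gt0.
move=> h; have [->|h0] := eqVneq h 0; first by rewrite linear0 !nrm0 mulr0.
have n0 : 0 < nrm h by rewrite nrm_gt0.
(* The vector is rescaled to norm d / 2, strictly inside the ball on which [L] stays below 1. *)
have := dP (rC (d / (2 * nrm h)) *: h).
rewrite !subr0 linearZ_LR !nrmZ nrm_rC ger0_norm; last first.
  by rewrite divr_ge0 ?mulr_ge0 ?ltW.
rewrite invfM mulrA -mulrA mulVf ?gt_eqF// mulr1 => /(_ _)/ltW HH.
have : d / 2 < d by rewrite ltr_pdivrMr // mulr_natr mulr2n ltrDl.
move=> /HH; rewrite -mulrA (mulrC _ (nrm (L h))) mulrA ler_pdivrMr // mul1r.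
by rewrite mulrC -ler_pdivlMr ?divr_gt0// => /le_trans; apply; rewrite invf_div mulrC.
Qed.

Lemma cdiffI f x L : linear L -> (exists B, forall h, nrm (L h) <= B * nrm h) ->
  (forall e : R, 0 < e -> exists2 d : R, 0 < d & forall h, nrm h < d ->
    nrm (f (x + h) - f x - L h) <= e * nrm h) ->
  is_diff x f L.
Proof.
move=> linL bL H.
pose LL : {linear V -> W} := HB.pack L (GRing.isLinear.Build _ _ _ _ L linL).
apply: (@diff_of_near _ _ _ f x LL); first exact: bounded_linear_continuous.
move=> e e0.
have ee : e = rC (reC e).
  by move: e0; case: (e) => a b; rewrite ltcE /= => /andP[/eqP-> _].
rewrite ee in e0 *; rewrite -[0]rC0 ltrC in e0; have [d d0 dP] := H _ e0.
apply/nrm_nbhsP; exists d => // h; rewrite subr0 => /dP.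
by rewrite !nrmE -rCM lerC.
Qed.

Lemma continuous_nrmP f p : {for p, continuous f} <->
  forall e : R, 0 < e -> exists2 d : R, 0 < d & forall x, nrm (x - p) < d -> nrm (f x - f p) < e.
Proof.
split=> [fp e e0|fp].
  by apply/nrm_nbhsP; have /cvg_nrmP/(_ e e0) := fp.
by apply/cvg_nrmP => e e0; apply/nrm_nbhsP; exact: fp.
Qed.

End Complex.

Section ComplexLine.
Variables (W : normedModType (C R)).
Implicit Types (f : C R -> W) (z : C R).

(** Epsilon form of the complex derivative without division by the increment: it covers
    vector-valued [f] and combines directly with Taylor-type bounds. *)
Definition is_cder f z (d : W) := forall e : R, 0 < e ->
  exists2 r : R, 0 < r & forall h : C R, nrm h < r ->
    nrm (f (z + h) - f z - h *: d) <= e * nrm h.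

Lemma is_cder_diff f z d : is_cder f z d -> is_diff z f ( *:%R ^~ d).
Proof.
move=> H; apply: cdiffI.
- by move=> a u v; rewrite scalerDl scalerA.
- by exists (nrm d) => h; rewrite nrmZ mulrC.
- exact: H.
Qed.

Lemma is_cderP f z d : is_cder f z d <-> derivable f z 1 /\ derive1 f z = d.
Proof.
split.
  move=> /is_cder_diff[df dv]; split; first exact/derivable1_diffP.
  by rewrite derive1E' // dv scale1r.
move=> [/derivable1_diffP df <-] e e0; have [r r0 rP] := cdiffP df e0.
exists r => // h /rP.
suff -> : 'd f z h = h *: derive1 f z by [].
by rewrite derive1E' // -[in LHS](mulr1 h) -[h * 1]/(h *: (1 : C R)) linearZ_LR.
Qed.

Lemma derivable_is_cder f z : derivable f z 1 -> is_cder f z (derive1 f z).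
Proof. by move=> fz; apply/is_cderP. Qed.

Lemma is_cder_continuous f z d : is_cder f z d -> {for z, continuous f}.
Proof. by move=> /is_cder_diff[/differentiable_continuous]. Qed.

Lemma is_cder_near f g z d : is_cder f z d -> (\forall w \near z, f w = g w) -> is_cder g z d.
Proof.
move=> fd /nrm_nbhsP[r r0 rP] e e0; have [s s0 sP] := fd e e0.
exists (Num.min r s); first by rewrite lt_min r0.
move=> h; rewrite lt_min => /andP[hr hs].
rewrite -rP ?[z + h]addrC ?addrK// -rP ?subrr ?nrm0// addrC; exact: sP.
Qed.

Lemma is_cder_ext f g z d : (forall w, f w = g w) -> is_cder f z d -> is_cder g z d.
Proof. by move=> /funext ->. Qed.

Lemma is_cder_cst (c : W) z : is_cder (fun=> c) z 0.
Proof. by move=> e e0; exists 1 => // h _; rewrite scaler0 subr0 subrr nrm0 mulr_ge0 ?nrm_ge0 ?ltW. Qed.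

Lemma is_cderD f g z a b : is_cder f z a -> is_cder g z b ->
  is_cder (fun w => f w + g w) z (a + b).
Proof.
move=> fa gb e e0; have e2 : 0 < e / 2 by rewrite divr_gt0.
have [r r0 rP] := fa _ e2; have [s s0 sP] := gb _ e2.
exists (Num.min r s); first by rewrite lt_min r0.
move=> h; rewrite lt_min => /andP[/rP H1 /sP H2].
rewrite scalerDr opprD addrACA [- (_ + _)]opprD [X in nrm X]addrACA.
by rewrite [e]splitr mulrDl (le_trans (nrmD _ _)) // lerD.
Qed.

Lemma is_cderZ f z a (c : C R) : is_cder f z a -> is_cder (fun w => c *: f w) z (c *: a).
Proof.
move=> fa e e0; have c0 : 0 < nrm c + 1 by rewrite ltr_wpDl ?nrm_ge0.
have [r r0 rP] := fa _ (divr_gt0 e0 c0).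
exists r => // h /rP; rewrite scalerA [h * c]mulrC -scalerA -!scalerBr nrmZ => H.
apply: (@le_trans _ _ (nrm c * (e / (nrm c + 1) * nrm h))).
  by rewrite ler_wpM2l ?nrm_ge0.
rewrite mulrA ler_wpM2r ?nrm_ge0// mulrA ler_pdivrMr // mulrC.
by rewrite ler_pM2l // lerDl.
Qed.

Lemma is_cderB f g z a b : is_cder f z a -> is_cder g z b ->
  is_cder (fun w => f w - g w) z (a - b).
Proof.
move=> fa gb; have := is_cderD fa (is_cderZ (-1) gb); rewrite scaleN1r.
by apply: is_cder_ext => w; rewrite scaleN1r.
Qed.
End ComplexLine.

Lemma is_cder_comp (W : normedModType (C R)) (g : C R -> W) (f : C R -> C R) z a b :
  is_cder f z a -> is_cder g (f z) b -> is_cder (g \o f) z (a *: b).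
Proof.
move=> /is_cder_diff fa /is_cder_diff gb.
have [df dv] : is_diff z (g \o f) (( *:%R ^~ b) \o ( *:%R ^~ a)) by exact: is_diff_comp.
apply/is_cderP; split; first exact/derivable1_diffP.
by rewrite derive1E' // dv /= scale1r.
Qed.

Lemma diff_comp_cder (V W : normedModType (C R)) (g : V -> W) (f : C R -> V) z a :
  is_cder f z a -> differentiable g (f z) -> is_cder (g \o f) z ('d g (f z) a).
Proof.
move=> /is_cder_diff fa /differentiableP gb.
have [df dv] : is_diff z (g \o f) ('d g (f z) \o ( *:%R ^~ a)) by exact: is_diff_comp.
apply/is_cderP; split; first exact/derivable1_diffP.
by rewrite derive1E' // dv /= scale1r.
Qed.

Lemma is_cder_id (z : C R) : is_cder (id : C R -> C R) z 1.
Proof. by move=> e e0; exists 1 => // h _; rewrite [h *: 1]mulr1 [z + h]addrC addrK subrr nrm0 mulr_ge0 ?nrm_ge0 ?ltW. Qed.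

Lemma is_cderM (f g : C R -> C R) z a b : is_cder f z a -> is_cder g z b ->
  is_cder (fun w => f w * g w) z (a * g z + f z * b).
Proof.
move=> /is_cderP[fa <-] /is_cderP[gb <-]; apply/is_cderP.
have -> : (fun w => f w * g w) = (f \* g) by [].
have fa' := derivableP fa; have gb' := derivableP gb.
have H := is_deriveM fa' gb'.
split; first exact: (@ex_derive _ _ _ _ _ _ _ H).
rewrite [LHS]derive1E (@derive_val _ _ _ _ _ _ _ H) !derive1E.
by rewrite addrC [_ *: 'D_1 f z]mulrC.
Qed.

Lemma is_cderV (f : C R -> C R) z a : is_cder f z a -> f z != 0 ->
  is_cder (fun w => (f w)^-1) z (- a / f z ^+ 2).
Proof.
move=> /is_cderP[fa <-] f0; apply/is_cderP; split.
  exact: (@derivableV _ _ f z 1 f0 fa).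
rewrite !derive1E (@deriveV _ _ f z 1 f0 fa).
by rewrite -[_ *: _]/(- (f z ^- 2) * 'D_1 f z) !mulNr mulrC.
Qed.
End Differentials.

(** * Cauchy theory in one variable *)

Section Goursat.
Variable R : realType.

Lemma cvgB_nrm (V : normedModType (C R)) (T : Type) (F : set_system T) {FF : Filter F}
    (f g : T -> V) (a b : V) :
  f @ F --> a -> g @ F --> b -> (fun t => f t - g t) @ F --> a - b.
Proof. exact: cvgB. Qed.

Lemma half_pow (c : R) n : c / 2 ^+ n = c / 2 ^+ n.+1 + c / 2 ^+ n.+1.
Proof.
have ne : (2 ^+ n : R) != 0 by rewrite expf_neq0.
by rewrite exprS; field.
Qed.

Local Notation mu := (@lebesgue_measure R).

Definition rint (f : R -> R) (a b : R) : R := \int[mu]_(x in `[a, b]) f x.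

Definition cont_on (T : topologicalType) (f : R -> T) (a b : R) :=
  forall x, a <= x <= b -> {for x, continuous f}.

Lemma cont_on_integrable (f : R -> R) a b : cont_on f a b ->
  mu.-integrable `[a, b] (EFin \o f).
Proof.
move=> cf; apply: continuous_compact_integrable; first exact: segment_compact.
apply: continuous_in_subspaceT => x; rewrite inE /= in_itv /=; exact: cf.
Qed.

Lemma rint_cst (c a b : R) : a <= b -> rint (fun=> c) a b = c * (b - a).
Proof.
move=> ab; rewrite /rint Rintegral_cst //= lebesgue_measure_itv /= lte_fin.
by case: ltgtP ab => //= -> _; rewrite subrr.
Qed.

Lemma rintB (f g : R -> R) a b : cont_on f a b -> cont_on g a b ->
  rint (fun x => f x - g x) a b = rint f a b - rint g a b.
Proof. by move=> cf cg; rewrite /rint RintegralB //; exact: cont_on_integrable. Qed.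

Lemma rint_le (f : R -> R) M a b : a <= b -> cont_on f a b ->
  (forall x, a <= x <= b -> `|f x| <= M) -> `|rint f a b| <= M * (b - a).
Proof.
move=> ab cf fM; rewrite -rint_cst //.
apply: le_trans (le_normr_Rintegral _ _) _ => //; first exact: cont_on_integrable.
apply: le_Rintegral => //.
- have := cont_on_integrable cf; by move/integrable_abse.
- by apply: cont_on_integrable => x _; exact: cvg_cst.
Qed.

Lemma rint_add (f : R -> R) a b c : a <= b -> b <= c -> cont_on f a c ->
  rint f a c = rint f a b + rint f b c.
Proof.
move=> ab bc cf; have If := cont_on_integrable cf.
have := @Rintegral_itvB R f (BLeft a) (BRight c) b If.
rewrite !bnd_simp => /(_ ab bc) /eqP; rewrite subr_eq => /eqP.
rewrite /rint addrC => ->; congr (_ + _); apply: Rintegral_itv_obnd_cbnd.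
apply: integrableS If => //= x /=; rewrite !in_itv /= => /andP[bx ->].
by rewrite (le_trans ab (ltW bx)).
Qed.

Definition cint (g : R -> C R) (a b : R) : C R :=
  mkC (rint (fun x => reC (g x)) a b) (rint (fun x => imC (g x)) a b).

Lemma cont_re (g : R -> C R) a b : cont_on g a b -> cont_on (fun x => reC (g x)) a b.
Proof. by move=> cg x /cg H; apply: (cvg_comp _ _ H); exact: continuous_reC. Qed.
Lemma cont_im (g : R -> C R) a b : cont_on g a b -> cont_on (fun x => imC (g x)) a b.
Proof. by move=> cg x /cg H; apply: (cvg_comp _ _ H); exact: continuous_imC. Qed.

Lemma cint_cst (c : C R) a b : a <= b -> cint (fun=> c) a b = rC (b - a) * c.
Proof.
move=> ab; rewrite /cint !rint_cst //; apply: mkCP; rewrite ?reCM ?imCM /=.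
  by rewrite mul0r subr0 mulrC.
by rewrite mul0r addr0 mulrC.
Qed.

Lemma cintB (f g : R -> C R) a b : cont_on f a b -> cont_on g a b ->
  cint (fun x => f x - g x) a b = cint f a b - cint g a b.
Proof.
move=> cf cg; apply: mkCP; rewrite ?reCB ?imCB /= -rintB; try exact: cont_re; try exact: cont_im.
  by congr rint; apply/funext => x; rewrite reCB.
by congr rint; apply/funext => x; rewrite imCB.
Qed.

(** Real and imaginary parts are bounded separately, whence the factor 2; it enters every later
    Cauchy constant and is harmless. *)
Lemma cint_le (g : R -> C R) M a b : a <= b -> cont_on g a b ->
  (forall x, a <= x <= b -> nrm (g x) <= M) -> nrm (cint g a b) <= 2 * M * (b - a).
Proof.
move=> ab cg gM; apply: le_trans (nrm_le _) _ => /=.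
rewrite -mulrA mulr_natl mulr2n; apply: lerD; apply: rint_le => //.
- exact: cont_re.
- by move=> x /gM; apply: le_trans (re_le _).
- exact: cont_im.
- by move=> x /gM; apply: le_trans (im_le _).
Qed.

Lemma cint_add (f : R -> C R) a b c : a <= b -> b <= c -> cont_on f a c ->
  cint f a c = cint f a b + cint f b c.
Proof.
move=> ab bc cf; apply: mkCP; rewrite ?reCD ?imCD /=; apply: rint_add => //.
  exact: cont_re.
exact: cont_im.
Qed.

Definition Ic : C R := mkC 0 1.

Lemma mkCE a b : mkC a b = rC a + Ic * rC b.
Proof.
by apply: mkCP; rewrite ?reCD ?imCD ?reCM ?imCM /=; rewrite ?(mul0r, mulr0, mul1r, subr0, addr0, add0r).
Qed.

(* The counterclockwise integral of [F dz] around [a, b] x [c, d]: [cint] integrates against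
   a real differential, hence the factor [Ic] on the vertical sides. *)
Definition boundary (F : C R -> C R) a b c d : C R :=
  cint (fun s => F (mkC s c)) a b - cint (fun s => F (mkC s d)) a b
  + Ic * (cint (fun t => F (mkC b t)) c d - cint (fun t => F (mkC a t)) c d).

Definition holo_rect (F : C R -> C R) a b c d :=
  forall s t, a <= s <= b -> c <= t <= d -> derivable F (mkC s t) 1.

Lemma continuous_mkCl (t s : R) : {for s, continuous (fun s => mkC s t)}.
Proof. by apply: cvg_mkC; [exact: cvg_id | exact: cvg_cst]. Qed.
Lemma continuous_mkCr (s t : R) : {for t, continuous (fun t => mkC s t)}.
Proof. by apply: cvg_mkC; [exact: cvg_cst | exact: cvg_id]. Qed.

Definition cont_rect (F : C R -> C R) a b c d :=
  forall s t, a <= s <= b -> c <= t <= d -> {for (mkC s t), continuous F}.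

Lemma holo_cont_rect F a b c d : holo_rect F a b c d -> cont_rect F a b c d.
Proof.
by move=> H s t sab tcd; have /derivable_is_cder/is_cder_continuous := H s t sab tcd.
Qed.

Lemma cont_horizontal F a b c d t : cont_rect F a b c d -> c <= t <= d ->
  cont_on (fun s => F (mkC s t)) a b.
Proof.
move=> cF tcd s sab.
exact: (@continuous_comp _ _ _ (fun s => mkC s t) F s (@continuous_mkCl t s) (cF s t sab tcd)).
Qed.
Lemma cont_vertical F a b c d s : cont_rect F a b c d -> a <= s <= b ->
  cont_on (fun t => F (mkC s t)) c d.
Proof.
move=> cF tcd t sab.
exact: (@continuous_comp _ _ _ (fun t => mkC s t) F t (@continuous_mkCr s t) (cF s t tcd sab)).
Qed.

(** Each inner side is traversed twice in opposite directions, so its contributions cancel. *)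
Lemma boundary_split F a m b c k d : a <= m -> m <= b -> c <= k -> k <= d ->
  cont_rect F a b c d ->
  boundary F a b c d = boundary F a m c k + boundary F m b c k
    + boundary F a m k d + boundary F m b k d.
Proof.
move=> am mb ck kd cF.
have ab := le_trans am mb; have cd := le_trans ck kd.
have H t : c <= t <= d -> cint (fun s => F (mkC s t)) a b =
  cint (fun s => F (mkC s t)) a m + cint (fun s => F (mkC s t)) m b.
  by move=> tcd; apply: cint_add => //; exact: cont_horizontal cF tcd.
have V s : a <= s <= b -> cint (fun t => F (mkC s t)) c d =
  cint (fun t => F (mkC s t)) c k + cint (fun t => F (mkC s t)) k d.
  by move=> sab; apply: cint_add => //; exact: cont_vertical cF sab.
rewrite /boundary (H c) ?lexx// (H d) ?lexx ?cd// (V a) ?lexx// (V b) ?lexx ?ab//.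
ring.
Qed.

(** The boundary integral of an affine function vanishes, so only the deviation from it counts: two
    opposite sides at a time, each side with the factor 2 of [cint_le]. *)
Lemma boundary_affine_err F A B (p : C R) eps a b c d : a <= b -> c <= d ->
  cont_rect F a b c d ->
  (forall s t, a <= s <= b -> c <= t <= d ->
    nrm (F (mkC s t) - (A + B * mkC s t)) <= eps) ->
  nrm (boundary F a b c d) <= 4 * eps * ((b - a) + (d - c)).
Proof.
move=> ab cd cF err.
pose L z := A + B * z; pose E z := F z - L z.
have cL : cont_rect L a b c d.
  move=> s t _ _; rewrite /L.
  have := is_cderD (is_cder_cst A (mkC s t)) (is_cderM (is_cder_cst B (mkC s t)) (is_cder_id (mkC s t))).
  by move/is_cder_continuous.
have cE : cont_rect E a b c d.
  by move=> s t sab tcd; exact: cvgB_nrm (cF s t sab tcd) (cL s t sab tcd).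
have acb : a <= a <= b by rewrite lexx. have bcb : a <= b <= b by rewrite lexx ab.
have ccd : c <= c <= d by rewrite lexx. have dcd : c <= d <= d by rewrite lexx cd.
have EH t : c <= t <= d -> cint (fun s => F (mkC s t)) a b =
    cint (fun s => E (mkC s t)) a b + cint (fun s => L (mkC s t)) a b.
  move=> tcd; rewrite /E cintB ?subrK//; first exact: cont_horizontal cF tcd.
  exact: cont_horizontal cL tcd.
have EV s : a <= s <= b -> cint (fun t => F (mkC s t)) c d =
    cint (fun t => E (mkC s t)) c d + cint (fun t => L (mkC s t)) c d.
  move=> sab; rewrite /E cintB ?subrK//; first exact: cont_vertical cF sab.
  exact: cont_vertical cL sab.
have L1 : cint (fun s => L (mkC s c)) a b - cint (fun s => L (mkC s d)) a b =
    rC (b - a) * (B * Ic * rC (c - d)).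
  rewrite -cintB; [|exact: cont_horizontal cL ccd|exact: cont_horizontal cL dcd].
  rewrite -cint_cst //; congr cint; apply/funext => s.
  rewrite /L !mkCE rCB; ring.
have L2 : cint (fun t => L (mkC b t)) c d - cint (fun t => L (mkC a t)) c d =
    rC (d - c) * (B * rC (b - a)).
  rewrite -cintB; [|exact: cont_vertical cL bcb|exact: cont_vertical cL acb].
  rewrite -cint_cst //; congr cint; apply/funext => s.
  rewrite /L !mkCE rCB; ring.
(* The value in [L1] and [Ic] times the value in [L2] are opposite, so the affine part drops out. *)
have -> : boundary F a b c d = boundary E a b c d.
  rewrite /boundary !EH // !EV //.
  set e1 := cint _ a b; set e2 := cint (fun s => L (mkC s c)) a b.
  move: L1; rewrite -/e2 => /eqP; rewrite subr_eq => /eqP ->.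
  move: L2 => /eqP; rewrite subr_eq => /eqP ->; rewrite !rCB; ring.
have e0 : 0 <= eps by apply: le_trans (err a c _ _) => //; exact: nrm_ge0.
rewrite /boundary; apply: le_trans (nrmD _ _) _; rewrite nrmM.
have -> : nrm Ic = 1 by rewrite nrm_mkC expr0n expr1n add0r sqrtr1.
rewrite mul1r mulrDr; apply: lerD.
  apply: le_trans (nrmB _ _) _.
  have := cint_le ab (cont_horizontal cE ccd) (fun s sab => err s c sab ccd).
  have := cint_le ab (cont_horizontal cE dcd) (fun s sab => err s d sab dcd).
  by move=> h1 h2; apply: le_trans (lerD h2 h1) _; rewrite le_eqVlt; apply/orP; left; apply/eqP; ring.
apply: le_trans (nrmB _ _) _.
have := cint_le cd (cont_vertical cE acb) (fun s sab => err a s acb sab).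
have := cint_le cd (cont_vertical cE bcb) (fun s sab => err b s bcb sab).
by move=> h1 h2; apply: le_trans (lerD h1 h2) _; rewrite le_eqVlt; apply/orP; left; apply/eqP; ring.
Qed.

Lemma half_pow_lt (x e : R) : 0 < e -> exists n : nat, x / 2 ^+ n < e.
Proof.
move=> e0; have [n xn] : exists n : nat, `|x| / e < n%:R.
  by exists (Num.truncn (`|x| / e)).+1; rewrite truncnS_gt.
exists n.
rewrite ltr_pdivrMr ?exprn_gt0//; apply: le_lt_trans (ler_norm _) _.
rewrite -ltr_pdivrMl // mulrC; apply: lt_le_trans xn _.
by rewrite -natrX ler_nat ltnW // ltn_expl.
Qed.

(* [P n x y] is meant for the rectangle with corner [(x, y)] and sides [w / 2 ^ n], [h / 2 ^ n]. *)
Lemma nested_rectangles (P : nat -> R -> R -> Prop) (w h : R) :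
  0 <= w -> 0 <= h ->
  (forall n x y, P n x y -> exists i j : bool,
     P n.+1 (x + i%:R * (w / 2 ^+ n.+1)) (y + j%:R * (h / 2 ^+ n.+1))) ->
  forall x0 y0, P 0%N x0 y0 ->
  exists x y : R, [/\ x0 <= x <= x0 + w, y0 <= y <= y0 + h & forall n,
    exists xn yn, [/\ P n xn yn, x0 <= xn /\ xn + w / 2 ^+ n <= x0 + w,
      y0 <= yn /\ yn + h / 2 ^+ n <= y0 + h,
      xn <= x <= xn + w / 2 ^+ n & yn <= y <= yn + h / 2 ^+ n]].
Proof.
move=> w0 h0 step x0 y0 P0.
(* Dependent choice: the rectangles satisfying [P] form a type on which [step] selects a
   successor. *)
pose S := {q : nat * R * R | P q.1.1 q.1.2 q.2}.
have next (q : S) : {q' : S | exists i j : bool,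
    sval q' = ((sval q).1.1.+1, (sval q).1.2 + i%:R * (w / 2 ^+ (sval q).1.1.+1),
               (sval q).2 + j%:R * (h / 2 ^+ (sval q).1.1.+1))}.
  apply: cid; case: q => [[[n x] y] /= Pq]; have [i [j Pij]] := step _ _ _ Pq.
  by exists (exist _ (n.+1, _, _) Pij); exists i, j.
pose q := fix q n : S := if n is m.+1 then sval (next (q m)) else exist _ (0%N, x0, y0) P0.
have qn n : (sval (q n)).1.1 = n.
  by elim: n => [//|n IH] /=; case: (next (q n)) => q' [i [j /= ->]] /=; rewrite IH.
pose xs n := (sval (q n)).1.2; pose ys n := (sval (q n)).2.
have xS n : xs n <= xs n.+1 /\ xs n.+1 + w / 2 ^+ n.+1 <= xs n + w / 2 ^+ n.
  rewrite /xs /=; case: (next (q n)) => q' [i [j /= ->]] /=; rewrite qn.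
  have W0 : 0 <= w / 2 ^+ n.+1 by rewrite divr_ge0 ?exprn_ge0.
  by rewrite (half_pow w n); case: i; rewrite ?mul1r ?mul0r ?addr0; split; lra.
have yS n : ys n <= ys n.+1 /\ ys n.+1 + h / 2 ^+ n.+1 <= ys n + h / 2 ^+ n.
  rewrite /ys /=; case: (next (q n)) => q' [i [j /= ->]] /=; rewrite qn.
  have W0 : 0 <= h / 2 ^+ n.+1 by rewrite divr_ge0 ?exprn_ge0.
  by rewrite (half_pow h n); case: j; rewrite ?mul1r ?mul0r ?addr0; split; lra.
(* The common point is the supremum of the left end points. *)
have lim (u : nat -> R) c : 0 <= c ->
    (forall n, u n <= u n.+1 /\ u n.+1 + c / 2 ^+ n.+1 <= u n + c / 2 ^+ n) ->
    exists l, forall n, u n <= l <= u n + c / 2 ^+ n.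
  move=> c0 uS.
  have up m n : (m <= n)%N -> u m <= u n /\ u n + c / 2 ^+ n <= u m + c / 2 ^+ m.
    elim: n => [|n IH]; first by rewrite leqn0 => /eqP ->.
    rewrite leq_eqVlt => /orP[/eqP -> //|/IH[h1 h2]].
    by have [h3 h4] := uS n; split; [exact: le_trans h1 h3|exact: le_trans h4 h2].
  have cn n : 0 <= c / 2 ^+ n by rewrite divr_ge0 ?exprn_ge0.
  have ub n : ubound (range u) (u n + c / 2 ^+ n).
    move=> _ [m _ <-]; case: (leqP m n) => [/up[h1 _]|/ltnW/up[_ h2]].
      by rewrite (le_trans h1) // lerDl.
    by apply: le_trans h2; rewrite lerDl.
  exists (sup (range u)) => n; apply/andP; split.
    by apply: ub_le_sup; [exists (u 0%N + c / 2 ^+ 0); exact: ub | exists n].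
  by apply: ge_sup; [exists (u 0%N), 0%N | exact: ub].
have [x xP] := lim xs w w0 xS; have [y yP] := lim ys h h0 yS.
have mono (u : nat -> R) c n : (forall n, u n <= u n.+1 /\ u n.+1 + c / 2 ^+ n.+1 <= u n + c / 2 ^+ n) ->
   u 0%N <= u n /\ u n + c / 2 ^+ n <= u 0%N + c.
  move=> uS; elim: n => [|n [h1 h2]]; first by rewrite expr0 divr1.
  by have [h3 h4] := uS n; split; [exact: le_trans h1 h3|exact: le_trans h4 h2].
exists x, y; split; [have := xP 0%N|have := yP 0%N|]; rewrite ?expr0 ?divr1 //.
move=> n; exists (xs n), (ys n); split => //; [|exact: mono xS|exact: mono yS].
by have := svalP (q n); rewrite qn.
Qed.

(** Bisection: a nonzero integral of modulus eta leaves at least eta / 4^n on some n-th rectangle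
    around a common point, where the affine approximation of [F] makes the integral o(4^-n). *)
Theorem goursat F a b c d : a < b -> c < d -> holo_rect F a b c d ->
  boundary F a b c d = 0.
Proof.
move=> ab cd hF; apply/eqP; rewrite -nrm_eq0; apply/negPn/negP => eta0.
have eta1 : 0 < nrm (boundary F a b c d) by rewrite lt_neqAle eq_sym eta0 nrm_ge0.
set eta := nrm _ in eta1.
pose w := b - a; pose h := d - c.
have w0 : 0 < w by rewrite subr_gt0. have h0 : 0 < h by rewrite subr_gt0.
pose P n x y := [/\ a <= x, x + w / 2 ^+ n <= b, c <= y, y + h / 2 ^+ n <= d &
  eta / 4 ^+ n <= nrm (boundary F x (x + w / 2 ^+ n) y (y + h / 2 ^+ n))].
have cF := holo_cont_rect hF.
have P0 : P 0%N a c.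
  by rewrite /P !expr0 !divr1 /w /h [a + _]addrC [c + _]addrC !subrK !lexx.
have step n x y : P n x y -> exists i j : bool,
     P n.+1 (x + i%:R * (w / 2 ^+ n.+1)) (y + j%:R * (h / 2 ^+ n.+1)).
  move=> [ax xb cy yd big]; apply: contrapT => no.
  have W0 : 0 <= w / 2 ^+ n.+1 by rewrite divr_ge0 ?exprn_ge0 ?ltW.
  have H0 : 0 <= h / 2 ^+ n.+1 by rewrite divr_ge0 ?exprn_ge0 ?ltW.
  have small (i j : bool) : nrm (boundary F (x + i%:R * (w / 2 ^+ n.+1))
      (x + i%:R * (w / 2 ^+ n.+1) + w / 2 ^+ n.+1) (y + j%:R * (h / 2 ^+ n.+1))
      (y + j%:R * (h / 2 ^+ n.+1) + h / 2 ^+ n.+1)) < eta / 4 ^+ n.+1.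
    rewrite ltNge; apply/negP => le; apply: no; exists i, j; split => //.
    - by rewrite (le_trans ax) // lerDl mulr_ge0.
    - by apply: le_trans xb; rewrite (half_pow w n); case: i {le}; rewrite ?mul1r ?mul0r; lra.
    - by rewrite (le_trans cy) // lerDl mulr_ge0.
    - by apply: le_trans yd; rewrite (half_pow h n); case: j {le}; rewrite ?mul1r ?mul0r; lra.
  move: big; apply/negP; rewrite -ltNge.
  rewrite (@boundary_split F x (x + w / 2 ^+ n.+1) _ y (y + h / 2 ^+ n.+1)); last 5 first.
  - by rewrite lerDl.
  - by rewrite (half_pow w n); lra.
  - by rewrite lerDl.
  - by rewrite (half_pow h n); lra.
  - move=> s t /andP[xs sx] /andP[yt ty]; apply: cF.
      by rewrite (le_trans ax xs) (le_trans sx xb).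
    by rewrite (le_trans cy yt) (le_trans ty yd).
  have := small false false; have := small true false.
  have := small false true; have := small true true.
  rewrite !mul1r !mul0r !addr0 (half_pow w n) (half_pow h n) [x + (_ + _)]addrA [y + (_ + _)]addrA => s1 s2 s3 s4.
  have -> : eta / 4 ^+ n = eta / 4 ^+ n.+1 + eta / 4 ^+ n.+1 + eta / 4 ^+ n.+1 + eta / 4 ^+ n.+1.
    have -> : eta / 4 ^+ n = 4 * (eta / 4 ^+ n.+1).
      by rewrite exprS invfM mulrCA [4 * _]mulrA divff ?mul1r.
    ring.
  apply: le_lt_trans (nrmD _ _) _; rewrite ltrD //.
  apply: le_lt_trans (nrmD _ _) _; rewrite ltrD //.
  apply: le_lt_trans (nrmD _ _) _; rewrite ltrD //.
have [x [y [xab ycd lim]]] := nested_rectangles (ltW w0) (ltW h0) step P0.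
have {}xab : a <= x <= b by move: xab; rewrite /w [a + _]addrC subrK.
have {}ycd : c <= y <= d by move: ycd; rewrite /h [c + _]addrC subrK.
have dF := derivable_is_cder (hF x y xab ycd).
have wh : 0 < w + h by rewrite addr_gt0.
(* With this [e] the affine estimate gives 4 e ((w + h) / 2^n)^2 = (eta / 2) / 4^n, half of what the
   n-th rectangle keeps. *)
pose e := eta / (8 * (w + h) ^+ 2).
have e0 : 0 < e by rewrite divr_gt0 // mulr_gt0 ?exprn_gt0.
have [r r0 rP] := dF _ e0.
have [n nr] := half_pow_lt (w + h) r0.
have [xn [yn [[ax xb cy yd big] _ _ xI yI]]] := lim n.
move: big; apply/negP; rewrite -ltNge.
set D := derive1 F (mkC x y) in rP.
have W0 : 0 <= w / 2 ^+ n by rewrite divr_ge0 ?exprn_ge0 ?ltW.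
have H0 : 0 <= h / 2 ^+ n by rewrite divr_ge0 ?exprn_ge0 ?ltW.
have whE : w / 2 ^+ n + h / 2 ^+ n = (w + h) / 2 ^+ n by rewrite [RHS]mulrDl.
have err s t : xn <= s <= xn + w / 2 ^+ n -> yn <= t <= yn + h / 2 ^+ n ->
    nrm (F (mkC s t) - ((F (mkC x y) - D * mkC x y) + D * mkC s t)) <= e * ((w + h) / 2 ^+ n).
  move=> sI tI; have hh : nrm (mkC s t - mkC x y) <= (w + h) / 2 ^+ n.
    apply: le_trans (nrm_le _) _; rewrite reCB imCB /= -whE; apply: lerD; rewrite ler_norml; lra.
  have := rP (mkC s t - mkC x y); rewrite [mkC x y + _]addrC subrK => /(_ (le_lt_trans hh nr)).
  have -> : F (mkC s t) - F (mkC x y) - (mkC s t - mkC x y) *: D =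
    F (mkC s t) - ((F (mkC x y) - D * mkC x y) + D * mkC s t).
    by rewrite -[(_ - _) *: D]/((_ - _) * D); ring.
  by move=> /le_trans; apply; rewrite ler_pM2l.
have cF' : cont_rect F xn (xn + w / 2 ^+ n) yn (yn + h / 2 ^+ n).
  move=> s t /andP[xs sx] /andP[yt ty]; apply: cF.
    by rewrite (le_trans ax xs) (le_trans sx xb).
  by rewrite (le_trans cy yt) (le_trans ty yd).
have xx : xn <= xn + w / 2 ^+ n by rewrite lerDl.
have yy : yn <= yn + h / 2 ^+ n by rewrite lerDl.
apply: le_lt_trans (boundary_affine_err (mkC x y) xx yy cF' err) _.
rewrite ![_ + _ / _ - _]addrAC !subrr !add0r whE.
have -> : 4 * (e * ((w + h) / 2 ^+ n)) * ((w + h) / 2 ^+ n) = (eta / 2) / 4 ^+ n.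
  have ne : (2 ^+ n : R) != 0 by rewrite expf_neq0.
  have -> : (4 ^+ n : R) = 2 ^+ n * 2 ^+ n by rewrite -exprMn -natrM.
  by rewrite /e; field; rewrite ?ne ?gt_eqF.
by rewrite ltr_pM2r ?invr_gt0 ?exprn_gt0// ltr_pdivrMr // mulr_natr mulr2n ltrDl.
Qed.
End Goursat.

(** * The complex exponential, circle means and the derivative formula *)

Section MeanValue.
Variable R : realType.

Lemma cont_on_cst (T : topologicalType) (c : T) (a b : R) : cont_on (fun=> c) a b.
Proof. by move=> x _; exact: cvg_cst. Qed.

Lemma real_deriv (f : R -> R) (x d : R) : is_derive x 1 f d -> forall e : R, 0 < e ->
  exists2 r : R, 0 < r & forall h, `|h| < r -> `|f (x + h) - f x - h * d| <= e * `|h|.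
Proof.
move=> [df dv] e e0.
have /real_nbhsP[r r0 rP] := diff_near ((derivable1_diffP f x).1 df) e0.
exists r => // h hr; have := rP h; rewrite subr0 => /(_ hr).
have -> : 'd f x h = h * d.
  rewrite -dv deriveE; last exact/derivable1_diffP.
  by rewrite -[X in 'd f x X = _](mulr1 h) -[h * 1]/(h *: (1 : R)) linearZ_LR.
by [].
Qed.

Definition cexp (z : C R) : C R :=
  mkC (expR (reC z) * cos (imC z)) (expR (reC z) * sin (imC z)).

Lemma cexpD z w : cexp (z + w) = cexp z * cexp w.
Proof.
rewrite /cexp; apply: mkCP; rewrite ?reCM ?imCM reCD imCD /= expRD ?cosD ?sinD; ring.
Qed.

Lemma cexp0 : cexp 0 = 1.
Proof. by apply: mkCP; rewrite /= expR0 ?cos0 ?sin0 mul1r. Qed.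

Lemma nrm_cexp z : nrm (cexp z) = expR (reC z).
Proof.
by rewrite /cexp nrm_mkC !exprMn -mulrDr cos2Dsin2 mulr1 sqrtr_sqr ger0_norm ?expR_ge0.
Qed.

Lemma cexp_neq0 z : cexp z != 0.
Proof. by rewrite -nrm_eq0 nrm_cexp gt_eqF ?expR_gt0. Qed.

Lemma cexp_der0 : is_cder cexp 0 1.
Proof.
(* The errors below are 3 k |h| in the real part and 5 k |h| in the imaginary part, together under 9
   k |h|; the cap at 1 absorbs products of errors. *)
move=> e e0; pose k := Num.min (e / 9) 1.
have k0 : 0 < k by rewrite /k lt_min divr_gt0 //=.
have k1 : k <= 1 by rewrite ge_min lexx orbT.
have ke : k <= e / 9 by rewrite ge_min lexx.
clearbody k.
have [r1 r10 E1] := real_deriv (is_derive_expR (0 : R)) k0.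
have [r2 r20 E2] := real_deriv (is_derive_cos (0 : R)) k0.
have [r3 r30 E3] := real_deriv (is_derive_sin (0 : R)) k0.
exists (Num.min k (Num.min r1 (Num.min r2 r3))).
  by rewrite lt_min k0 /= lt_min r10 /= lt_min r20.
move=> h; rewrite !lt_min => /and4P[hk h1 h2 h3].
have xh := re_le h; have yh := im_le h.
set x := reC h in xh; set y := imC h in yh.
have := E1 x (le_lt_trans xh h1); have := E2 y (le_lt_trans yh h2).
have := E3 y (le_lt_trans yh h3).
rewrite !add0r expR0 cos0 sin0 oppr0 mulr0 !mulr1 !subr0 ?addr0 => S3 S2 S1.
rewrite ?add0r cexp0 [h *: 1]mulr1; set N := nrm h in xh yh hk *.
have N0 : 0 <= N by exact: nrm_ge0.
have kN (z : R) : `|z| <= N -> k * `|z| <= k * N by move=> zN; rewrite ler_pM2l.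
have {}S1 := le_trans S1 (kN _ xh); have {}S2 := le_trans S2 (kN _ yh).
have {}S3 := le_trans S3 (kN _ yh).
have kNN : k * N <= N by rewrite ler_piMl.
apply: le_trans (nrm_le _) _; rewrite !reCB !imCB /= -/x -/y !subr0.
have -> : expR x * cos y - 1 - x = (expR x - 1 - x) * cos y + (1 + x) * (cos y - 1) by ring.
have -> : expR x * sin y - y = (expR x - 1) * sin y + (sin y - y) by ring.
have c1 : `|cos y| <= 1 by rewrite ler_norml cos_geN1 cos_le1.
have A1 : `|(expR x - 1 - x) * cos y + (1 + x) * (cos y - 1)| <= 3 * (k * N).
  have B1 : `|(expR x - 1 - x) * cos y| <= k * N.
    by rewrite normrM (le_trans _ S1) // ler_piMr.
  have B2 : `|(1 + x) * (cos y - 1)| <= 2 * (k * N).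
    rewrite normrM; apply: ler_pM => //; apply: le_trans (ler_normD _ _) _.
    by rewrite normr1; lra.
  by apply: le_trans (ler_normD _ _) _; lra.
have A2 : `|(expR x - 1) * sin y + (sin y - y)| <= 5 * (k * N).
  have B1 : `|expR x - 1| <= 2 * N.
    have -> : expR x - 1 = (expR x - 1 - x) + x by ring.
    by apply: le_trans (ler_normD _ _) _; lra.
  have B2 : `|sin y| <= 2 * k.
    have -> : sin y = (sin y - y) + y by ring.
    by apply: le_trans (ler_normD _ _) _; lra.
  have B3 : `|(expR x - 1) * sin y| <= 2 * N * (2 * k) by rewrite normrM ler_pM.
  by apply: le_trans (ler_normD _ _) _; lra.
have kN0 : 0 <= k * N by rewrite mulr_ge0 // ltW.
apply: (@le_trans _ _ (9 * (k * N))); first lra.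
rewrite mulrA ler_wpM2r // -ler_pdivlMl // mulrC.
exact: ke.
Qed.

Lemma cexp_der z : is_cder cexp z (cexp z).
Proof.
move=> e e0; have c0 : 0 < nrm (cexp z) by rewrite nrm_gt0 cexp_neq0.
have [r r0 rP] := cexp_der0 (divr_gt0 e0 c0).
exists r => // h /rP; rewrite add0r cexp0 [h *: 1]mulr1 cexpD => H.
have -> : cexp z * cexp h - cexp z - h *: cexp z = cexp z * (cexp h - 1 - h).
  by rewrite -[h *: _]/(h * _); ring.
by rewrite nrmM mulrC -ler_pdivlMr // mulrAC.
Qed.

Lemma cexp_2pi z : cexp (z + mkC 0 (2 * pi)) = cexp z.
Proof.
rewrite cexpD; have -> : cexp (mkC 0 (2 * pi)) = 1.
  by apply: mkCP; rewrite /= expR0 mulr_natl ?cos2pi ?sin2pi mul1r.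
by rewrite mulr1.
Qed.

Definition cis (t : R) : C R := cexp (mkC 0 t).

Lemma nrm_cis t : nrm (cis t) = 1.
Proof. by rewrite nrm_cexp expR0. Qed.

Lemma cexp_mkC s t : cexp (mkC s t) = rC (expR s) * cis t.
Proof.
have -> : mkC s t = mkC s 0 + mkC 0 t by apply: mkCP; rewrite /= ?addr0 ?add0r.
by rewrite cexpD; congr (_ * _); apply: mkCP; rewrite /= ?cos0 ?sin0 ?mulr1 ?mulr0.
Qed.

Lemma continuous_cis : continuous (cis : R -> C R).
Proof.
move=> t.
exact: (@continuous_comp _ _ _ (fun t => mkC 0 t) cexp t (@continuous_mkCr _ 0 t) (is_cder_continuous (cexp_der _))).
Qed.

Definition circle (z : C R) (r t : R) : C R := z + rC r * cis t.

Lemma nrm_circle z r t : 0 <= r -> nrm (circle z r t - z) = r.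
Proof. by move=> r0; rewrite /circle addrC addKr nrmM nrm_rC nrm_cis mulr1 ger0_norm. Qed.

Lemma continuous_circle z r : continuous (circle z r : R -> C R).
Proof.
move=> t; apply/cvg_nrmP => e e0.
have /cvg_nrmP/(_ (e / (`|r| + 1))) := @continuous_cis t.
have r1 : 0 < `|r| + 1 by rewrite ltr_wpDl.
move=> /(_ (divr_gt0 e0 r1)); apply: filterS => u.
rewrite /circle opprD addrACA subrr add0r -mulrBr nrmM nrm_rC ltr_pdivlMr // mulrC.
by apply: le_lt_trans; rewrite ler_wpM2r ?nrm_ge0// lerDl.
Qed.

Lemma continuous_on_circle (f : C R -> C R) (z : C R) (r : R) : 0 <= r ->
  (forall w : C R, nrm (w - z) = r -> {for w, continuous f}) ->
  continuous (fun t => f (circle z r t)).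
Proof.
move=> r0 cf t; have cft := cf _ (nrm_circle z t r0).
exact: (@continuous_comp _ _ _ (circle z r) f t (@continuous_circle z r t) cft).
Qed.

(* Goursat applied to [f (z + exp zeta)] on a rectangle of height [2 pi]: the
   horizontal sides cancel by periodicity. *)
Lemma circle_integral_cst (f : C R -> C R) (z : C R) (rho r1 r2 : R) :
  (forall w : C R, 0 < nrm (w - z) < rho -> derivable f w 1) ->
  0 < r1 < r2 -> r2 < rho ->
  cint (fun t => f (circle z r1 t)) 0 (2 * pi) = cint (fun t => f (circle z r2 t)) 0 (2 * pi).
Proof.
move=> hf /andP[r10 r12] r2rho.
have r20 := lt_trans r10 r12.
pose F w := f (z + cexp w).
have hol : holo_rect F (ln r1) (ln r2) 0 (2 * pi).
  move=> s t /andP[s1 s2] _.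
  have d1 : is_cder (fun w => z + cexp w) (mkC s t) (cexp (mkC s t)).
    by have := is_cderD (is_cder_cst z _) (cexp_der (mkC s t)); rewrite add0r.
  have d2 : derivable f (z + cexp (mkC s t)) 1.
    apply: hf; rewrite [z + _]addrC addrK nrm_cexp /= expR_gt0 /=.
    by apply: le_lt_trans r2rho; rewrite -(@lnK _ r2) ?posrE // ler_expR.
  have := is_cder_comp d1 (derivable_is_cder d2).
  by move=> /is_cderP[].
have l12 : ln r1 < ln r2 by rewrite ltr_ln.
have p0 : 0 < 2 * pi :> R by rewrite mulr_gt0 ?pi_gt0.
have := goursat l12 p0 hol.
have per s : F (mkC s 0) = F (mkC s (2 * pi)).
  rewrite /F -(cexp_2pi (mkC s 0)); congr (f (_ + cexp _)).
  by apply: mkCP; rewrite /= ?addr0 ?add0r.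
have Fc r t : 0 < r -> F (mkC (ln r) t) = f (circle z r t).
  by move=> r0; rewrite /F cexp_mkC lnK.
rewrite /boundary.
have -> : (fun s => F (mkC s 0)) = (fun s => F (mkC s (2 * pi))) by apply/funext.
rewrite subrr add0r => /eqP; rewrite mulf_eq0 => /orP[/eqP[]/eqP|]; first by rewrite oner_eq0.
rewrite subr_eq0 => /eqP.
have -> : (fun t => F (mkC (ln r2) t)) = (fun t => f (circle z r2 t)) by apply/funext => t; rewrite Fc.
by have -> : (fun t => F (mkC (ln r1) t)) = (fun t => f (circle z r1 t)) by apply/funext => t; rewrite Fc.
Qed.

(** Circle means do not depend on the radius and tend to [f z] as it shrinks. At the centre
    continuity is asked instead of a derivative, so that difference quotients extended by their
    limit qualify. *)
Lemma mean_value (f : C R -> C R) (z : C R) (rho r : R) :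
  (forall w : C R, 0 < nrm (w - z) < rho -> derivable f w 1) -> {for z, continuous f} ->
  0 < r < rho -> cint (fun t => f (circle z r t)) 0 (2 * pi) = rC (2 * pi) * f z.
Proof.
move=> hf cf /andP[r0 rrho].
have p0 : 0 < 2 * pi :> R by rewrite mulr_gt0 ?pi_gt0.
apply/eqP; rewrite -subr_eq0 -nrm_eq0; apply/negPn/negP => ne.
set A := _ - _ in ne.
have A0 : 0 < nrm A by rewrite lt_neqAle eq_sym ne nrm_ge0.
(* [cint_le] over a period gives 2 e (2 pi), which is then half of |A|. *)
pose e := nrm A / (8 * pi).
have e0 : 0 < e by rewrite divr_gt0 // mulr_gt0 ?pi_gt0.
have [d d0 dP] := (continuous_nrmP f z).1 cf e e0.
pose s := Num.min (d / 2) (r / 2).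
have s0 : 0 < s by rewrite lt_min !divr_gt0.
have sd : s < d by rewrite gt_min ltr_pdivrMr // mulr_natr mulr2n ltrDl d0.
have sr : s < r by rewrite gt_min [r / 2 < r]ltr_pdivrMr // mulr_natr mulr2n ltrDl r0 orbT.
have csr : 0 < s < r by rewrite s0.
have cs : cont_on (fun t => f (circle z s t)) 0 (2 * pi).
  move=> t _; apply: continuous_on_circle; first exact: ltW.
  move=> w ws; have /derivable_is_cder/is_cder_continuous : derivable f w 1.
    by apply: hf; rewrite ws s0 (lt_trans sr).
  by [].
have ck : cont_on (fun _ : R => f z) 0 (2 * pi) by exact: cont_on_cst.
have AE : A = cint (fun t => f (circle z s t) - f z) 0 (2 * pi).
  rewrite (cintB cs ck).
  by rewrite cint_cst ?ltW// /A (circle_integral_cst hf csr) // subr0.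
have : nrm A <= 2 * e * (2 * pi - 0).
  rewrite AE; apply: cint_le; first exact: ltW.
    by move=> t tI; exact: cvgB_nrm (cs t tI) (ck t tI).
  by move=> t _; apply/ltW/dP; rewrite nrm_circle // ltW.
rewrite subr0; have -> : 2 * e * (2 * pi) = nrm A / 2.
  have pi0 : (pi : R) != 0 by rewrite gt_eqF ?pi_gt0.
  have E : e * pi = nrm A / 8 by rewrite /e invfM mulrA mulfVK.
  by rewrite (_ : 2 * e * (2 * pi) = 4 * (e * pi)) ?E; lra.
by rewrite leNgt ltr_pdivrMr // mulr_natr mulr2n ltrDl A0.
Qed.

(** This is the mean value property of the difference quotient of [f] at [z], completed by its limit
    [d]. *)
Lemma derivative_formula (f : C R -> C R) (z : C R) (rho r : R) d :
  (forall w : C R, nrm (w - z) < rho -> derivable f w 1) -> is_cder f z d ->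
  0 < r < rho ->
  cint (fun t => (f (circle z r t) - f z) / (rC r * cis t)) 0 (2 * pi) = rC (2 * pi) * d.
Proof.
move=> hf fd rr; have /andP[r0 rrho] := rr.
pose q (w : C R) : C R := if w == z then d else (f w - f z) / (w - z).
have qz : q z = d by rewrite /q eqxx.
have cq : {for z, continuous q}.
  apply/continuous_nrmP => e e0.
  have e2 : 0 < e / 2 by rewrite divr_gt0.
  have [s s0 sP] := fd _ e2.
  exists s => // w ws; rewrite qz /q; case: eqP => [_|/eqP wz].
    by rewrite subrr nrm0.
  have n0 : 0 < nrm (w - z) by rewrite nrm_gt0 subr_eq0.
  have := sP _ ws; rewrite [z + _]addrC subrK => H.
  have -> : (f w - f z) / (w - z) - d = (f w - f z - (w - z) *: d) / (w - z).
    by rewrite -[_ *: d]/(_ * d); field; rewrite subr_eq0.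
  rewrite nrmM nrmV ltr_pdivrMr //; apply: le_lt_trans H _.
  by rewrite ltr_pM2r // ltr_pdivrMr // mulr_natr mulr2n ltrDl.
have hq w : 0 < nrm (w - z) < rho -> derivable q w 1.
  move=> /andP[w0 wrho].
  have wz : w - z != 0 by rewrite -nrm_gt0.
  have D : is_cder (fun w => w - z) w (1 - 0) := is_cderB (is_cder_id w) (is_cder_cst z w).
  have D2 := is_cderB (derivable_is_cder (hf w wrho)) (is_cder_cst (f z) w).
  have /is_cderP[+ _] : is_cder q w (((f^`())%classic w - 0) * (w - z)^-1 + (f w - f z) * (- (1 - 0) / (w - z) ^+ 2)).
    apply: (is_cder_near (is_cderM D2 (is_cderV D wz))).
    apply/nrm_nbhsP; exists (nrm (w - z)) => // v vw.
    by rewrite /q; case: eqP => // vz; move: vw; rewrite vz nrmC ltxx.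
  by [].
have := mean_value hq cq rr; rewrite qz => <-.
congr cint; apply/funext => t; rewrite /q; case: eqP => [E|_].
  have := nrm_circle z t (ltW r0); rewrite E subrr nrm0 => r00.
  by rewrite -r00 ltxx in r0.
by rewrite /circle [z + _]addrC addrK.
Qed.
End MeanValue.

(** * Cauchy estimates and the second-order Taylor bound *)

Section CauchyEstimates.
Variable R : realType.

(* Continuous induction: a pseudo-distance along [a, b] that grows at most at rate [L] near
   each point grows at most at rate [L] globally. *)
Lemma local_growth (d : R -> R -> R) (a b L : R) : a <= b ->
  d a a <= 0 ->
  (forall s t u, d s u <= d s t + d t u) ->
  (forall t e, a <= t <= b -> 0 < e -> exists2 r : R, 0 < r &
    forall s, a <= s <= b -> `|s - t| < r ->
      d s t <= (L + e) * `|s - t| /\ d t s <= (L + e) * `|s - t|) ->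
  d a b <= L * (b - a).
Proof.
move=> ab d0 tri loc.
suff H e : 0 < e -> d a b <= (L + e) * (b - a).
  apply/ler_addgt0Pr => e e0.
  have ba : 0 < b - a + 1 by rewrite ltr_wpDl // subr_ge0.
  have := H (e / (b - a + 1)) (divr_gt0 e0 ba).
  move=> /le_trans; apply; rewrite mulrDl lerD2l mulrAC ler_pdivrMr //.
  by rewrite ler_pM2l // lerDl.
move=> e0.
pose S := [set t | a <= t <= b /\ forall s, a <= s <= t -> d a s <= (L + e) * (s - a)].
have Sa : S a.
  split; first by rewrite lexx.
  move=> s /andP[h1 h2]; have -> : s = a by apply/le_anti; rewrite h1 h2.
  by rewrite subrr mulr0.
have ubS : ubound S b by move=> t [/andP[]].
have hsS : has_sup S by split; [exists a | exists b].
pose c := sup S.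
have ac : a <= c by apply: ub_le_sup => //; exists b.
have cb : c <= b by apply: ge_sup => //; exists a.
have [r r0 rP] := loc c e (introT andP (conj ac cb)) e0.
have [t St tc] := sup_adherent r0 hsS; have tc' : t <= c by apply: ub_le_sup => //; exists b.
have [/andP[at_ tb] tP] := St.
have dc : d a c <= (L + e) * (c - a).
  apply: le_trans (tri a t c) _.
  have -> : (L + e) * (c - a) = (L + e) * (t - a) + (L + e) * (c - t) by ring.
  apply: lerD; first by apply: tP; rewrite at_ lexx.
  have := rP t; rewrite at_ tb => /(_ isT); rewrite distrC ger0_norm ?subr_ge0//.
  by case=> //; rewrite ltrBlDr -ltrBlDl.
have near s : a <= s <= b -> `|s - c| < r -> c <= s -> d a s <= (L + e) * (s - a).
  move=> sab sr cs; apply: le_trans (tri a c s) _.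
  have -> : (L + e) * (s - a) = (L + e) * (c - a) + (L + e) * (s - c) by ring.
  by apply: lerD => //; have [_] := rP s sab sr; rewrite ger0_norm ?subr_ge0.
have upto s : a <= s -> s < c -> d a s <= (L + e) * (s - a).
  move=> as_ sc; have cs0 : 0 < c - s by rewrite subr_gt0.
  have [u Su uc] := sup_adherent cs0 hsS; have [_ uP] := Su.
  by apply: uP; rewrite as_ /= ltW //; move: uc; rewrite -/c opprB addrC subrK.
(* If the supremum [c] were below [b], the local estimate at [c] would carry the bound past it. *)
pose c' := Num.min b (c + r / 2).
have r2 : 0 < r / 2 by rewrite divr_gt0.
have rr : r / 2 < r by rewrite ltr_pdivrMr // mulr_natr mulr2n ltrDl.
have Sc' : S c'.
  split.
    by rewrite /c' le_min ge_min lexx ab /=; rewrite (le_trans ac) // lerDl ltW.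
  move=> s; rewrite /c' le_min => /andP[as_ /andP[sb sc]].
  case: (ltP s c) => [|cs]; first exact: upto.
  apply: near => //; first by rewrite as_.
  by rewrite ger0_norm ?subr_ge0// (le_lt_trans _ rr) // lerBlDl.
have c'c : c' <= c by apply: ub_le_sup => //; exists b.
have bc : b = c.
  apply/le_anti; rewrite cb andbT.
  by move: c'c; rewrite /c' ge_min => /orP[//|]; rewrite gerDl leNgt r2.
by rewrite bc.
Qed.

Lemma segment_nrm (a b : C R) (t s : R) : nrm ((a + rC s * (b - a)) - (a + rC t * (b - a))) = `|s - t| * nrm (b - a).
Proof. by rewrite opprD addrACA subrr add0r -mulrBl nrmM -rCB nrm_rC. Qed.

(** Continuous induction along the segment takes the place of integration, so [f] may have values in
    any normed space. *)
Lemma mean_value_ineq (W : normedModType (C R)) (f : C R -> W) (a b : C R) (L : R) :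
  (forall t : R, 0 <= t <= 1 -> exists2 d, is_cder f (a + rC t * (b - a)) d & nrm d <= L) ->
  nrm (f b - f a) <= L * nrm (b - a).
Proof.
move=> H.
pose g t := f (a + rC t * (b - a)).
have := @local_growth (fun s t => nrm (g s - g t)) 0 1 (L * nrm (b - a)) ler01.
rewrite /g mul0r addr0 rC1 mul1r [a + _]addrC subrK subrr nrm0 subr0 mulr1 nrmC; apply => //.
  by move=> s t u; exact: nrm_tri.
move=> t e t01 e0; have [d fd dL] := H t t01.
have B1 : 0 < nrm (b - a) + 1 by rewrite ltr_wpDl ?nrm_ge0.
have [r r0 rP] := fd (e / (nrm (b - a) + 1)) (divr_gt0 e0 B1).
exists (r / (nrm (b - a) + 1)); first by rewrite divr_gt0.
move=> s s01; rewrite ltr_pdivlMr // => st.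
suff K : nrm (f (a + rC s * (b - a)) - f (a + rC t * (b - a))) <= (L * nrm (b - a) + e) * `|s - t|.
  by split; [|rewrite nrmC].
set h := (a + rC s * (b - a)) - (a + rC t * (b - a)).
have hE : a + rC s * (b - a) = a + rC t * (b - a) + h by rewrite /h [RHS]addrC subrK.
have hn : nrm h = `|s - t| * nrm (b - a) by rewrite segment_nrm.
have hr : nrm h < r.
  by rewrite hn; apply: le_lt_trans st; rewrite ler_wpM2l // lerDl.
have := rP h hr; rewrite -hE => H1.
have -> : f (a + rC s * (b - a)) - f (a + rC t * (b - a)) =
  (f (a + rC s * (b - a)) - f (a + rC t * (b - a)) - h *: d) + h *: d by rewrite subrK.
apply: le_trans (nrmD _ _) _; rewrite nrmZ addrC [leRHS]mulrDl.
apply: lerD.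
  rewrite (_ : L * nrm (b - a) * `|s - t| = nrm h * L); last by rewrite hn; ring.
  by rewrite ler_wpM2l ?nrm_ge0.
apply: le_trans H1 _; rewrite hn mulrCA mulrC ler_wpM2r //.
by rewrite mulrAC ler_pdivrMr // ler_pM2l // lerDl.
Qed.

Section Disc.
Variables (f : C R -> C R) (z : C R) (rho B : R).
Hypothesis rho0 : 0 < rho.
Hypothesis hf : forall w : C R, nrm (w - z) < rho -> derivable f w 1.
Hypothesis fB : forall w : C R, nrm (w - z) < rho -> nrm (f w) <= B.

Let sub_disc (w v : C R) (r s : R) : nrm (w - z) < r -> nrm (v - w) < s -> r + s <= rho -> nrm (v - z) < rho.
Proof.
by move=> wr vw rs; apply: lt_le_trans rs; apply: le_lt_trans (nrm_tri v w z) _; rewrite addrC ltrD.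
Qed.

Lemma circle_quotient_cont (w : C R) (r : R) : 0 < r -> (forall v : C R, nrm (v - w) = r -> nrm (v - z) < rho) ->
  continuous (fun t => (f (circle w r t) - f w) / (rC r * cis t) : C R).
Proof.
move=> r0 inr.
have -> : (fun t => (f (circle w r t) - f w) / (rC r * cis t)) =
    (fun t => (fun v => (f v - f w) * (v - w)^-1) (circle w r t)).
  by apply/funext => t; rewrite /circle [w + _]addrC addrK.
apply: (@continuous_on_circle R (fun v => (f v - f w) * (v - w)^-1) w r (ltW r0)) => v vr.
have vw : v - w != 0 by rewrite -nrm_gt0 vr.
have D : is_cder (fun v => v - w) v (1 - 0) := is_cderB (is_cder_id v) (is_cder_cst w v).
have D2 := is_cderB (derivable_is_cder (hf (inr _ vr))) (is_cder_cst (f w) v).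
exact: is_cder_continuous (is_cderM D2 (is_cderV D vw)).
Qed.

(** The derivative formula on the circle of radius rho / 4 about [w]: the quotients are at most 2 B
    / (rho / 4), and [cint_le] doubles this. *)
Lemma cauchy_estimate (w : C R) : nrm (w - z) < rho / 2 -> nrm (derive1 f w) <= 16 * B / rho.
Proof.
move=> wz.
have p0 : 0 < 2 * pi :> R by rewrite mulr_gt0 ?pi_gt0.
pose r := rho / 4.
have r0 : 0 < r by rewrite divr_gt0.
have inr (v : C R) : nrm (v - w) < rho / 2 -> nrm (v - z) < rho.
  by move=> vw; apply: sub_disc wz vw _; lra.
have hw (v : C R) : nrm (v - w) < rho / 2 -> derivable f v 1 by move=> /inr/hf.
have rr : 0 < r < rho / 2 by rewrite r0 /= /r; have := rho0; lra.
have dw : derivable f w 1 by apply: hw; rewrite subrr nrm0 divr_gt0.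
have := derivative_formula hw (derivable_is_cder dw) rr => E.
have : nrm (cint (fun t => (f (circle w r t) - f w) / (rC r * cis t)) 0 (2 * pi)) <= 2 * (2 * B / r) * (2 * pi - 0).
  apply: cint_le; first exact: ltW.
    move=> t _; apply: circle_quotient_cont => // v vr; apply: inr; rewrite vr.
    by have /andP[] := rr.
  move=> t _; rewrite nrmM nrmV nrmM nrm_rC nrm_cis mulr1 gtr0_norm //.
  rewrite ler_wpM2r ?invr_ge0 ?(ltW r0)//; apply: le_trans (nrmB _ _) _.
  rewrite mulr_natl mulr2n lerD ?fB//.
    by apply: inr; rewrite nrm_circle ?ltW//; have /andP[] := rr.
  by apply: inr; rewrite subrr nrm0 divr_gt0.
rewrite E nrmM nrm_rC subr0 gtr0_norm // mulrC ler_pM2r // => /le_trans; apply.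
rewrite /r le_eqVlt; apply/orP; left; apply/eqP; field.
by rewrite gt_eqF.
Qed.

Lemma holo_lipschitz (v w : C R) : nrm (v - z) < rho / 2 -> nrm (w - z) < rho / 2 ->
  nrm (f v - f w) <= 16 * B / rho * nrm (v - w).
Proof.
move=> vz wz; apply: mean_value_ineq => t /andP[t0 t1].
have inr : nrm ((w + rC t * (v - w)) - z) < rho / 2.
  have -> : (w + rC t * (v - w)) - z = rC (1 - t) * (w - z) + rC t * (v - z).
    by rewrite rCB rC1; ring.
  apply: le_lt_trans (nrmD _ _) _; rewrite !nrmM !nrm_rC !ger0_norm ?subr_ge0//.
  have [->|t0'] := eqVneq t 0; first by rewrite mul0r addr0 subr0 mul1r.
  have tp : 0 < t by rewrite lt_neqAle eq_sym t0'.
  have h1 : (1 - t) * nrm (w - z) <= (1 - t) * (rho / 2) by rewrite ler_wpM2l ?subr_ge0 // ltW.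
  have h2 : t * nrm (v - z) < t * (rho / 2) by rewrite ltr_pM2l.
  by lra.
exists (derive1 f (w + rC t * (v - w))); last exact: cauchy_estimate.
apply/derivable_is_cder/hf; apply: lt_le_trans inr _.
by rewrite ler_pdivrMr // mulr_natr mulr2n lerDl ltW.
Qed.
End Disc.

(** Subtracting the derivative formulas at [v] and [w] on circles of the same radius rho / 8 leaves
    differences of values of [f], which [holo_lipschitz] controls. *)
Lemma derive_lipschitz (f : C R -> C R) (z : C R) (rho B : R) : 0 < rho ->
  (forall w : C R, nrm (w - z) < rho -> derivable f w 1) ->
  (forall w : C R, nrm (w - z) < rho -> nrm (f w) <= B) ->
  forall v w : C R, nrm (v - z) < rho / 4 -> nrm (w - z) < rho / 4 ->
    nrm (derive1 f v - derive1 f w) <= 8 * 64 * B / rho ^+ 2 * nrm (v - w).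
Proof.
move=> rho0 hf fB v w vz wz.
have p0 : 0 < 2 * pi :> R by rewrite mulr_gt0 ?pi_gt0.
pose r := rho / 8.
have r0 : 0 < r by rewrite divr_gt0.
have inr (u x : C R) : nrm (u - z) < rho / 4 -> nrm (x - u) < rho / 4 -> nrm (x - z) < rho / 2.
  by move=> uz xu; apply: le_lt_trans (nrm_tri x u z) _; lra.
have half : rho / 2 <= rho by lra.
have rr : 0 < r < rho / 4 by rewrite r0 /r; lra.
have hu (u : C R) : nrm (u - z) < rho / 4 -> forall x : C R, nrm (x - u) < rho / 4 -> derivable f x 1.
  by move=> uz x xu; apply: hf; apply: lt_le_trans half; exact: inr xu.
have q0 : 0 < rho / 4 by rewrite divr_gt0.
have formula (u : C R) : nrm (u - z) < rho / 4 ->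
    cint (fun t => (f (circle u r t) - f u) / (rC r * cis t)) 0 (2 * pi) = rC (2 * pi) * derive1 f u.
  move=> uz; apply: derivative_formula (hu _ uz) _ rr.
  by apply/derivable_is_cder/(hu u uz); rewrite subrr nrm0.
have cont (u : C R) : nrm (u - z) < rho / 4 ->
    cont_on (fun t => (f (circle u r t) - f u) / (rC r * cis t) : C R) 0 (2 * pi).
  move=> uz t _; have H (x : C R) : nrm (x - u) = r -> nrm (x - z) < rho.
    by move=> xu; apply: lt_le_trans half; apply: inr uz _; rewrite xu; have /andP[] := rr.
  have K := circle_quotient_cont hf r0 H.
  exact: K.
have circ (u : C R) t : nrm (u - z) < rho / 4 -> nrm (circle u r t - z) < rho / 2.
  by move=> uz; apply: inr uz _; rewrite nrm_circle ?ltW//; have /andP[] := rr.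
have q2 (u : C R) : nrm (u - z) < rho / 4 -> nrm (u - z) < rho / 2 by move=> uz; lra.
have := cintB (cont v vz) (cont w wz); rewrite !formula // -mulrBr => E.
have : nrm (rC (2 * pi) * (derive1 f v - derive1 f w)) <= 2 * (2 * (16 * B / rho * nrm (v - w)) / r) * (2 * pi - 0).
  rewrite -E; apply: cint_le; first exact: ltW.
    by move=> t tI; exact: cvgB_nrm (cont v vz t tI) (cont w wz t tI).
  move=> t _; rewrite -mulrBl nrmM nrmV nrmM nrm_rC nrm_cis mulr1 gtr0_norm //.
  rewrite ler_wpM2r ?invr_ge0 ?(ltW r0)//.
  have -> : f (circle v r t) - f v - (f (circle w r t) - f w) =
    (f (circle v r t) - f (circle w r t)) - (f v - f w) by ring.
  apply: le_trans (nrmB _ _) _; rewrite mulr_natl mulr2n lerD //.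
    apply: le_trans (holo_lipschitz rho0 hf fB (circ v t vz) (circ w t wz)) _.
    by rewrite /circle opprD addrACA subrr addr0.
  exact: (holo_lipschitz rho0 hf fB (q2 _ vz) (q2 _ wz)).
rewrite nrmM nrm_rC subr0 gtr0_norm // mulrC ler_pM2r // => /le_trans; apply.
rewrite /r le_eqVlt; apply/orP; left; apply/eqP; field.
by rewrite gt_eqF.
Qed.

(** Mean value inequality for w |-> f w - w f'(z), whose derivative is O(|h|) between z and z + h.
    The constant depends on [B] and [rho] only, which lets the bound pass to limits. *)
Lemma holo_taylor2 (f : C R -> C R) (z : C R) (rho B : R) : 0 < rho ->
  (forall w : C R, nrm (w - z) < rho -> derivable f w 1) ->
  (forall w : C R, nrm (w - z) < rho -> nrm (f w) <= B) ->
  forall h : C R, nrm h < rho / 4 ->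
    nrm (f (z + h) - f z - h * derive1 f z) <= 8 * 64 * B / rho ^+ 2 * nrm h ^+ 2.
Proof.
move=> rho0 hf fB h hr.
have := @mean_value_ineq (C R) (fun w => f w - w * derive1 f z) z (z + h) (8 * 64 * B / rho ^+ 2 * nrm h).
have -> : f (z + h) - (z + h) * derive1 f z - (f z - z * derive1 f z) = f (z + h) - f z - h * derive1 f z by ring.
rewrite (_ : z + h - z = h); last by rewrite [z + h]addrC addrK.
rewrite -[8 * 64 * B / rho ^+ 2 * nrm h * nrm h]mulrA -expr2; apply => t /andP[t0 t1].
have tn : nrm (z + rC t * h - z) <= nrm h.
  by rewrite [z + _]addrC addrK nrmM nrm_rC ger0_norm // ler_piMl ?nrm_ge0.
have q : rho / 4 < rho by lra.
exists (derive1 f (z + rC t * h) - (1 * derive1 f z + (z + rC t * h) * 0)).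
  apply: is_cderB; first by apply/derivable_is_cder/hf; lra.
  exact: is_cderM (is_cder_id _) (is_cder_cst _ _).
have -> : 1 * derive1 f z + (z + rC t * h) * 0 = derive1 f z by ring.
apply: le_trans (derive_lipschitz rho0 hf fB _ _) _; first lra.
  by rewrite subrr nrm0 divr_gt0.
have B0 : 0 <= B by apply: le_trans (nrm_ge0 (f z)) (fB _ _); rewrite subrr nrm0.
have K0 : 0 <= 8 * 64 * B / rho ^+ 2 by rewrite divr_ge0 ?mulr_ge0 ?exprn_ge0 // ltW.
exact: ler_wpM2l.
Qed.
End CauchyEstimates.

(** * Holomorphic functions of several variables *)

Section Ultralimits.

Lemma ultra_fmap (T S : Type) (U : set_system T) (f : T -> S) :
  UltraFilter U -> UltraFilter (f @ U).
Proof.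
move=> UU; apply: Build_UltraFilter => G PG sub.
apply/seteqP; split=> [A GA|]; last exact: sub.
have [//|nA] := in_ultra_setVsetC (f @^-1` A) UU.
have GnA : G (~` A) by apply: sub.
have : G (A `&` ~` A) by apply: filterI.
by rewrite setICr => /filter_not_empty.
Qed.

(** Along an ultrafilter a map into a compact set converges outright; this does the work of
    extracting subsequences. *)
Lemma ultra_compact_cvg (T : Type) (S : topologicalType) (U : set_system T) (f : T -> S) (A : set S) :
  UltraFilter U -> compact A -> U (f @^-1` A) -> exists2 p, A p & f @ U --> p.
Proof.
move=> UU cA fA; move: cA; rewrite compact_ultra => /(_ (f @ U) (ultra_fmap f UU) fA)[p [Ap fp]].
by exists p.
Qed.

Variable R : realType.

Lemma ultra_bounded_cvg (T : Type) (U : set_system T) (f : T -> C R) (B : R) :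
  UltraFilter U -> (\forall k \near U, nrm (f k) <= B) -> exists l : C R, f @ U --> l.
Proof.
move=> UU fB.
have [a _ fa] : exists2 a : R, `[- B, B]%classic a & (fun k => reC (f k)) @ U --> a.
  apply: ultra_compact_cvg; first exact: segment_compact.
  by apply: filterS fB => k kB; rewrite /= in_itv /= -ler_norml (le_trans (re_le _)).
have [b _ fb] : exists2 a : R, `[- B, B]%classic a & (fun k => imC (f k)) @ U --> a.
  apply: ultra_compact_cvg; first exact: segment_compact.
  by apply: filterS fB => k kB; rewrite /= in_itv /= -ler_norml (le_trans (im_le _)).
exists (mkC a b).
have -> : f = (fun k => mkC (reC (f k)) (imC (f k))) by apply/funext => k; rewrite mkC_eta.
exact: cvg_mkC.
Qed.

Lemma cvg_nrm_le (V : normedModType (C R)) (T : Type) (F : set_system T) {PF : ProperFilter F} (f : T -> V) (l : V) (M : R) :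
  f @ F --> l -> (\forall k \near F, nrm (f k) <= M) -> nrm l <= M.
Proof.
move=> fl fM; apply/ler_addgt0Pr => e e0.
have /cvg_nrmP/(_ e e0) H := fl.
have [k [k1 k2]] := filter_ex (filterI fM H).
rewrite -[l](subrK (f k)) addrC; apply: le_trans (nrmD _ _) _.
by apply: lerD => //; rewrite nrmC ltW.
Qed.

Lemma cvg_nrm_uniq (V : normedModType (C R)) (T : Type) (F : set_system T) {PF : ProperFilter F} (f : T -> V) (a b : V) :
  f @ F --> a -> f @ F --> b -> a = b.
Proof.
move=> fa fb; apply/eqP; rewrite -subr_eq0 -nrm_eq0 eq_le nrm_ge0 andbT.
apply: cvg_nrm_le (cvgB_nrm fa fb) _; apply: nearW => k.
by rewrite subrr nrm0.
Qed.

Lemma cvgD_nrm (V : normedModType (C R)) (T : Type) (F : set_system T) {FF : Filter F} (f g : T -> V) (a b : V) :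
  f @ F --> a -> g @ F --> b -> (fun t => f t + g t) @ F --> a + b.
Proof. exact: cvgD. Qed.

Lemma cvgZ_nrm (V : normedModType (C R)) (T : Type) (F : set_system T) {FF : Filter F} (k : C R) (g : T -> V) (b : V) :
  g @ F --> b -> (fun t => k *: g t) @ F --> k *: b.
Proof.
move=> gb; apply/cvg_nrmP => e e0; have k1 : 0 < nrm k + 1 by rewrite ltr_wpDl ?nrm_ge0.
have /cvg_nrmP/(_ _ (divr_gt0 e0 k1)) := gb; apply: filterS => t.
rewrite ltr_pdivlMr // mulrC => H; rewrite -scalerBr nrmZ; apply: le_lt_trans H.
by rewrite ler_wpM2r ?nrm_ge0// lerDl.
Qed.
End Ultralimits.

(** * Holomorphic functions on a normed complex vector space *)

Section SeveralVariables.
Variables (R : realType) (V : normedModType (C R)).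
Implicit Types (f G : V -> C R) (x h w : V).

Definition holo_ball f x (rho : R) := forall y, nrm (y - x) < rho -> differentiable f y.

Lemma is_cder_line (z : C R) x w : is_cder (fun t : C R => x + t *: w) z w.
Proof.
move=> e e0; exists 1 => // h _.
rewrite scalerDl addrA [x + _ + _]addrC addrK subrr nrm0.
by rewrite mulr_ge0 ?nrm_ge0// ltW.
Qed.

Lemma unit_vector h : h != 0 -> exists u : V, nrm u = 1 /\ h = rC (nrm h) *: u.
Proof.
move=> h0; have n0 : nrm h != 0 by rewrite nrm_eq0.
exists ((rC (nrm h))^-1 *: h); rewrite nrmZ -rCV nrm_rC normrV ?unitfE// ger0_norm ?nrm_ge0//.
by rewrite mulVf // scalerA -rCM mulfV // rC1 scale1r.
Qed.

(** Restriction to the complex line through [x] in a unit direction reduces both bounds to one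
    variable; homogeneity of the differential does the rest. *)
Lemma holo_ball_taylor f x (rho B : R) : 0 < rho -> holo_ball f x rho ->
  (forall y, nrm (y - x) < rho -> nrm (f y) <= B) ->
  (forall h, nrm ('d f x h) <= 16 * B / rho * nrm h) /\
  (forall h, nrm h < rho / 4 ->
    nrm (f (x + h) - f x - 'd f x h) <= 8 * 64 * B / rho ^+ 2 * nrm h ^+ 2).
Proof.
move=> rho0 hf fB.
have dfx : differentiable f x by apply: hf; rewrite subrr nrm0.
have line u : nrm u = 1 -> let g := (fun t : C R => f (x + t *: u)) in
    [/\ (forall t : C R, nrm (t - 0) < rho -> derivable g t 1), (forall t : C R, nrm (t - 0) < rho -> nrm (g t) <= B)
      & derive1 g 0 = 'd f x u].
  move=> u1 g.
  have inb (t : C R) : nrm (t - 0) < rho -> nrm (x + t *: u - x) < rho.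
    by rewrite subr0 [x + _]addrC addrK nrmZ u1 mulr1.
  split=> [t /inb tr|t /inb|]; last 2 first.
  - exact: fB.
  - have := @diff_comp_cder _ _ _ f _ 0 _ (@is_cder_line 0 x u).
    by rewrite scale0r addr0 => /(_ dfx) /is_cderP[].
  have /is_cderP[] // := diff_comp_cder (@is_cder_line t x u) (hf _ tr).
split=> h.
  have [->|h0] := eqVneq h 0; first by rewrite linear0 !nrm0 mulr0.
  have [u [u1 hu]] := unit_vector h0; have [g1 g2 g3] := line u u1.
  rewrite {1}hu linearZ_LR nrmZ nrm_rC ger0_norm ?nrm_ge0// mulrC ler_wpM2r ?nrm_ge0//.
  rewrite -g3; apply: (cauchy_estimate rho0 g1 g2).
  by rewrite subrr nrm0 divr_gt0.
move=> hr; have [->|h0] := eqVneq h 0.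
  by rewrite linear0 addr0 subrr subr0 !nrm0 expr0n /= mulr0.
have [u [u1 hu]] := unit_vector h0; have [g1 g2 g3] := line u u1.
have hn : nrm (rC (nrm h)) = nrm h by rewrite nrm_rC ger0_norm ?nrm_ge0.
have := holo_taylor2 rho0 g1 g2 (h := rC (nrm h)); rewrite hn => /(_ hr).
rewrite g3 add0r scale0r addr0 -hu.
by have -> : 'd f x h = rC (nrm h) * 'd f x u by rewrite {1}hu linearZ_LR.
Qed.

(** The Taylor bounds are uniform along [U]: the differentials stay bounded, so they converge to
    some [L], linear as a limit, and the quadratic remainder bound passes to the limit and
    identifies [L] as the differential of [G]. *)
Lemma holo_limit (T : Type) (U : set_system T) (g : T -> V -> C R) G x (rho B : R) :
  UltraFilter U -> 0 < rho ->
  (\forall k \near U, holo_ball (g k) x rho /\ forall y, nrm (y - x) < rho -> nrm (g k y) <= B) ->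
  (forall y, nrm (y - x) < rho -> (fun k => g k y) @ U --> G y) ->
  differentiable G x /\ forall h, (fun k => 'd (g k) x h) @ U --> 'd G x h.
Proof.
move=> UU rho0 gk gG.
have PU : ProperFilter U := @ultra_proper _ _ UU.
have /choice[L LP] : forall h, exists l : C R, (fun k => 'd (g k) x h) @ U --> l.
  move=> h; apply: (@ultra_bounded_cvg _ _ _ _ (16 * B / rho * nrm h)).
  by apply: filterS gk => k [g1 g2]; have [] := holo_ball_taylor rho0 g1 g2.
have dL : is_diff x G L.
  apply: cdiffI.
  - move=> a u v; apply: cvg_nrm_uniq (LP _) _.
    have -> : (fun k => 'd (g k) x (a *: u + v)) = (fun k => a *: 'd (g k) x u + 'd (g k) x v).
      by apply/funext => k; rewrite linearP.
    apply: cvgD_nrm (LP v); exact: cvgZ_nrm.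
  - exists (16 * B / rho) => h; apply: cvg_nrm_le (LP h) _.
    by apply: filterS gk => k [g1 g2]; have [] := holo_ball_taylor rho0 g1 g2.
  move=> e e0; set K := 8 * 64 * B / rho ^+ 2.
  have K1 : 0 < `|K| + 1 by rewrite ltr_wpDl.
  exists (Num.min (rho / 4) (e / (`|K| + 1))).
    by rewrite lt_min !divr_gt0.
  move=> h; rewrite lt_min => /andP[h1 h2].
  have h3 : nrm (x + h - x) < rho by rewrite [x + h]addrC addrK; lra.
  have h4 : nrm (x - x) < rho by rewrite subrr nrm0.
  apply: (@le_trans _ _ (K * nrm h ^+ 2)).
    apply: (cvg_nrm_le (cvgB_nrm (cvgB_nrm (gG _ h3) (gG _ h4)) (LP h))).
    apply: filterS gk => k [g1 g2]; have [_ H] := holo_ball_taylor rho0 g1 g2.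
    exact: H.
  rewrite expr2 mulrA ler_wpM2r ?nrm_ge0//.
  move: h2; rewrite ltr_pdivlMr // mulrC => /ltW; apply: le_trans.
  rewrite ler_wpM2r ?nrm_ge0//; apply: le_trans (ler_norm _) _.
  by rewrite lerDl.
have [dG dv] := dL; split; first exact: dG.
move=> h; have dvh : L h = 'd G x h := congr1 (@^~ h) (esym dv).
by rewrite -[X in _ --> X]dvh; exact: LP.
Qed.

Lemma diff_shift f x w : differentiable f (x + w) -> differentiable (fun y => f (y + w)) x.
Proof.
move=> df; have d1 : differentiable (fun y : V => y + w) x.
  by apply: differentiableD => //; exact: differentiable_cst.
exact: (@differentiable_comp _ _ _ _ (fun y => y + w) f x d1 df).
Qed.

(** The difference quotients in direction [w] are holomorphic and bounded near [x] and tend to the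
    directional derivative, so [holo_limit] applies. Iterated, this makes holomorphic functions
    smooth in the real sense. *)
Lemma holo_derivative f x w (rho : R) : 0 < rho -> holo_ball f x rho ->
  differentiable (fun y => 'd f y w) x.
Proof.
move=> rho0 hf.
have dfx : differentiable f x by apply: hf; rewrite subrr nrm0.
have [s0 s00 sB] : exists2 s, 0 < s & forall y, nrm (y - x) < s -> nrm (f y - f x) < 1.
  exact: (continuous_nrmP f x).1 (differentiable_continuous dfx) 1 ltr01.
pose s := Num.min s0 rho; pose B := nrm (f x) + 1.
have sp : 0 < s by rewrite lt_min s00.
have hs : holo_ball f x s by move=> y; rewrite lt_min => /andP[_ /hf].
have fB y : nrm (y - x) < s -> nrm (f y) <= B.
  rewrite lt_min => /andP[/sB ys _]; rewrite -[f y](subrK (f x)) addrC.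
  by apply: le_trans (nrmD _ _) _; rewrite lerD2l ltW.
clearbody s.
(* [holo_limit] asks for an ultrafilter, so the step t tends to 0 from the right along one. *)
have [U [UU subU]] := ultraFilterLemma (at_right_proper_filter (0 : R)).
have s2 : 0 < s / 2 by rewrite divr_gt0.
have sub y z : nrm (y - x) < s / 2 -> nrm (z - y) < s / 2 -> nrm (z - x) < s.
  by move=> yx zy; apply: le_lt_trans (nrm_tri z y x) _; lra.
have ball2 y : nrm (y - x) < s / 2 -> holo_ball f y (s / 2) /\ forall z, nrm (z - y) < s / 2 -> nrm (f z) <= B.
  by move=> yx; split=> z zy; [apply: hs|apply: fB]; exact: sub yx zy.
pose q (t : R) y : C R := rC t^-1 * (f (y + rC t *: w) - f y).
pose K := 8 * 64 * B / (s / 2) ^+ 2.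
(* Below [t0] the increment t w lies within s / 8, the range of the Taylor bound for radius s / 2; t
   < 1 bounds the quotients uniformly. *)
pose t0 := Num.min (s / 8 / (nrm w + 1)) 1.
have w1 : 0 < nrm w + 1 by rewrite ltr_wpDl ?nrm_ge0.
have t00 : 0 < t0 by rewrite lt_min ltr01 andbT !divr_gt0.
have est t y : 0 < t < t0 -> nrm (y - x) < s / 2 -> nrm (q t y - 'd f y w) <= t * (K * nrm w ^+ 2).
  move=> /andP[tp tt0] yx; have [b1 b2] := ball2 y yx.
  have [_ /(_ (rC t *: w))] := holo_ball_taylor s2 b1 b2.
  rewrite nrmZ nrm_rC gtr0_norm //.
  have tw : t * nrm w < s / 2 / 4.
    move: tt0; rewrite lt_min => /andP[+ _]; rewrite ltr_pdivlMr // => tw1.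
    apply: (@le_lt_trans _ _ (t * (nrm w + 1))); last by lra.
    by rewrite ler_pM2l // lerDl.
  move=> /(_ tw); rewrite linearZ_LR => H.
  have -> : q t y - 'd f y w = rC t^-1 * (f (y + rC t *: w) - f y - rC t *: 'd f y w).
    rewrite mulrBr -/(q t y) -[rC t *: _]/(rC t * _) mulrA -rCM mulVf ?gt_eqF// rC1 mul1r.
    by [].
  rewrite nrmM nrm_rC gtr0_norm ?invr_gt0//.
  rewrite ler_pdivrMl //; apply: le_trans H _.
  by rewrite -/K exprMn le_eqVlt; apply/orP; left; apply/eqP; ring.
have near0 (e : R) : 0 < e -> \forall t \near U, 0 < t < e.
  move=> e0; apply: subU.
  by apply: filterS2 (nbhs_right_gt 0) (nbhs_right_lt e0) => t -> ->.
pose B2 := 16 * B / (s / 2) * nrm w + K * nrm w ^+ 2.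
have B0 : 0 <= B by rewrite addr_ge0 ?nrm_ge0.
have K0 : 0 <= K by rewrite /K divr_ge0 ?exprn_ge0 ?mulr_ge0 // ltW.
have qk : \forall t \near U, holo_ball (q t) x (s / 2) /\ forall y, nrm (y - x) < s / 2 -> nrm (q t y) <= B2.
  apply: filterS (near0 _ t00) => t tt; split=> y yx; last first.
    have := est t y tt yx; have [b1 b2] := ball2 y yx.
    have [/(_ w) D _] := holo_ball_taylor s2 b1 b2.
    move=> E; rewrite -[q t y](subrK ('d f y w)) addrC; apply: le_trans (nrmD _ _) _.
    apply: lerD => //; apply: le_trans E _.
    have /andP[tp] := tt; rewrite lt_min => /andP[_ t1].
    have K2 : 0 <= K * nrm w ^+ 2 by rewrite mulr_ge0 // exprn_ge0 // nrm_ge0.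
    by rewrite ler_piMl // ltW.
  have dy : differentiable f y by apply: hs; lra.
  have dyt : differentiable (fun y => f (y + rC t *: w)) y.
    apply: diff_shift; apply: hs; apply: (sub y) => //.
    rewrite [y + _]addrC addrK nrmZ nrm_rC.
    have /andP[tp] := tt; rewrite lt_min => /andP[+ _]; rewrite ltr_pdivlMr // => tw1.
    rewrite gtr0_norm //; apply: (@le_lt_trans _ _ (t * (nrm w + 1))); last by lra.
    by rewrite ler_pM2l // lerDl.
  exact: (@differentiableZ _ _ _ _ (rC t^-1) _ (differentiableB dyt dy)).
have [] // := @holo_limit R U q (fun y => 'd f y w) x (s / 2) B2 UU s2 qk.
move=> y yx; apply/cvg_nrmP => e e0.
pose M := K * nrm w ^+ 2 + 1.
have M1 : 0 < M by rewrite ltr_wpDl // mulr_ge0 ?exprn_ge0 ?nrm_ge0.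
apply: filterS2 (near0 _ t00) (near0 _ (divr_gt0 e0 M1)) => t tt /andP[tp te].
apply: le_lt_trans (est t y tt yx) _.
move: te; rewrite ltr_pdivlMr //; apply: le_lt_trans.
by rewrite ler_pM2l // lerDl.
Qed.

Lemma holo_continuous_derivative f x w (rho : R) : 0 < rho -> holo_ball f x rho ->
  {for x, continuous (fun y => 'd f y w)}.
Proof. by move=> r0 /(holo_derivative w r0)/differentiable_continuous. Qed.
End SeveralVariables.

(** * Row vectors with the max norm *)

Section Rows.

Lemma normr_coord (K : numFieldType) n (v : 'rV[K]_n) j : `|v 0 j| <= `|v|.
Proof.
rewrite [leRHS]/Num.norm /= mx_normE -[leLHS]nngE num_le.
exact: (@le_bigmax _ _ _ _ (fun ij : 'I_1 * 'I_n => `|v ij.1 ij.2|%:nng) (0, j)).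
Qed.

Lemma normr_row_le (K : numFieldType) n (v : 'rV[K]_n) (M : K) :
  0 <= M -> (forall j, `|v 0 j| <= M) -> `|v| <= M.
Proof.
move=> M0 H; rewrite [leLHS]/Num.norm /= mx_normE.
case/nonnegP: M0 H => {}M H.
rewrite num_le; apply/bigmax_leP; split; first exact: (ge0 M).
by move=> [i j] _ /=; rewrite -num_le /= ord1.
Qed.

Variables (R : realType) (n : nat).

Lemma nrm_coord (v : 'rV[C R]_n) j : nrm (v 0 j) <= nrm v.
Proof. by have := normr_coord v j; rewrite !nrmE lerC. Qed.

Lemma nrm_row_le (v : 'rV[C R]_n) (M : R) : 0 <= M -> (forall j, nrm (v 0 j) <= M) -> nrm v <= M.
Proof.
move=> M0 H; have := @normr_row_le _ _ v (rC M); rewrite nrmE -[0]rC0 !lerC; apply => //.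
by move=> j; rewrite nrmE lerC.
Qed.

Lemma nrm_row_lt (v : 'rV[C R]_n) (M : R) : 0 < M -> (forall j, nrm (v 0 j) < M) -> nrm v < M.
Proof.
move=> M0 H; have [j|n0] := pselect (exists j : 'I_n, nrm v <= nrm (v 0 j)).
  by case: j => j /le_lt_trans; apply.
pose S := \big[Num.max/0]_(j < n) nrm (v 0 j).
apply: (@le_lt_trans _ _ S).
  apply: nrm_row_le; first by rewrite /S; apply/bigmax_geP; left.
  by move=> j; apply: le_bigmax.
by apply/bigmax_ltP; split.
Qed.

Lemma cvg_rowP (T : Type) (F : set_system T) {FF : Filter F} (f : T -> 'rV[C R]_n) (l : 'rV[C R]_n) :
  f @ F --> l <-> forall j, (fun t => f t 0 j : C R) @ F --> (l 0 j : C R).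
Proof.
split=> [/cvg_nrmP fl j|fl].
  apply/(@cvg_nrmP R T F FF (C R)) => e e0; apply: filterS (fl e e0) => t.
  by apply: le_lt_trans; have := nrm_coord (f t - l) j; rewrite !mxE.
apply/cvg_nrmP => e e0.
have : \forall t \near F, forall j, nrm (f t 0 j - l 0 j) < e.
  apply: filter_forall => j.
  by have /(@cvg_nrmP R T F FF (C R))/(_ e e0) := fl j.
by apply: filterS => t tP; apply: nrm_row_lt => // j; rewrite !mxE.
Qed.

(** Coordinates are bounded, hence converge along any ultrafilter, and the limit row stays in the
    ball. *)
Lemma closed_ball_compact (c : 'rV[C R]_n) (r : R) : compact [set v | nrm (v - c) <= r].
Proof.
rewrite compact_ultra => F UF FA.
have PF : ProperFilter F := @ultra_proper _ _ UF.
have /choice[l lP] : forall j, exists l : C R, (fun v : 'rV[C R]_n => v 0 j : C R) @ F --> l.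
  move=> j; apply: (@ultra_bounded_cvg R _ F _ (r + nrm (c 0 j))) => //.
  apply: filterS FA => v /= vr.
  rewrite -[v 0 j](subrK (c 0 j)); apply: le_trans (nrmD _ _) _; rewrite lerD2r.
  by apply: le_trans vr; have := nrm_coord (v - c) j; rewrite !mxE.
have cl : F --> (\row_j l j : 'rV[C R]_n).
  by apply: (cvg_rowP id (\row_j l j)).2 => j; rewrite mxE; exact: lP.
exists (\row_j l j); split => //=.
apply: (@cvg_nrm_le R _ _ F PF (fun v => v - c)); last exact: FA.
by apply: cvgB_nrm; [exact: cl | exact: cvg_cst].
Qed.

Lemma diff_row (V : normedModType (C R)) (f : V -> 'rV[C R]_n) (x : V) :
  (forall j, differentiable (fun y => f y 0 j : C R) x) ->
  differentiable f x /\ forall h j, 'd f x h 0 j = 'd (fun y => f y 0 j : C R) x h.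
Proof.
move=> df; pose L h : 'rV[C R]_n := \row_j 'd (fun y => f y 0 j : C R) x h.
suff [dF dv] : is_diff x f L.
  split; first exact: dF.
  move=> h j; have dvh : L h = 'd f x h := congr1 (@^~ h) (esym dv).
  by transitivity (L h 0 j); [exact: (congr1 (fun v : 'rV_n => v 0 j) (esym dvh)) | rewrite mxE].
apply: cdiffI.
- by move=> a u v; apply/rowP => j; rewrite !mxE linearP.
- have /choice[B BP] : forall j, exists B, 0 < B /\ forall h, nrm ('d (fun y => f y 0 j : C R) x h) <= B * nrm h.
    move=> j; have [B B0 BP] := linear_continuous_bounded (diff_continuous (df j)).
    by exists B.
  exists (\sum_j B j) => h; apply: nrm_row_le.
    by rewrite mulr_ge0 ?nrm_ge0 // sumr_ge0 // => j _; apply/ltW; case: (BP j).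
  move=> j; rewrite mxE; have [_ /(_ h) /le_trans] := BP j; apply.
  rewrite ler_wpM2r ?nrm_ge0// (bigD1 j) //= lerDl sumr_ge0 // => i _.
  by apply/ltW; case: (BP i).
move=> e e0.
have : \forall h \near (0 : V), forall j, nrm (f (x + h) 0 j - f x 0 j - 'd (fun y => f y 0 j : C R) x h) <= e * nrm h.
  apply: filter_forall => j; have [d d0 dP] := cdiffP (df j) e0.
  by apply/nrm_nbhsP; exists d => // h; rewrite subr0; exact: dP.
move=> /nrm_nbhsP[d d0 dP]; exists d => // h hd; apply: nrm_row_le.
  by rewrite mulr_ge0 ?nrm_ge0 ?ltW.
by move=> j; rewrite !mxE; apply: dP; rewrite subr0.
Qed.

Lemma diff_row_coord (V : normedModType (C R)) (f : V -> 'rV[C R]_n) (x : V) j :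
  differentiable f x -> differentiable (fun y => f y 0 j : C R) x.
Proof.
move=> df.
exact: (@differentiable_comp _ _ _ _ f (fun v : 'rV[C R]_n => v 0 j : C R) x df (differentiable_coord _ _ _)).
Qed.

Lemma is_cder_row (f : C R -> 'rV[C R]_n) (z : C R) (d : 'rV[C R]_n) :
  is_cder f z d <-> forall j, is_cder (fun w => f w 0 j : C R) z (d 0 j).
Proof.
split=> [fd j e e0|fd].
  have [r r0 rP] := fd e e0; exists r => // h /rP; apply: le_trans.
  by have := nrm_coord (f (z + h) - f z - h *: d) j; rewrite !mxE.
have [df dv] := diff_row (fun j => @ex_diff _ _ _ _ _ _ _ (is_cder_diff (fd j))).
apply/is_cderP; split; first exact/derivable1_diffP.
rewrite derive1E' //; apply/rowP => j; rewrite dv.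
have [_ ->] := is_cder_diff (fd j).
exact: mul1r.
Qed.
End Rows.

(** * Charts and densities of pull-backs *)

Section QuadraticForm.
Variables (R : realType) (n : nat).
Implicit Types (H : 'M[C R]_n) (v : 'rV[C R]_n).

Definition qform H v : R := reC ((v *m H *m adjoint v) 0 0).

Lemma qformE H v : (v *m H *m adjoint v) 0 0 = \sum_i \sum_j v 0 i * H i j * (v 0 j)^*.
Proof.
rewrite mxE exchange_big; apply: eq_bigr => j _; rewrite mxE big_distrl /=.
by apply: eq_bigr => i _; rewrite !mxE.
Qed.

Lemma adjointM m p q (A : 'M[C R]_(m, p)) (B : 'M[C R]_(p, q)) :
  adjoint (A *m B) = adjoint B *m adjoint A.
Proof. by rewrite /adjoint trmx_mul map_mxM. Qed.

Lemma qform_mulmx H (J : 'M[C R]_n) v : qform (J *m H *m adjoint J) v = qform H (v *m J).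
Proof. by rewrite /qform adjointM !mulmxA. Qed.

Lemma qformZ H a v : qform H (a *: v) = nrm a ^+ 2 * qform H v.
Proof.
rewrite /qform !qformE; have -> : \sum_i \sum_j (a *: v) 0 i * H i j * ((a *: v) 0 j)^* =
    (a * a^*) * \sum_i \sum_j v 0 i * H i j * (v 0 j)^*.
  rewrite big_distrr /=; apply: eq_bigr => i _; rewrite big_distrr /=; apply: eq_bigr => j _.
  by rewrite !mxE rmorphM /=; ring.
rewrite -normCK nrmE expr2 -rCM reCM /= mul0r subr0.
by rewrite expr2.
Qed.

(** A coarse substitute for the operator norm, small as soon as all entries are small. *)
Definition mxsum H : R := \sum_i \sum_j nrm (H i j).

Lemma mxsum_ge0 H : 0 <= mxsum H.
Proof. by apply: sumr_ge0 => i _; apply: sumr_ge0 => j _; exact: nrm_ge0. Qed.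

Lemma nrm_sum (I : Type) (r : seq I) (P : pred I) (F : I -> C R) :
  nrm (\sum_(i <- r | P i) F i) <= \sum_(i <- r | P i) nrm (F i).
Proof.
elim/big_ind2: _ => [|x a y b xa yb|i _ //]; first by rewrite nrm0.
by apply: le_trans (nrmD _ _) _; exact: lerD.
Qed.

Lemma qform_le H v : `|qform H v| <= mxsum H * nrm v ^+ 2.
Proof.
rewrite /qform qformE; apply: le_trans (re_le _) _.
apply: le_trans (nrm_sum _ _ _) _; rewrite big_distrl /=; apply: ler_sum => i _.
apply: le_trans (nrm_sum _ _ _) _; rewrite big_distrl /=; apply: ler_sum => j _.
rewrite !nrmM nrm_conj [nrm (v 0 i) * _]mulrC -mulrA ler_wpM2l ?nrm_ge0// expr2.
by rewrite ler_pM ?nrm_ge0 ?nrm_coord.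
Qed.

Lemma qformB H K v : qform (H - K) v = qform H v - qform K v.
Proof. by rewrite /qform mulmxBr mulmxBl !mxE reCB. Qed.
End QuadraticForm.

Lemma nbhsS (T : topologicalType) (z : T) (P Q : set T) : P `<=` Q -> nbhs z P -> nbhs z Q.
Proof. exact: filterS. Qed.

Lemma nbhsI (T : topologicalType) (z : T) (P Q : set T) : nbhs z P -> nbhs z Q -> nbhs z (P `&` Q).
Proof. exact: filterI. Qed.

Lemma continuous_preimage (T S : topologicalType) (g : T -> S) (z : T) (B : set S) :
  {for z, continuous g} -> nbhs (g z) B -> nbhs z (g @^-1` B).
Proof. by move=> cg /cg. Qed.

Lemma continuous_near_eq (T S : topologicalType) (g k : T -> S) (z : T) :
  {for z, continuous g} -> nbhs z [set w | g w = k w] -> {for z, continuous k}.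
Proof.
move=> cg gk B; have gkz : g z = k z := nbhs_singleton gk.
rewrite -gkz => /cg gB; have : nbhs z (g @^-1` B `&` [set w | g w = k w]) by exact: filterI.
by apply: filterS => w /= [gw <-].
Qed.

(** * Holomorphic curves in a manifold and their densities *)

Section Manifold.
Variables (R : realType) (n : nat) (M : complexManifold R n).
Implicit Types (phi psi : chart R n M) (g : C R -> M) (z : C R) (x : M).

(** Holomorphy at a point for maps that are not packaged as [discMap]: rescaled discs live on larger
    discs, Brody curves on all of C. *)
Definition holo_at g z := {for z, continuous g} /\
  forall phi, atlas phi -> chart_dom phi (g z) -> derivable (chart_map phi \o g) z 1.

Lemma chart_at_atlas x : atlas (chart_at x).
Proof. by rewrite /chart_at; case: cid2. Qed.
Lemma chart_at_dom x : chart_dom (chart_at x) x.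
Proof. by rewrite /chart_at; case: cid2. Qed.

Lemma chart_dom_nbhs phi x : chart_dom phi x -> nbhs x (chart_dom phi).
Proof. by move=> px; apply: open_nbhs_nbhs; split => //; exact: chart_dom_open. Qed.

Lemma chart_img_nbhs phi x : chart_dom phi x -> nbhs (chart_map phi x) (chart_map phi @` chart_dom phi).
Proof.
by move=> px; apply: open_nbhs_nbhs; split; [exact: chart_img_open | exists x].
Qed.

Lemma chart_invK phi y : (chart_map phi @` chart_dom phi) y -> chart_map phi (chart_inv phi y) = y.
Proof. by move=> [x px <-]; rewrite chart_mapK. Qed.

Lemma chart_inv_dom phi y : (chart_map phi @` chart_dom phi) y -> chart_dom phi (chart_inv phi y).
Proof. by move=> [x px <-]; rewrite chart_mapK. Qed.

(** Near [z] the expression of [g] in [psi] is the transition map composed with its expression in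
    [phi]; by the row convention the jacobian acts from the right. *)
Lemma is_cder_change g z phi psi v : {for z, continuous g} -> atlas phi -> atlas psi ->
  chart_dom phi (g z) -> chart_dom psi (g z) -> is_cder (chart_map phi \o g) z v ->
  is_cder (chart_map psi \o g) z (v *m jacobian (transition phi psi) (chart_map phi (g z))).
Proof.
move=> cg aphi apsi dphi dpsi gv.
have dt := atlas_holomorphic aphi apsi dphi dpsi.
have := @diff_comp_cder _ _ _ (transition phi psi) (chart_map phi \o g) z v gv dt.
rewrite /jacobian mul_rV_lin1; move/is_cder_near; apply.
apply: (nbhsS _ (continuous_preimage cg (chart_dom_nbhs dphi))) => w gw.
by rewrite /transition /= chart_mapK.
Qed.

Lemma holo_at_chart g z phi : {for z, continuous g} -> atlas phi -> chart_dom phi (g z) ->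
  derivable (chart_map phi \o g) z 1 -> holo_at g z.
Proof.
move=> cg aphi dphi dg; split; first exact: cg.
move=> psi apsi dpsi.
by have /is_cderP[] := is_cder_change cg aphi apsi dphi dpsi (derivable_is_cder dg).
Qed.

Lemma holo_at_continuous g z : holo_at g z -> {for z, continuous g}. Proof. by case. Qed.

Lemma holo_at_is_cder g z phi : holo_at g z -> atlas phi -> chart_dom phi (g z) ->
  is_cder (chart_map phi \o g) z (derive1 (chart_map phi \o g) z).
Proof. by move=> [_ H] aphi dphi; apply/derivable_is_cder/H. Qed.

Lemma holo_at_comp g (h : C R -> C R) z d : is_cder h z d -> holo_at g (h z) -> holo_at (g \o h) z.
Proof.
move=> hd [cg dg]; split; first exact: (@continuous_comp _ _ _ h g z (is_cder_continuous hd) cg).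
move=> phi aphi dphi.
have := is_cder_comp hd (derivable_is_cder (dg phi aphi dphi)).
by move=> /is_cderP[].
Qed.

Variable om : positiveForm M.

(** [pullback_density] for an arbitrary map, so that it makes sense for entire curves as well. *)
Definition dens g z : R :=
  qform (form_coef om (chart_at (g z)) (g z)) (derive1 (chart_map (chart_at (g z)) \o g) z).

Lemma pullback_densityE (f : discMap M) z : pullback_density om f z = dens f z.
Proof. by []. Qed.

Lemma dens_chart g z phi v : {for z, continuous g} -> atlas phi -> chart_dom phi (g z) ->
  is_cder (chart_map phi \o g) z v -> dens g z = qform (form_coef om phi (g z)) v.
Proof.
move=> cg aphi dphi gv; rewrite /dens.
set psi := chart_at (g z).
have apsi : atlas psi := chart_at_atlas (g z).
have dpsi : chart_dom psi (g z) := chart_at_dom (g z).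
have /is_cderP[_ ->] := is_cder_change cg aphi apsi dphi dpsi gv.
by rewrite (form_change om aphi apsi dphi dpsi) qform_mulmx.
Qed.

Lemma qform_ge0 phi x v : atlas phi -> chart_dom phi x -> 0 <= qform (form_coef om phi x) v.
Proof.
move=> aphi dphi; have [->|v0] := eqVneq v 0.
  by rewrite /qform !mul0mx mxE.
have := form_positive om aphi dphi v0; rewrite /qform ltcE => /andP[_ /ltW].
by [].
Qed.

Lemma qform_gt0 phi x v : atlas phi -> chart_dom phi x -> v != 0 -> 0 < qform (form_coef om phi x) v.
Proof.
move=> aphi dphi v0.
by have := form_positive om aphi dphi v0; rewrite /qform ltcE => /andP[_ ].
Qed.

Lemma dens_ge0 g z : 0 <= dens g z.
Proof. by apply: qform_ge0; [exact: chart_at_atlas | exact: chart_at_dom]. Qed.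

(** The chain rule multiplies chart velocities by the scalar [d], and a hermitian form sees |d|^2.
    Moebius maps, rescalings, the exponential and the pole all enter through this rule. *)
Lemma dens_comp g (h : C R -> C R) z d : is_cder h z d -> holo_at g (h z) ->
  dens (g \o h) z = nrm d ^+ 2 * dens g (h z).
Proof.
move=> hd hg.
have [cgh _] := holo_at_comp hd hg.
have [cg dg] := hg.
set phi := chart_at (g (h z)).
have aphi : atlas phi := chart_at_atlas _.
have dphi : chart_dom phi (g (h z)) := chart_at_dom _.
have D := derivable_is_cder (dg phi aphi dphi).
rewrite (dens_chart cgh aphi dphi (is_cder_comp hd D)).
by rewrite qformZ (dens_chart cg aphi dphi D).
Qed.

Definition to_reals (y : 'rV[C R]_n) : 'rV[R]_n * 'rV[R]_n :=
  (\row_j reC (y 0 j), \row_j imC (y 0 j)).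

Lemma to_realsK y : of_reals (to_reals y) = y.
Proof. by apply/rowP => j; rewrite !mxE mkC_eta. Qed.

Lemma normr_to_reals y : `|to_reals y| <= nrm y.
Proof.
rewrite [leLHS]/Num.norm /= ge_max; apply/andP; split; apply: normr_row_le; rewrite ?nrm_ge0// => j.
  by rewrite mxE; apply: le_trans (re_le _) (nrm_coord _ _).
by rewrite mxE; apply: le_trans (im_le _) (nrm_coord _ _).
Qed.

Lemma to_realsB y w : to_reals (y - w) = to_reals y - to_reals w.
Proof. by congr pair; apply/rowP => j; rewrite !mxE ?reCB ?imCB. Qed.

Lemma form_coef_continuous phi x i j : atlas phi -> chart_dom phi x ->
  {for chart_map phi x, continuous (fun y => form_coef om phi (chart_inv phi y) i j : C R)}.
Proof.
move=> aphi dphi; have [sre sim] := form_smooth om i j aphi.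
set y := chart_map phi x.
have Up : (@of_reals R n @^-1` (chart_map phi @` chart_dom phi)) (to_reals y).
  by rewrite /= to_realsK; exists x.
have part (u : 'rV[R]_n * 'rV[R]_n -> R) : differentiable u (to_reals y) ->
    {for y, continuous (u \o to_reals)}.
  move=> /differentiable_continuous cu; apply/continuous_realP => e e0.
  have /cvgrPdist_lt/(_ e e0)/real_nbhsP[d d0 dP] := cu.
  exists d => // w wd; rewrite distrC; apply: dP.
  by rewrite -to_realsB; apply: le_lt_trans (normr_to_reals _) wd.
(* The empty list of directions gives differentiability, hence continuity, of the coefficients
   themselves. *)
have cre := part _ (sre [::] _ Up); have cim := part _ (sim [::] _ Up).
have -> : (fun y => form_coef om phi (chart_inv phi y) i j : C R) =
  (fun y => mkC (((fun p => reC (form_coef om phi (chart_inv phi (of_reals p)) i j)) \o to_reals) y)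
                (((fun p => imC (form_coef om phi (chart_inv phi (of_reals p)) i j)) \o to_reals) y)).
  by apply/funext => w /=; rewrite to_realsK mkC_eta.
exact: cvg_mkC cre cim.
Qed.

End Manifold.

Lemma nbhs_forall (T : topologicalType) (I : finType) (z : T) (P : I -> set T) :
  (forall i, nbhs z (P i)) -> nbhs z [set y | forall i, P i y].
Proof. exact: filter_forall. Qed.

Lemma min_dist_le (R : realDomainType) (a b r : R) : `|Num.min a r - Num.min b r| <= `|a - b|.
Proof.
have h1 := ler_norm (a - b); have h2 := ler_norm (b - a); rewrite distrC in h2.
by rewrite /Num.min; case: ltP => ?; case: ltP => ?; rewrite ler_norml; lra.
Qed.

Lemma perturbed_bounds (R : realFieldType) (m S A B N : R) :
  `|A - B| <= m / 2 * N -> `|B| <= S * N -> m * N <= B ->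
  m / 2 * N <= A <= (S + m / 2) * N.
Proof.
by rewrite !ler_norml => /andP[D1 D2] /andP[B1 B2] B3; apply/andP; split; lra.
Qed.

(** * Coordinate balls on which the form is comparable to the coordinate norm *)

Section AdaptedCharts.
Variables (R : realType) (n : nat).

Lemma bform_le (H : 'M[C R]_n) (u v : 'rV[C R]_n) :
  nrm ((u *m H *m adjoint v) 0 0) <= mxsum H * (nrm u * nrm v).
Proof.
have -> : (u *m H *m adjoint v) 0 0 = \sum_i \sum_j u 0 i * H i j * (v 0 j)^*.
  rewrite mxE exchange_big; apply: eq_bigr => j _; rewrite mxE big_distrl /=.
  by apply: eq_bigr => i _; rewrite !mxE.
apply: le_trans (nrm_sum _ _ _) _; rewrite big_distrl /=; apply: ler_sum => i _.
apply: le_trans (nrm_sum _ _ _) _; rewrite big_distrl /=; apply: ler_sum => j _.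
rewrite !nrmM nrm_conj [nrm (u 0 i) * _]mulrC -mulrA ler_wpM2l ?nrm_ge0//.
by rewrite ler_pM ?nrm_ge0 ?nrm_coord.
Qed.

Lemma continuous_qform (H : 'M[C R]_n) : continuous (qform H : 'rV[C R]_n -> R).
Proof.
move=> w; apply/continuous_realP => e e0.
pose K := mxsum H * (2 * nrm w + 1) + 1.
have K0 : 0 < K by rewrite ltr_wpDl // mulr_ge0 ?mxsum_ge0// addr_ge0 ?mulr_ge0 ?nrm_ge0.
exists (Num.min 1 (e / K)); first by rewrite lt_min ltr01 divr_gt0.
move=> v; rewrite lt_min => /andP[v1 ve].
have -> : qform H v - qform H w = reC (((v - w) *m H *m adjoint v) 0 0 + (w *m H *m adjoint (v - w)) 0 0).
  have E : v *m H *m adjoint v - w *m H *m adjoint w = (v - w) *m H *m adjoint v + w *m H *m adjoint (v - w).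
    have -> : adjoint (v - w) = adjoint v - adjoint w by apply/matrixP => i j; rewrite !mxE rmorphB.
    by rewrite !mulmxBl mulmxBr addrA subrK.
  by rewrite /qform -reCB; congr reC; have := congr1 (fun A : 'M[C R]_1 => A 0 0) E; rewrite !mxE.
apply: le_lt_trans (re_le _) _; apply: le_lt_trans (nrmD _ _) _.
have vw : nrm v <= nrm w + 1.
  by rewrite -[v](subrK w) addrC; apply: le_trans (nrmD _ _) _; rewrite lerD2l ltW.
apply: (@le_lt_trans _ _ (nrm (v - w) * (mxsum H * (2 * nrm w + 1)))).
  have -> : nrm (v - w) * (mxsum H * (2 * nrm w + 1)) =
     mxsum H * (nrm (v - w) * (nrm w + 1)) + mxsum H * (nrm w * nrm (v - w)) by ring.
  apply: lerD; last exact: bform_le.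
  apply: le_trans (bform_le _ _ _) _.
  by rewrite ler_wpM2l ?mxsum_ge0// ler_wpM2l ?nrm_ge0.
apply: (@le_lt_trans _ _ (nrm (v - w) * K)); first by rewrite ler_wpM2l ?nrm_ge0 // lerDl.
by rewrite -ltr_pdivlMr.
Qed.

(** The minimum over the unit sphere, compact as a closed subset of a ball, serves as [m];
    homogeneity extends the bound. *)
Lemma qform_lower (H : 'M[C R]_n) : (forall v, v != 0 -> 0 < qform H v) ->
  exists2 m : R, 0 < m & forall v, m * nrm v ^+ 2 <= qform H v.
Proof.
move=> Hpos.
pose S := [set v : 'rV[C R]_n | nrm v = 1].
have cS : compact S.
  apply: (@subclosed_compact _ _ [set v | nrm (v - 0) <= 1]); last 2 first.
  - exact: closed_ball_compact.
  - by move=> v; rewrite /S /= subr0 => ->.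
  have -> : S = @nrm R _ @^-1` [set (1 : R)] by [].
  apply: preimage_closed; first by move=> x _; exact: continuous_nrm.
  exact: closed_eq.
have q0 : qform H 0 = 0 by rewrite /qform !mul0mx mxE.
(* The sphere is empty only when every vector vanishes (n = 0), and any constant works then. *)
have [[s Ss]|S0] := pselect (S !=set0); last first.
  exists 1 => // v; have [->|v0] := eqVneq v 0; first by rewrite nrm0 expr0n /= mulr0 q0.
  by have [u [u1 _]] := unit_vector v0; case: S0; exists u.
have [c /set_mem Sc cmin] := compact_EVT_min (ex_intro _ s Ss) cS (continuous_subspaceT (@continuous_qform H)).
have c0 : c != 0 by rewrite -nrm_gt0 Sc.
exists (qform H c); first exact: Hpos.
move=> v; have [->|v0] := eqVneq v 0; first by rewrite nrm0 expr0n /= mulr0 q0.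
have [u [u1 vu]] := unit_vector v0.
rewrite {2}vu qformZ nrm_rC ger0_norm ?nrm_ge0// mulrC ler_wpM2l ?exprn_ge0 ?nrm_ge0//.
by apply: cmin; apply/mem_set.
Qed.

Variables (M : complexManifold R n) (om : positiveForm M).

(** The lower constant [m] turns a bound on the density into a bound on the chart velocity; the
    upper constant [K] turns Cauchy estimates in the chart into a bound on the density. *)
Definition adapted (phi : chart R n M) (p : M) (rho m K : R) :=
  [/\ atlas phi, chart_dom phi p, [/\ 0 < rho, 0 < m & 0 < K],
      (forall y, nrm (y - chart_map phi p) <= rho -> (chart_map phi @` chart_dom phi) y) &
      (forall x v, chart_dom phi x -> nrm (chart_map phi x - chart_map phi p) <= rho ->
         m * nrm v ^+ 2 <= qform (form_coef om phi x) v <= K * nrm v ^+ 2)].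

Lemma adapted_chart (p : M) : exists phi rho m K, adapted phi p rho m K.
Proof.
pose phi := chart_at p.
have aphi : atlas phi := chart_at_atlas p.
have dphi : chart_dom phi p := chart_at_dom p.
pose H := form_coef om phi p.
have [m m0 mP] := qform_lower (fun v v0 => qform_gt0 om aphi dphi v0).
(* n^2 entries below this bound sum to at most m / 2; the successor keeps the denominator nonzero
   when n = 0. *)
have c0 : 0 < m / 2 / (n * n).+1%:R by rewrite !divr_gt0 // ltr0n.
have /nrm_nbhsP[e e0 eP] : \forall y \near chart_map phi p,
    (chart_map phi @` chart_dom phi) y /\
    forall i j, nrm (form_coef om phi (chart_inv phi y) i j - H i j) < m / 2 / (n * n).+1%:R.
  apply: filterI; first exact: chart_img_nbhs.
  apply: (@nbhs_forall _ _ _ (fun i y => forall j, nrm (form_coef om phi (chart_inv phi y) i j - H i j) < m / 2 / (n * n).+1%:R)) => i.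
  apply: (@nbhs_forall _ _ _ (fun j y => nrm (form_coef om phi (chart_inv phi y) i j - H i j) < m / 2 / (n * n).+1%:R)) => j.
  have := form_coef_continuous (om := om) (i := i) (j := j) aphi dphi.
  move=> /continuous_nrmP/(_ _ c0)[d d0 dP]; apply/nrm_nbhsP; exists d => // y /dP.
  by rewrite chart_mapK.
have e2 : e / 2 < e by rewrite ltr_pdivrMr // mulr_natr mulr2n ltrDl.
exists phi, (e / 2), (m / 2), (mxsum H + m / 2); split => //.
- by split; rewrite ?divr_gt0// ltr_wpDl ?mxsum_ge0 ?divr_gt0.
- by move=> y ye; have [] := eP y (le_lt_trans ye e2).
move=> x v dx xe; have [_] := eP _ (le_lt_trans xe e2).
rewrite chart_mapK // => small.
have D : `|qform (form_coef om phi x) v - qform H v| <= m / 2 * nrm v ^+ 2.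
  rewrite -qformB; apply: le_trans (qform_le _ _) _.
  rewrite ler_wpM2r ?exprn_ge0 ?nrm_ge0//.
  apply: (@le_trans _ _ (\sum_(i < n) \sum_(j < n) (m / 2 / (n * n).+1%:R))).
    by apply: ler_sum => i _; apply: ler_sum => j _; rewrite !mxE ltW.
  rewrite !sumr_const !card_ord -mulrnA -[leLHS]mulr_natr [leLHS]mulrAC ler_pdivrMr ?ltr0n//.
  by rewrite ler_pM2l ?divr_gt0// ler_nat.
have := mP v; have := qform_le H v; move: D; exact: perturbed_bounds.
Qed.

Section ChartBall.
Variables (phi : chart R n M) (p : M) (rho : R).
Hypothesis sub : forall y : 'rV[C R]_n, nrm (y - chart_map phi p) <= rho -> (chart_map phi @` chart_dom phi) y.

Definition chart_ball (r : R) : set M :=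
  [set x | chart_dom phi x /\ nrm (chart_map phi x - chart_map phi p) <= r].

Lemma chart_ball_compact r : r <= rho -> compact (chart_ball r).
Proof.
move=> rr.
pose D := [set y | nrm (y - chart_map phi p) <= r].
have -> : chart_ball r = chart_inv phi @` D.
  apply/seteqP; split=> [x [dx xr]|_ [y yr <-]].
    by exists (chart_map phi x) => //; rewrite chart_mapK.
  have img := sub (le_trans yr rr).
  by split; [exact: chart_inv_dom | rewrite chart_invK].
apply: continuous_compact; last exact: closed_ball_compact.
apply: continuous_in_subspaceT => y /set_mem yr.
by apply: chart_inv_continuous; apply: sub; exact: le_trans rr.
Qed.

(** The Hausdorff property enters here: a compact coordinate ball is closed in [M], so its
    complement is open. *)
Lemma chart_ball_closed r : r <= rho -> closed (chart_ball r).
Proof.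
by move=> rr; apply: compact_closed; [exact: manifold_hausdorff | exact: chart_ball_compact].
Qed.

End ChartBall.

Section Radius.
Variables (phi : chart R n M) (p : M) (rho m K : R).
Hypothesis ad : adapted phi p rho m K.

(** Truncation at [rho] extends the coordinate distance from [p] to a continuous function on all of
    [M], so curves can be followed outside the chart. *)
Definition chart_radius (x : M) : R :=
  if `[< chart_dom phi x >] then Num.min (nrm (chart_map phi x - chart_map phi p)) rho else rho.

Lemma chart_radiusE x : chart_dom phi x -> chart_radius x = Num.min (nrm (chart_map phi x - chart_map phi p)) rho.
Proof. by move=> dx; rewrite /chart_radius asboolT. Qed.

Lemma chart_radius_le x : chart_radius x <= rho.
Proof. by rewrite /chart_radius; case: ifP => // _; rewrite ge_min lexx orbT. Qed.

Lemma chart_radius_ge0 x : 0 <= chart_radius x.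
Proof.
have [_ _ [r0 _ _] _ _] := ad.
by rewrite /chart_radius; case: ifP => _; rewrite ?le_min ?nrm_ge0 ltW.
Qed.

Lemma chart_radius_center : chart_radius p = 0.
Proof.
have [_ dp [r0 _ _] _ _] := ad.
by rewrite chart_radiusE // subrr nrm0 min_l // ltW.
Qed.

Lemma chart_radius_ball r x : r < rho -> chart_radius x <= r <-> chart_ball phi p r x.
Proof.
move=> rr; rewrite /chart_radius /chart_ball /=; case: asboolP => dx.
  by rewrite ge_min [rho <= r]leNgt rr orbF; split=> [|[]].
by rewrite leNgt rr; split=> // -[].
Qed.

Lemma chart_radius_out x : ~ chart_ball phi p rho x -> chart_radius x = rho.
Proof.
rewrite /chart_radius /chart_ball /=; case: asboolP => dx // nb.
by apply: min_r; rewrite leNgt; apply/negP => /ltW H; apply: nb.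
Qed.

(** Off the chart domain, the complement of the closed ball is a neighbourhood on which the function
    equals [rho]. *)
Lemma chart_radius_continuous : continuous chart_radius.
Proof.
move=> x; have [dx|ndx] := pselect (chart_dom phi x).
  have c1 : {for x, continuous (fun y => Num.min (nrm (chart_map phi y - chart_map phi p)) rho)}.
    apply: (@continuous_comp _ _ _ (chart_map phi) (fun y => Num.min (nrm (y - chart_map phi p)) rho)).
      exact: chart_map_continuous.
    apply/continuous_realP => e e0; exists e => // y ye.
    apply: le_lt_trans ye; have H := nrm_ler_dist (y - chart_map phi p) (chart_map phi x - chart_map phi p).
    have E : y - chart_map phi p - (chart_map phi x - chart_map phi p) = y - chart_map phi x.
      by rewrite opprB addrA subrK.
    rewrite E in H; apply: le_trans H.
    exact: min_dist_le.
  apply: continuous_near_eq c1 _.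
  by apply: nbhsS (chart_dom_nbhs dx) => y dy /=; rewrite chart_radiusE.
have c1 : {for x, continuous (fun _ : M => rho)} by exact: cst_continuous.
apply: continuous_near_eq c1 _.
have : nbhs x (~` chart_ball phi p rho).
  apply: open_nbhs_nbhs; split; last by case.
  by apply: closed_openC; have [_ _ _ sub _] := ad; exact: (chart_ball_closed sub).
by apply: nbhsS => y nb /=; rewrite chart_radius_out.
Qed.

Lemma chart_ball_deriv (g : C R -> M) z L : 0 <= L -> holo_at g z -> dens om g z <= m * L ^+ 2 ->
  chart_ball phi p rho (g z) -> nrm (derive1 (chart_map phi \o g) z) <= L.
Proof.
move=> L0 hg dL [dz rz]; have [aphi _ [_ m0 _] _ bnd] := ad.
have D := holo_at_is_cder hg aphi dz.
move: dL; rewrite (dens_chart om (holo_at_continuous hg) aphi dz D) => dL.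
have /andP[lo _] := bnd _ (derive1 (chart_map phi \o g) z) dz rz.
have := le_trans lo dL; rewrite ler_pM2l // => H.
by rewrite -ler_sqr ?nnegrE ?nrm_ge0.
Qed.

(** Continuous induction along the segment: where the curve is in the ball, the density bounds its
    chart velocity by [L]; elsewhere the radius is locally constant along it. *)
Lemma chart_radius_lipschitz (g : C R -> M) (a b : C R) L : 0 <= L ->
  (forall t : R, 0 <= t <= 1 -> holo_at g (a + rC t * (b - a)) /\ dens om g (a + rC t * (b - a)) <= m * L ^+ 2) ->
  `|chart_radius (g b) - chart_radius (g a)| <= L * nrm (b - a).
Proof.
move=> L0 H.
pose k t := chart_radius (g (a + rC t * (b - a))).
suff : `|k 0 - k 1| <= L * nrm (b - a) * (1 - 0).
  by rewrite /k rC0 mul0r addr0 rC1 mul1r (addrC a) subrK subr0 mulr1 distrC.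
apply: (@local_growth R (fun s t => `|k s - k t|) 0 1 (L * nrm (b - a)) ler01).
- by rewrite subrr normr0.
- by move=> s t u; exact: ler_distD.
move=> t e t01 e0; have [hg dL] := H t t01; set z := a + rC t * (b - a) in hg dL *.
have cg := holo_at_continuous hg.
have B1 : 0 < nrm (b - a) + 1 by rewrite ltr_wpDl ?nrm_ge0.
have e1 : 0 < e / (nrm (b - a) + 1) by rewrite divr_gt0.
suff [r r0 rP] : exists2 r : R, 0 < r & forall w, nrm (w - z) < r ->
    `|chart_radius (g w) - chart_radius (g z)| <= (L + e / (nrm (b - a) + 1)) * nrm (w - z).
  exists (r / (nrm (b - a) + 1)); first by rewrite divr_gt0.
  move=> s s01; rewrite ltr_pdivlMr // => st.
  have hn : nrm (a + rC s * (b - a) - z) = `|s - t| * nrm (b - a) by rewrite segment_nrm.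
  suff HH : `|chart_radius (g (a + rC s * (b - a))) - chart_radius (g z)| <= (L * nrm (b - a) + e) * `|s - t|.
    by split; [exact: HH | rewrite distrC; exact: HH].
  apply: le_trans (rP _ _) _.
    by rewrite hn; apply: le_lt_trans st; rewrite ler_wpM2l // lerDl.
  rewrite hn mulrDl [leRHS]mulrDl; apply: lerD.
    by rewrite le_eqVlt; apply/orP; left; apply/eqP; ring.
  rewrite mulrCA mulrC ler_wpM2r // mulrAC ler_pdivrMr // ler_pM2l // lerDl //.
have [inb|outb] := pselect (chart_ball phi p rho (g z)); last first.
  have : nbhs z (g @^-1` (~` chart_ball phi p rho)).
    apply: continuous_preimage cg _; apply: open_nbhs_nbhs; split => //.
    by apply: closed_openC; have [_ _ _ sub _] := ad; exact: (chart_ball_closed sub).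
  move=> /(@nrm_nbhsP R (C R))[r r0 rP]; exists r => // w /rP /= ow.
  rewrite !chart_radius_out // subrr normr0 mulr_ge0 ?nrm_ge0//.
  by rewrite addr_ge0 // ltW.
have [aphi _ [_ m0 _] _ bnd] := ad.
have [dz _] := inb.
have vL := chart_ball_deriv L0 hg dL inb.
have [r1 r10 r1P] := holo_at_is_cder hg aphi dz e1.
have /(@nrm_nbhsP R (C R))[r2 r20 r2P] := continuous_preimage cg (chart_dom_nbhs dz).
exists (Num.min r1 r2); first by rewrite lt_min r10.
move=> w; rewrite lt_min => /andP[w1 w2].
rewrite !chart_radiusE //; last exact: r2P.
have := r1P (w - z) w1; rewrite [z + _]addrC subrK /= => H1.
set v := derive1 _ z in H1 vL.
apply: (@le_trans _ _ (nrm (chart_map phi (g w) - chart_map phi (g z)))).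
  have H2 := nrm_ler_dist (chart_map phi (g w) - chart_map phi p) (chart_map phi (g z) - chart_map phi p).
  rewrite opprB addrA subrK in H2; apply: le_trans H2.
  exact: min_dist_le.
rewrite -[_ - chart_map phi (g z)](subrK ((w - z) *: v)) addrC.
apply: le_trans (nrmD _ _) _; rewrite mulrDl; apply: lerD => //.
by rewrite nrmZ mulrC ler_wpM2r ?nrm_ge0.
Qed.
End Radius.
End AdaptedCharts.

(** * Boundedness of the density and the Kobayashi distance *)

Section Moebius.
Variable R : realType.
Implicit Types a b z : C R.

Lemma disc1P z : disc 1 z <-> nrm z < 1.
Proof. by []. Qed.

Definition moebius a z : C R := (z + a) / (1 + a^* * z).

Lemma moebius_identity a z :
  nrm (1 + a^* * z) ^+ 2 - nrm (z + a) ^+ 2 = (1 - nrm a ^+ 2) * (1 - nrm z ^+ 2).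
Proof.
rewrite !nrm_sqr !reCD !imCD !reCM !imCM reC_conj imC_conj /=.
by ring.
Qed.

Lemma moebius_den a z : nrm a < 1 -> nrm z < 1 -> 1 + a^* * z != 0.
Proof.
move=> a1 z1; rewrite -nrm_gt0.
have H : nrm (a^* * z) < 1.
  rewrite nrmM nrm_conj; apply: le_lt_trans z1.
  by rewrite ler_piMl ?nrm_ge0 // ltW.
have := @nrm_tri R (C R) 1 (- (a^* * z)) 0; rewrite !subr0 opprK nrmN nrm1; lra.
Qed.

Lemma moebius_disc a z : nrm a < 1 -> nrm z < 1 -> nrm (moebius a z) < 1.
Proof.
move=> a1 z1; have d0 := moebius_den a1 z1.
have dp : 0 < nrm (1 + a^* * z) by rewrite nrm_gt0.
rewrite /moebius nrmM nrmV ltr_pdivrMr // mul1r.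
rewrite -ltr_sqr ?nnegrE ?nrm_ge0// -subr_gt0 moebius_identity.
by rewrite mulr_gt0 // subr_gt0 expr_lt1 // nrm_ge0.
Qed.

Lemma moebius0 a : moebius a 0 = a.
Proof. by rewrite /moebius mulr0 addr0 add0r divr1. Qed.

Lemma moebius_cder a z : nrm a < 1 -> nrm z < 1 ->
  is_cder (moebius a) z ((1 - a * a^*) / (1 + a^* * z) ^+ 2).
Proof.
move=> a1 z1; have d0 := moebius_den a1 z1.
have D1 : is_cder (fun w : C R => w + a) z (1 + 0) := is_cderD (is_cder_id z) (is_cder_cst a z).
have D2 : is_cder (fun w : C R => 1 + a^* * w) z (0 + (0 * z + a^* * 1)).
  exact: (is_cderD (is_cder_cst (1 : C R) z) (is_cderM (is_cder_cst (a^* : C R) z) (is_cder_id z))).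
have := is_cderM D1 (is_cderV D2 d0).
suff -> : (1 + 0) * (1 + a^* * z)^-1 + (z + a) * (- (0 + (0 * z + a^* * 1)) / (1 + a^* * z) ^+ 2) =
  (1 - a * a^*) / (1 + a^* * z) ^+ 2 by [].
by field.
Qed.

Definition moebius_inv a b : C R := (b - a) / (1 - a^* * b).

Lemma moebius_invE a b : moebius_inv a b = moebius (- a) b.
Proof. by rewrite /moebius_inv /moebius rmorphN mulNr. Qed.

Lemma moebiusK a b : nrm a < 1 -> nrm b < 1 -> moebius a (moebius_inv a b) = b.
Proof.
move=> a1 b1.
have d1 : 1 - a^* * b != 0.
  by have := @moebius_den (- a) b; rewrite nrmN rmorphN mulNr; apply.
have d2 : 1 - a * a^* != 0.
  rewrite -normCK nrmE expr2 -rCM -rC1 -rCB rC_eq0 subr_eq0 eq_sym lt_eqF //.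
  by rewrite -expr2 expr_lt1 // nrm_ge0.
have d3 : 1 + a^* * moebius_inv a b != 0.
  have -> : 1 + a^* * moebius_inv a b = (1 - a * a^*) / (1 - a^* * b) by rewrite /moebius_inv; field.
  by rewrite mulf_neq0 // invr_eq0.
apply: (mulIf d3); rewrite /moebius -mulrA mulVf // mulr1 /moebius_inv.
by field.
Qed.

Lemma poincareE a b : poincare a b = ln ((1 + nrm (moebius_inv a b)) / (1 - nrm (moebius_inv a b))).
Proof.
rewrite /poincare /moebius_inv nrmM nrmV !nrmE -rCV -rCM /=.
by rewrite [nrm (b - a)]nrmC.
Qed.

Lemma moebius_inv_lt1 a b : nrm a < 1 -> nrm b < 1 -> nrm (moebius_inv a b) < 1.
Proof. by move=> a1 b1; rewrite moebius_invE moebius_disc // nrmN. Qed.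

(** The inequality ln (1 + y) <= y, applied to the reciprocal ratio, gives at least 2 x / (1 + x),
    which is at least x on the unit interval. *)
Lemma ln_ratio_ge (x : R) : 0 <= x < 1 -> x <= ln ((1 + x) / (1 - x)).
Proof.
move=> /andP[x0 x1].
have p1 : 0 < 1 + x by rewrite ltr_wpDr.
have p2 : 0 < 1 - x by rewrite subr_gt0.
have y0 : 0 < (1 - x) / (1 + x) by rewrite divr_gt0.
have -> : (1 + x) / (1 - x) = ((1 - x) / (1 + x))^-1 by rewrite invf_div.
rewrite lnV ?posrE //.
have y1 : -1 < (1 - x) / (1 + x) - 1 by rewrite ltrBrDl subrr.
have := le_ln1Dx y1; rewrite [1 + _]addrC subrK.
have H : x <= 2 * x / (1 + x).
  by rewrite ler_pdivlMr // mulrC ler_wpM2r //; lra.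
have E : (1 - x) / (1 + x) = 1 - 2 * x / (1 + x) by field; rewrite gt_eqF.
by rewrite E; lra.
Qed.

Lemma poincare_ge a b : nrm a < 1 -> nrm b < 1 -> nrm (moebius_inv a b) <= poincare a b.
Proof. by move=> a1 b1; rewrite poincareE ln_ratio_ge // nrm_ge0 moebius_inv_lt1. Qed.

Lemma poincare_ge0 a b : nrm a < 1 -> nrm b < 1 -> 0 <= poincare a b.
Proof. by move=> a1 b1; apply: le_trans (nrm_ge0 _) (poincare_ge a1 b1). Qed.

Lemma ln_ratio_le (x : R) : 0 <= x <= 1 / 2 -> ln ((1 + x) / (1 - x)) <= 4 * x.
Proof.
move=> /andP[x0 x1].
have p2 : 0 < 1 - x by lra.
have E : (1 + x) / (1 - x) = 1 + 2 * x / (1 - x) by field; rewrite gt_eqF.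
have q0 : 0 <= 2 * x / (1 - x) by rewrite divr_ge0 ?mulr_ge0 // ltW.
have y1 : -1 < 2 * x / (1 - x) by lra.
rewrite E; apply: le_trans (le_ln1Dx y1) _.
by rewrite ler_pdivrMr //; nra.
Qed.

Lemma poincare_small a b : nrm (moebius_inv a b) <= 1 / 2 -> poincare a b <= 4 * nrm (moebius_inv a b).
Proof. by move=> h; rewrite poincareE ln_ratio_le // nrm_ge0. Qed.
End Moebius.

Lemma mulC_conj (R : realType) (z : C R) : z * z^* = rC (nrm z ^+ 2).
Proof. by rewrite -normCK nrmE [LHS]expr2 -rCM -expr2. Qed.

Lemma continuous_scale (R : realType) (z : C R) : continuous (fun t : R => rC t * z : C R).
Proof.
move=> t; have D := is_cderM (is_cder_id (rC t)) (is_cder_cst z (rC t)).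
exact: (@continuous_comp _ _ _ (fun t : R => mkC t 0) (fun w => w * z) t (@continuous_mkCl _ 0 t) (is_cder_continuous D)).
Qed.

(** * Hyperbolicity is equivalent to a bound on the density at the centre *)

Section Hyperbolicity.
Variables (R : realType) (n : nat) (M : complexManifold R n).
Implicit Types (f : discMap M) (p q x : M).

Lemma discMap_holo f (z : C R) : nrm z < 1 -> holo_at f z.
Proof.
move=> z1; split; first exact: disc_map_continuous.
by move=> phi aphi dphi; exact: disc_map_holomorphic.
Qed.

Lemma discMap_of_holo (g : C R -> M) : (forall z : C R, nrm z < 1 -> holo_at g z) ->
  exists f : discMap M, disc_map f = g.
Proof.
move=> H; have H1 z : disc 1 z -> {for z, continuous g} by move=> /H[].
have H2 z phi : disc 1 z -> atlas phi -> chart_dom phi (g z) -> derivable (chart_map phi \o g) z 1.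
  by move=> /H[_]; apply.
by exists (DiscMap H1 H2).
Qed.

Lemma discMap_comp f (h h' : C R -> C R) :
  (forall z : C R, nrm z < 1 -> nrm (h z) < 1 /\ is_cder h z (h' z)) ->
  exists f' : discMap M, disc_map f' = f \o h.
Proof.
move=> H; apply: discMap_of_holo => z z1; have [h1 h2] := H z z1.
exact: holo_at_comp h2 (discMap_holo f h1).
Qed.

Variable om : positiveForm M.

(** The reparametrized disc [f \o moebius z] has centre [f z], and [moebius z] has derivative 1 -
    |z|^2 at 0. *)
Lemma dens_disc_bound (K : R) : (forall f, dens om f 0 <= K) ->
  forall f (z : C R), nrm z < 1 -> dens om f z <= K / (1 - nrm z ^+ 2) ^+ 2.
Proof.
move=> fK f z z1.
have [f' f'E] := @discMap_comp f (moebius z) (fun w => (1 - z * z^*) / (1 + z^* * w) ^+ 2)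
  (fun w w1 => conj (moebius_disc z1 w1) (moebius_cder z1 w1)).
have n0 : nrm (0 : C R) < 1 by rewrite nrm0.
have z2 : 0 < 1 - nrm z ^+ 2 by rewrite subr_gt0 expr_lt1 // nrm_ge0.
have hz : holo_at f (moebius z 0) by rewrite moebius0; exact: discMap_holo.
have := fK f'; rewrite f'E (dens_comp om (moebius_cder z1 n0) hz) moebius0.
rewrite mulr0 addr0 expr1n divr1 mulC_conj -rC1 -rCB nrm_rC.
by rewrite gtr0_norm // mulrC => H; rewrite ler_pdivlMr // exprn_gt0.
Qed.

Definition chain_cost (s : seq (discMap M * C R * C R)) : R := \sum_(l <- s) poincare l.1.2 l.2.

Lemma chain_cost_ge0 p s q : disc_chain p s q -> 0 <= chain_cost s.
Proof.
elim: s p => [|[[f a] b] s IH] p /=; first by rewrite /chain_cost big_nil.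
move=> [a1 b1 _ /IH]; rewrite /chain_cost big_cons /= => H.
by rewrite addr_ge0 // poincare_ge0.
Qed.

Lemma disc_chain_cat p s q t x : disc_chain p s q -> disc_chain q t x -> disc_chain p (s ++ t) x.
Proof.
elim: s p => [|[[f a] b] s IH] p /=; first by move=> ->.
by move=> [a1 b1 fa] /IH H /H.
Qed.

Lemma chain_cost_cat s t : chain_cost (s ++ t) = chain_cost s + chain_cost t.
Proof. by rewrite /chain_cost big_cat. Qed.

Lemma kobayashi_eq0 p q : (forall e : R, 0 < e -> exists2 s, disc_chain p s q & chain_cost s < e) ->
  kobayashi p q = 0%E.
Proof.
move=> H; apply/eqP; rewrite eq_le; apply/andP; split.
  apply/lee_addgt0Pr => e e0; rewrite add0e; have [s ps se] := H e e0.
  apply: (@le_trans _ _ (chain_cost s)%:E); last by rewrite lee_fin ltW.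
  by apply: ereal_inf_lbound; exists s.
apply: le_ereal_inf_tmp => _ [s ps <-].
by rewrite lee_fin; exact: chain_cost_ge0 ps.
Qed.

Lemma kobayashi0P p q : kobayashi p q = 0%E ->
  forall e : R, 0 < e -> exists2 s, disc_chain p s q & chain_cost s < e.
Proof.
move=> k0 e e0.
have [|x [s ps <-]] := @lb_ereal_inf_adherent R
    [set (\sum_(l <- s) poincare l.1.2 l.2)%:E | s in [set s | disc_chain p s q]] e e0.
  by rewrite -/(kobayashi p q) k0.
by rewrite -/(kobayashi p q) k0 add0e lte_fin => ?; exists s.
Qed.

(** Each link changes the truncated radius by at most a constant times its Poincare length. Short
    links, mu <= 1/2, use the density bound; for long ones it suffices that the radius varies by at
    most [rho]. *)
Lemma bounded_dens_chain (K : R) phi p rho m K' : adapted om phi p rho m K' ->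
  (forall f, dens om f 0 <= K) -> exists2 c : R, 0 < c &
  forall x s y, disc_chain x s y ->
    `|chart_radius phi p rho y - chart_radius phi p rho x| <= c * chain_cost s.
Proof.
move=> ad fK; have [_ _ [rho0 m0 _] _ _] := ad.
(* As L >= 1, m L^2 >= m L >= 2 |K|, and 2 |K| bounds the density on |z| <= 1/2. *)
pose L := 2 * `|K| / m + 1.
have L1 : 1 <= L by rewrite lerDr divr_ge0 ?mulr_ge0 // ltW.
pose c := 2 * rho + L.
have c0 : 0 < c by rewrite addr_gt0 ?mulr_gt0 // (lt_le_trans ltr01).
exists c => // x s y; elim: s x => [|[[f a] b] s IH] x /=.
  by move=> ->; rewrite subrr normr0 /chain_cost big_nil mulr0.
move=> [a1 b1 fa] /IH; rewrite /chain_cost big_cons /= => H.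
rewrite mulrDr; apply: le_trans (ler_distD (chart_radius phi p rho (f b)) _ _) _.
rewrite addrC; apply: lerD => //.
set mu := nrm (moebius_inv a b).
have mu1 : mu < 1 := moebius_inv_lt1 a1 b1.
have mu0 : 0 <= mu := nrm_ge0 _.
suff : `|chart_radius phi p rho (f b) - chart_radius phi p rho x| <= c * mu.
  move=> /le_trans; apply; rewrite ler_pM2l //; exact: poincare_ge.
have [mu2|mu2] := leP mu (1 / 2); last first.
  apply: (@le_trans _ _ rho).
    have r1 := chart_radius_le phi p rho (f b); have r2 := chart_radius_le phi p rho x.
    have r3 := chart_radius_ge0 ad (f b); have r4 := chart_radius_ge0 ad x.
    by rewrite ler_norml; apply/andP; split; lra.
  have : rho <= 2 * rho * mu by nra.
  by move=> /le_trans; apply; rewrite ler_wpM2r // /c lerDl; lra.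
(* Recentring at [a] turns the link into one from 0 to a point of modulus mu. *)
have [F FE] := @discMap_comp f (moebius a) (fun w => (1 - a * a^*) / (1 + a^* * w) ^+ 2)
  (fun w w1 => conj (moebius_disc a1 w1) (moebius_cder a1 w1)).
have -> : f b = F (moebius_inv a b) by rewrite FE /= moebiusK.
have -> : x = F 0 by rewrite FE /= moebius0 fa.
have := @chart_radius_lipschitz _ _ _ _ _ _ _ _ _ ad F 0 (moebius_inv a b) L (le_trans ler01 L1).
rewrite subr0 -/mu => HL; apply: le_trans (HL _) _; last first.
  by rewrite ler_wpM2r // /c lerDr mulr_ge0 // ltW.
move=> t /andP[t0 t1]; rewrite add0r.
have zt : nrm (rC t * moebius_inv a b) <= 1 / 2.
  by rewrite nrmM nrm_rC ger0_norm // (le_trans _ mu2) // ler_piMl.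
have z1 : nrm (rC t * moebius_inv a b) < 1 by lra.
split; first exact: discMap_holo.
apply: le_trans (dens_disc_bound fK F z1) _.
have z0 := nrm_ge0 (rC t * moebius_inv a b).
set w := nrm (rC t * _) in zt z1 z0 *.
have w2 : w ^+ 2 <= 1 / 4 by nra.
have d0 : 1 / 2 <= (1 - w ^+ 2) ^+ 2 by nra.
rewrite ler_pdivrMr; last by lra.
have K0 := ler_norm K.
have mL : 2 * `|K| <= m * L ^+ 2.
  apply: (@le_trans _ _ (m * L)); last by rewrite ler_pM2l // expr2 ler_peMl // (le_trans ler01).
  by rewrite /L mulrDr mulr1 mulrCA mulfV ?gt_eqF// mulr1 lerDl ltW.
have := normr_ge0 K; nra.
Qed.

Lemma bounded_dens_hyperbolic (K : R) : (forall f, dens om f 0 <= K) -> kobayashi_hyperbolic M.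
Proof.
move=> fK p q /kobayashi0P H; apply: contrapT => pq.
have [phi [rho [m [K' ad]]]] := adapted_chart om p.
have [aphi dp [rho0 _ _] _ _] := ad.
have [c c0 cP] := bounded_dens_chain ad fK.
have eta0 : 0 < chart_radius phi p rho q.
  rewrite /chart_radius; case: asboolP => // dq.
  rewrite lt_min rho0 andbT nrm_gt0 subr_eq0; apply/eqP => E; apply: pq.
  by rewrite -(chart_mapK dp) -(chart_mapK dq) E.
have [s ps] := H _ (divr_gt0 eta0 c0).
rewrite ltr_pdivlMr // mulrC ltNge => /negP; apply.
have := cP _ _ _ ps; rewrite (chart_radius_center ad) subr0 ger0_norm //.
exact: ltW.
Qed.

(** In a chart at [q], the affine disc that sends 0 to [q] and a small eta to [x] joins them at cost
    at most 4 eta; it stays in the chart as soon as [x] has coordinate distance below eta rho from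
    [q]. *)
Lemma short_chains q (e : R) : 0 < e -> \forall x \near q,
  (exists2 s, disc_chain q s x & chain_cost s < e) /\
  (exists2 s, disc_chain x s q & chain_cost s < e).
Proof.
move=> e0; have [phi [rho [m [K' ad]]]] := adapted_chart om q.
have [aphi dq [rho0 _ _] sub _] := ad.
pose eta := Num.min (1 / 2) (e / 8).
have eta0 : 0 < eta by rewrite lt_min !divr_gt0.
have eta1 : eta <= 1 / 2 by rewrite ge_min lexx.
have eta2 : 4 * eta < e.
  have : eta <= e / 8 by rewrite ge_min lexx orbT.
  by lra.
have dn : nbhs q [set x | nrm (chart_map phi x - chart_map phi q) < eta * rho].
  have cq := chart_map_continuous dq.
  apply: (continuous_preimage (B := [set y | nrm (y - chart_map phi q) < eta * rho]) cq).
  by apply/nrm_nbhsP; exists (eta * rho) => //; rewrite mulr_gt0.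
apply: (nbhsS _ (nbhsI (chart_dom_nbhs dq) dn)) => x [dx /= xd].
set d := chart_map phi x - chart_map phi q in xd.
pose g (z : C R) : M := chart_inv phi (chart_map phi q + (z / rC eta) *: d).
have gd (z : C R) : nrm z < 1 -> nrm (chart_map phi q + (z / rC eta) *: d - chart_map phi q) <= rho.
  move=> z1; rewrite addrC addKr nrmZ nrmM nrmV nrm_rC gtr0_norm //.
  rewrite mulrAC ler_pdivrMr // mulrC [rho * _]mulrC.
  have := nrm_ge0 d; have := nrm_ge0 z; nra.
have hg (z : C R) : nrm z < 1 -> holo_at g z.
  move=> z1; have img := sub _ (gd z z1).
  have D : is_cder (fun z : C R => chart_map phi q + (z / rC eta) *: d) z ((rC eta)^-1 *: d).
    have := is_cderD (is_cder_cst (chart_map phi q) z) (is_cder_comp (is_cderZ (rC eta)^-1 (is_cder_id z)) (@is_cder_line _ _ ((rC eta)^-1 *: z) 0 d)).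
    rewrite add0r -[(rC eta)^-1 *: 1]/((rC eta)^-1 * 1) mulr1; apply: is_cder_ext => w.
    by rewrite /= add0r -[_ *: w]/(_ * w) mulrC.
  have cg : {for z, continuous g}.
    apply: (@continuous_comp _ _ _ (fun z : C R => chart_map phi q + (z / rC eta) *: d) (chart_inv phi) z).
      exact: is_cder_continuous D.
    exact: chart_inv_continuous.
  apply: (holo_at_chart cg aphi); first exact: chart_inv_dom.
  suff : is_cder (chart_map phi \o g) z ((rC eta)^-1 *: d) by move/is_cderP => [].
  apply: is_cder_near D _.
  have : nbhs z [set w : C R | nrm w < 1].
    apply/(@nrm_nbhsP R (C R)); exists (1 - nrm z); first by rewrite subr_gt0.
    move=> w /= wz; have := nrm_tri w z 0; rewrite !subr0; lra.
  by apply: nbhsS => w /= w1; rewrite chart_invK //; apply: sub; exact: gd.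
have [f fE] := discMap_of_holo hg.
have f0 : f 0 = q by rewrite fE /g mul0r scale0r addr0 chart_mapK.
have en : nrm (rC eta) < 1 by rewrite nrm_rC ger0_norm ?ltW//; lra.
have feta : f (rC eta) = x.
  by rewrite fE /g mulfV ?rC_eq0 ?gt_eqF// scale1r /d addrC subrK chart_mapK.
have n0 : nrm (0 : C R) < 1 by rewrite nrm0.
have cost0 (a b : C R) : nrm (moebius_inv a b) = eta -> poincare a b < e.
  by move=> E; apply: le_lt_trans (poincare_small _) _; rewrite E.
split.
  exists [:: (f, 0, rC eta)]; first by split.
  rewrite /chain_cost big_seq1 /=; apply: cost0.
  by rewrite /moebius_inv subr0 rmorph0 mul0r subr0 divr1 nrm_rC ger0_norm // ltW.
exists [:: (f, rC eta, 0)]; first by split.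
rewrite /chain_cost big_seq1 /=; apply: cost0.
by rewrite /moebius_inv sub0r mulr0 subr0 divr1 nrmN nrm_rC ger0_norm // ltW.
Qed.

Hypothesis compactM : compact [set: M].

(** Hyperbolicity bounds the cost of reaching each point of [S] below by some e > 0; short chains
    spread the bound e / 2 to a neighbourhood, and compactness makes it uniform. *)
Lemma chains_to_compact p (S : set M) : kobayashi_hyperbolic M -> compact S -> ~ S p ->
  exists2 e : R, 0 < e & forall x s, S x -> disc_chain p s x -> e <= chain_cost s.
Proof.
move=> hyp cS nSp.
have := (compact_near_coveringP S).1 cS R (0^'+) (fun e x => forall s, disc_chain p s x -> e <= chain_cost s) _.
case; last first.
  move=> e0 /= e00 /(_ (e0 / 2)) H.
  have h0 : 0 < e0 / 2 by rewrite divr_gt0.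
  exists (e0 / 2) => // x s Sx ps; apply: (H _ h0 x Sx s ps).
  rewrite /= sub0r normrN gtr0_norm ?divr_gt0//.
  by rewrite ltr_pdivrMr // mulr_natr mulr2n ltrDl.
move=> x Sx.
have px : p <> x by move=> E; apply: nSp; rewrite E.
have [e e0 eP] : exists2 e : R, 0 < e & forall s, disc_chain p s x -> e <= chain_cost s.
  apply: contrapT => no; apply: px; apply: hyp; apply: kobayashi_eq0 => e e0.
  apply: contrapT => no2; apply: no; exists e => // s ps.
  by rewrite leNgt; apply/negP => se; apply: no2; exists s.
have e2 : 0 < e / 2 by rewrite divr_gt0.
exists ([set x' | exists2 s, disc_chain x' s x & chain_cost s < e / 2], [set e' : R | e' < e / 2]).
  split; last exact: nbhs_right_lt.
  by apply: nbhsS (short_chains x e2) => x' [].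
move=> [x' e'] /= [[s x's se] e'e] t pt.
have := eP _ (disc_chain_cat pt x's); rewrite chain_cost_cat; lra.
Qed.

Lemma cauchy_estimate_row (g : C R -> 'rV[C R]_n) (z : C R) (r B : R) : 0 < r ->
  (forall w : C R, nrm (w - z) < r -> derivable g w 1) ->
  (forall w : C R, nrm (w - z) < r -> nrm (g w) <= B) ->
  nrm (derive1 g z) <= 16 * B / r.
Proof.
move=> r0 dg gB.
have B0 : 0 <= B by apply: le_trans (nrm_ge0 (g z)) (gB z _); rewrite subrr nrm0.
have zz : nrm (z - z) < r by rewrite subrr nrm0.
apply: nrm_row_le; first by rewrite divr_ge0 ?mulr_ge0 // ltW.
move=> j.
have D w (wz : nrm (w - z) < r) := (is_cder_row _ _ _).1 (derivable_is_cder (dg w wz)) j.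
have := (is_cderP _ _ _).1 (D z zz) => -[_ <-].
apply: (cauchy_estimate r0).
- by move=> w /D/is_cderP[].
- by move=> w /gB; apply: le_trans; exact: nrm_coord.
- by rewrite subrr nrm0 divr_gt0.
Qed.

(** A disc centred near [p] cannot meet the sphere of radius rho / 2 for |z| < del: preceded by a
    cheap chain from [p] to its centre, it would reach the sphere at cost below [e]. So it stays in
    the chart ball, where Cauchy's estimate applies. *)
Lemma hyperbolic_locally_bounded p : kobayashi_hyperbolic M ->
  exists K : R, \forall x \near p, forall f, f 0 = x -> dens om f 0 <= K.
Proof.
move=> hyp; have [phi [rho [m [K' ad]]]] := adapted_chart om p.
have [aphi dp [rho0 _ K0] _ bnd] := ad.
pose u := chart_radius phi p rho; pose r := rho / 2.
have r0 : 0 < r by rewrite divr_gt0.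
have rr : r < rho by rewrite ltr_pdivrMr // mulr_natr mulr2n ltrDl.
have cu : continuous u := chart_radius_continuous ad.
have cS : compact [set x | u x = r].
  apply: subclosed_compact compactM _ => //.
  have -> : [set x | u x = r] = u @^-1` [set r] by [].
  by apply: preimage_closed; [move=> x _; exact: cu | exact: closed_eq].
have nSp : ~ [set x | u x = r] p.
  by rewrite /= /u (chart_radius_center ad) => E; move: r0; rewrite -E ltxx.
have [e e0 eP] := chains_to_compact hyp cS nSp.
have e2 : 0 < e / 2 by rewrite divr_gt0.
(* 4 del < e / 2 leaves the other half of [e] for the chain from [p] to the centre; del <= 1/2 is
   the range of [poincare_small]. *)
pose del := Num.min (1 / 2) (e / 16).
have del0 : 0 < del by rewrite lt_min !divr_gt0.
have del1 : del <= 1 / 2 by rewrite ge_min lexx.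
have del2 : 4 * del < e / 2.
  have : del <= e / 16 by rewrite ge_min lexx orbT.
  by lra.
pose B := nrm (chart_map phi p) + r.
exists (K' * (16 * B / del) ^+ 2).
have un : nbhs p [set x | u x < r].
  apply: (continuous_preimage (B := [set t | t < r]) (cu p)).
  by apply: lt_nbhsl; rewrite /u (chart_radius_center ad).
apply: (nbhsS _ (nbhsI (short_chains p e2) un)) => x [[[s ps se] _] /= ux] f fx.
have inside (z : C R) : nrm z < del -> u (f z) < r.
  move=> zd; rewrite ltNge; apply/negP => uz.
  have ft (t : R) : 0 <= t <= 1 -> nrm (rC t * z) < del.
    move=> /andP[t0 t1]; rewrite nrmM nrm_rC ger0_norm //.
    by apply: le_lt_trans zd; rewrite ler_piMl ?nrm_ge0.
  (* On the segment from 0 to [z] the chart radius starts below [r] and ends at or above it, so some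
     point lies on the sphere. *)
  have [||t t01 ut] := @IVT R (fun t => u (f (rC t * z))) 0 1 r ler01.
  - apply: continuous_in_subspaceT => t; rewrite inE /= in_itv /= => /ft tz.
    have tz1 : nrm (rC t * z) < 1 by lra.
    have c1 : {for t, continuous (fun t : R => rC t * z : C R)}.
      exact: continuous_scale.
    have c2 := holo_at_continuous (discMap_holo f tz1).
    have c3 := @continuous_comp _ _ _ (fun t : R => rC t * z : C R) f t c1 c2.
    exact: (@continuous_comp _ _ _ (fun t : R => f (rC t * z)) u t c3 (cu _)).
  - rewrite rC0 mul0r rC1 mul1r fx.
    by rewrite ge_min le_max uz orbT andbT ltW.
  move: t01; rewrite in_itv /= => /ft tz.
  have chain : disc_chain p (s ++ [:: (f, 0, rC t * z)]) (f (rC t * z)).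
    apply: disc_chain_cat ps _; split=> //; apply/disc1P; first by rewrite nrm0.
    by lra.
  have := eP _ _ ut chain; rewrite chain_cost_cat {2}/chain_cost big_seq1 /=.
  have mE : nrm (moebius_inv 0 (rC t * z)) = nrm (rC t * z).
    by rewrite /moebius_inv subr0 rmorph0 mul0r subr0 divr1.
  have := @poincare_small R 0 (rC t * z); rewrite mE => /(_ _) H.
  have : poincare 0 (rC t * z) <= 4 * nrm (rC t * z) by apply: H; lra.
  by lra.
have inb (z : C R) : nrm (z - 0) < del -> chart_ball phi p r (f z).
  by rewrite subr0 => /inside/ltW/(chart_radius_ball phi p _ rr).
have z0 : nrm (0 - 0 : C R) < del by rewrite subrr nrm0.
have [d0 b0] := inb 0 z0.
have lt1 (z : C R) : nrm (z - 0) < del -> nrm z < 1 by rewrite subr0; lra.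
have h0 : holo_at f 0 := discMap_holo f (lt1 0 z0).
rewrite (dens_chart om (holo_at_continuous h0) aphi d0 (holo_at_is_cder h0 aphi d0)).
have /andP[_ up] := bnd _ (derive1 (chart_map phi \o f) 0) d0 (le_trans b0 (ltW rr)).
apply: le_trans up _; rewrite ler_pM2l // ler_sqr ?nnegrE ?nrm_ge0//; last first.
  by rewrite divr_ge0 ?mulr_ge0 ?addr_ge0 ?nrm_ge0 // ltW.
apply: cauchy_estimate_row => //.
  move=> w wd; have [dw _] := inb w wd; have [_ H] := discMap_holo f (lt1 w wd).
  exact: H.
move=> w /inb[dw wr] /=; rewrite -[chart_map phi (f w)](subrK (chart_map phi p)) addrC.
by apply: le_trans (nrmD _ _) _; rewrite lerD2l.
Qed.

Theorem hyperbolic_bounded_dens : kobayashi_hyperbolic M ->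
  exists2 K : R, 0 < K & forall f, dens om f 0 <= K.
Proof.
move=> hyp.
have := (compact_near_coveringP [set: M]).1 compactM R (pinfty_nbhs R)
  (fun K x => forall f, f 0 = x -> dens om f 0 <= K) _.
case.
  move=> x _; have [K HK] := hyperbolic_locally_bounded x hyp.
  exists ([set x' | forall f, f 0 = x' -> dens om f 0 <= K], [set K' : R | K < K']).
    by split => //; exists K; split => //; exact: num_real.
  by move=> [x' K'] /= [HK' KK'] f fx; apply: le_trans (HK' f fx) (ltW KK').
move=> K [_ KP]; exists (`|K| + 1); first by rewrite ltr_wpDl.
by move=> f; apply: (KP (`|K| + 1) _ (f 0)) => //; apply: le_lt_trans (ler_norm K) _; rewrite ltrDl.
Qed.
End Hyperbolicity.

(** * Brody rescaling *)

Lemma cvg_near (T : Type) (S : topologicalType) (F : set_system T) (f : T -> S) (l : S) (B : set S) :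
  f @ F --> l -> nbhs l B -> F (f @^-1` B).
Proof. exact. Qed.

Lemma continuous_real_mul (T : topologicalType) (R : realType) (f g : T -> R) (z : T) :
  {for z, continuous f} -> {for z, continuous g} -> {for z, continuous (fun x => f x * g x)}.
Proof. exact: cvgM. Qed.

Lemma continuous_real_sub (T : topologicalType) (R : realType) (c : R) (g : T -> R) (z : T) :
  {for z, continuous g} -> {for z, continuous (fun x => c - g x)}.
Proof. by move=> cg; apply: cvgB => //; exact: cvg_cst. Qed.

Lemma continuous_row (T : topologicalType) (R : realType) n (f : T -> 'rV[C R]_n) (z : T) :
  (forall j, {for z, continuous (fun t => f t 0 j : C R)}) -> {for z, continuous f}.
Proof. by move=> cf; apply/cvg_rowP. Qed.

Lemma closed_limit (T : Type) (S : topologicalType) (F : set_system T) {PF : ProperFilter F}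
    (f : T -> S) (l : S) (A : set S) : closed A -> F (f @^-1` A) -> f @ F --> l -> A l.
Proof.
move=> clA fA fl; apply: clA => B /fl fB.
by have [k [Ak Bk]] := @filter_ex _ F _ _ (filterI fA fB); exists (f k).
Qed.

Lemma derive1_diff (R : realType) (W : normedModType (C R)) (f : C R -> W) (z : C R) :
  derivable f z 1 -> 'd f z 1 = derive1 f z.
Proof. by move=> /derivable1_diffP df; rewrite derive1E'. Qed.

Lemma cvg_eventually_eq (T : Type) (S : topologicalType) (F : set_system T) {FF : Filter F}
    (f g : T -> S) (l : S) : F [set k | f k = g k] -> f @ F --> l -> g @ F --> l.
Proof.
move=> fg fl B /fl fB; apply: (@filterS2 _ F _ _ _ _ _ fB fg) => k /= fBk E.
by rewrite -E.
Qed.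

Lemma quarter_bound (R : realFieldType) (x D E : R) : 0 < x -> x / 4 * D <= x * E -> D <= E * 4.
Proof. by move=> x0; rewrite mulrAC -mulrA ler_pM2l // ler_pdivrMr. Qed.

Section Brody.
Variables (R : realType) (n : nat) (M : complexManifold R n) (om : positiveForm M).
Implicit Types (g : C R -> M) (z : C R).

(** The coefficients at [y k] are compared with those at [x] while [v k] stays bounded; the fixed
    form at [x] is continuous in the vector. *)
Lemma qform_cvg (T : Type) (F : set_system T) {PF : ProperFilter F} (phi : chart R n M) (x : M)
    (y : T -> M) (v : T -> 'rV[C R]_n) (w : 'rV[C R]_n) :
  atlas phi -> chart_dom phi x -> y @ F --> x -> v @ F --> w ->
  forall e : R, 0 < e -> \forall k \near F,
    chart_dom phi (y k) /\ `|qform (form_coef om phi (y k)) (v k) - qform (form_coef om phi x) w| < e.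
Proof.
move=> aphi dx yx vw e e0.
have e2 : 0 < e / 2 by rewrite divr_gt0.
pose N := (nrm w + 1) ^+ 2.
have N0 : 0 < N by rewrite exprn_gt0 // ltr_wpDl ?nrm_ge0.
pose c := e / 2 / N / (n * n).+1%:R.
have c0 : 0 < c by rewrite !divr_gt0 // ltr0n.
have ydom : \forall k \near F, chart_dom phi (y k) by apply: yx; exact: chart_dom_nbhs.
have coef : \forall k \near F, forall i j, nrm (form_coef om phi (chart_inv phi (chart_map phi (y k))) i j - form_coef om phi x i j) < c.
  have cy : (chart_map phi \o y) @ F --> chart_map phi x.
    by apply: cvg_comp yx _; exact: chart_map_continuous.
  apply: filter_forall => i; apply: filter_forall => j.
  apply: (cvg_near (B := [set y | nrm (form_coef om phi (chart_inv phi y) i j - form_coef om phi x i j) < c]) cy).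
  have := form_coef_continuous (om := om) (i := i) (j := j) aphi dx.
  move=> /continuous_nrmP/(_ _ c0)[d d0 dP]; apply/nrm_nbhsP; exists d => // y' /dP.
  by rewrite chart_mapK.
have v1 : \forall k \near F, nrm (v k - w) < 1 by have /cvg_nrmP := vw; apply.
have q2 : \forall k \near F, `|qform (form_coef om phi x) (v k) - qform (form_coef om phi x) w| < e / 2.
  apply: (cvg_near (B := [set v | `|qform (form_coef om phi x) v - qform (form_coef om phi x) w| < e / 2]) vw).
  have /continuous_realP/(_ _ e2) := @continuous_qform R n (form_coef om phi x) w.
  by move=> [d d0 dP]; apply/nrm_nbhsP; exists d.
apply: filterS (filterI (filterI ydom coef) (filterI v1 q2)) => k [[dk cf] [vk qk]].
split=> //.
have -> : qform (form_coef om phi (y k)) (v k) - qform (form_coef om phi x) w =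
  qform (form_coef om phi (y k) - form_coef om phi x) (v k) +
  (qform (form_coef om phi x) (v k) - qform (form_coef om phi x) w) by rewrite qformB addrA subrK.
apply: le_lt_trans (ler_normD _ _) _; rewrite [e]splitr; apply: ler_ltD => //.
apply: le_trans (qform_le _ _) _.
have H1 : nrm (v k) ^+ 2 <= N.
  rewrite /N ler_sqr ?nnegrE ?nrm_ge0 ?addr_ge0 ?nrm_ge0//.
  by rewrite -[v k](subrK w) addrC; apply: le_trans (nrmD _ _) _; rewrite lerD2l ltW.
have H2 : mxsum (form_coef om phi (y k) - form_coef om phi x) <= e / 2 / N.
  apply: (@le_trans _ _ (\sum_(i < n) \sum_(j < n) c)).
    apply: ler_sum => i _; apply: ler_sum => j _; rewrite !mxE.
    by have := cf i j; rewrite chart_mapK // => /ltW.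
  rewrite !sumr_const !card_ord -mulrnA -[leLHS]mulr_natr /c [leLHS]mulrAC ler_pdivrMr ?ltr0n//.
  by rewrite ler_pM2l ?divr_gt0// ler_nat.
apply: (@le_trans _ _ (e / 2 / N * N)); last by rewrite divfK // gt_eqF.
by apply: ler_pM => //; [exact: mxsum_ge0 | rewrite exprn_ge0 // nrm_ge0].
Qed.

Lemma qform_continuous (T : topologicalType) (z : T) (phi : chart R n M)
    (y : T -> M) (v : T -> 'rV[C R]_n) :
  atlas phi -> chart_dom phi (y z) -> {for z, continuous y} -> {for z, continuous v} ->
  forall e : R, 0 < e -> nbhs z [set k | chart_dom phi (y k) /\
    `|qform (form_coef om phi (y k)) (v k) - qform (form_coef om phi (y z)) (v z)| < e].
Proof. by move=> aphi dphi cy cv e e0; exact: (@qform_cvg T (nbhs z) _ phi (y z) y v (v z)). Qed.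

Lemma derive_row_continuous (f : C R -> 'rV[C R]_n) z (r : R) : 0 < r ->
  (forall w : C R, nrm (w - z) < r -> derivable f w 1) ->
  {for z, continuous (derive1 f)}.
Proof.
move=> r0 df; apply: (@continuous_row (C R)) => j.
have D w (wz : nrm (w - z) < r) := (is_cder_row _ _ _).1 (derivable_is_cder (df w wz)) j.
pose fj (w : C R) : C R := f w 0 j.
have hj : holo_ball fj z r by move=> w /D/is_cderP[/derivable1_diffP].
have c := holo_continuous_derivative (w := (1 : C R)) r0 hj.
apply: (continuous_near_eq c).
apply/(@nrm_nbhsP R (C R)); exists r => // w wr /=.
have [dj <-] := (is_cderP _ _ _).1 (D w wr).
exact: (@derive1_diff R (C R) fj w dj).
Qed.

(** [dens] takes a new chart at every point; near [z] all values are recomputed in the single chart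
    at [g z]. *)
Lemma dens_continuous g z (r : R) : 0 < r -> (forall w : C R, nrm (w - z) < r -> holo_at g w) ->
  {for z, continuous (dens om g)}.
Proof.
move=> r0 hg; have hz : holo_at g z by apply: hg; rewrite subrr nrm0.
have cg := holo_at_continuous hz.
set phi := chart_at (g z).
have aphi : atlas phi := chart_at_atlas _.
have dphi : chart_dom phi (g z) := chart_at_dom _.
have /(@nrm_nbhsP R (C R))[r1 r10 r1P] := continuous_preimage cg (chart_dom_nbhs dphi).
have rr : 0 < Num.min r r1 by rewrite lt_min r0.
have df (w : C R) : nrm (w - z) < Num.min r r1 -> derivable (chart_map phi \o g) w 1.
  by rewrite lt_min => /andP[/hg[_ H] /r1P]; exact: H.
have cd := derive_row_continuous rr df.
apply/(@continuous_realP R (C R)) => e e0.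
have Q := @qform_continuous (C R) z phi g _ aphi dphi cg cd e e0.
have [d d0 dP] := (@nrm_nbhsP R (C R) z _).1 Q.
exists (Num.min d (Num.min r r1)); first by rewrite lt_min d0.
move=> w; rewrite lt_min => /andP[/dP[dw H] wr].
have hw : holo_at g w by apply: hg; move: wr; rewrite lt_min => /andP[].
by rewrite (dens_chart om cg aphi dphi (holo_at_is_cder hz aphi dphi))
  (dens_chart om (holo_at_continuous hw) aphi dw (holo_at_is_cder hw aphi dw)).
Qed.

Lemma disc_compact (r : R) : compact [set z : C R | nrm z <= r].
Proof.
rewrite compact_ultra => F UF FA.
have PF : ProperFilter F := @ultra_proper _ _ UF.
have [l lP] := @ultra_bounded_cvg R (C R) F id r UF FA.
by exists l; split; [exact: cvg_nrm_le lP FA | exact: lP].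
Qed.

(* Point picking: at a maximum [z0] of [(1/2 - |z|)^2 dens f z] the density is at most four
   times its value at [z0] on a disc of half the distance to the boundary. *)
Lemma rescaled_disc (f : discMap M) (k : R) : 0 < k -> 16 * k ^+ 2 < dens om f 0 ->
  exists g, (forall z, nrm z < k -> holo_at g z /\ dens om g z <= 4) /\ dens om g 0 = 1.
Proof.
move=> k0 kf.
pose F (z : C R) := (1 / 2 - nrm z) ^+ 2 * dens om f z.
have cF z : nrm z <= 1 / 2 -> {for z, continuous F}.
  move=> z2; apply: (@continuous_real_mul (C R)); last first.
    apply: (@dens_continuous _ _ (1 / 2)); first by rewrite divr_gt0.
    by move=> w wz; apply: discMap_holo; have := nrm_tri w z 0; rewrite !subr0; lra.
  rewrite (_ : (fun x : C R => _) = (fun x => (1 / 2 - nrm x) * (1 / 2 - nrm x))); last first.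
    by apply/funext => x; rewrite expr2.
  have cn : {for z, continuous (fun z : C R => 1 / 2 - nrm z)}.
    by apply: (@continuous_real_sub (C R)); exact: continuous_nrm.
  exact: (@continuous_real_mul (C R)).
have ne : [set z : C R | nrm z <= 1 / 2] !=set0 by exists 0; rewrite /= nrm0 divr_ge0.
have [z0 [z0P zmax]] : exists z0 : C R, nrm z0 <= 1 / 2 /\ forall z, nrm z <= 1 / 2 -> F z <= F z0.
  have [z0 z0P zmax] := compact_EVT_max ne (@disc_compact (1 / 2))
    (continuous_in_subspaceT (fun z zP => cF z (set_mem zP))).
  by exists z0; split; [exact: set_mem z0P | move=> z zz; apply/zmax/mem_set].
(* F 0 is a quarter of [dens om f 0], which accounts for the 16 in the hypothesis. *)
have F0 : 4 * k ^+ 2 < F z0.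
  apply: (@lt_le_trans _ _ (F 0)); last by apply: zmax; rewrite nrm0 divr_ge0.
  by rewrite /F nrm0 subr0 (_ : (1 / 2) ^+ 2 = 1 / 4 :> R); lra.
have FE z : F z = (1 / 2 - nrm z) ^+ 2 * dens om f z by [].
clear cF; clearbody F.
have k2 : 0 < k ^+ 2 by rewrite exprn_gt0.
have [d dE] : exists d, d = 1 / 2 - nrm z0 by eexists.
have d0 : 0 < d.
  rewrite lt_neqAle dE subr_ge0 z0P andbT -dE; apply/eqP => E.
  have Fz : F z0 = 0 by rewrite FE -dE -E expr0n /= mul0r.
  by move: F0; rewrite Fz ltNge mulr_ge0 // ltW.
have D0 : 0 < dens om f z0.
  rewrite lt_neqAle dens_ge0 andbT; apply/eqP => E.
  have Fz : F z0 = 0 by rewrite FE -E mulr0.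
  by move: F0; rewrite Fz ltNge mulr_ge0 // ltW.
have [lam [lam0 lam2]] : exists lam : R, 0 < lam /\ lam ^+ 2 = dens om f z0.
  by exists (Num.sqrt (dens om f z0)); split; [rewrite sqrtr_gt0 | apply: sqr_sqrtr; exact: ltW].
(* Hence |z| < k moves [h z] by at most k / lam < d / 2 from [z0], while the scale 1 / lam makes the
   density 1 at the centre. *)
have dl : 2 * k < d * lam.
  rewrite -ltr_sqr ?nnegrE ?mulr_ge0 ?(ltW d0) ?(ltW lam0) ?(ltW k0) //.
  by rewrite !exprMn lam2 (_ : 2 ^+ 2 = 4 :> R) ?dE -?FE// -natrX.
pose h (z : C R) : C R := z0 + rC lam^-1 * z.
have hd z : is_cder h z (rC lam^-1).
  have := is_cderD (is_cder_cst z0 z) (is_cderZ (rC lam^-1) (is_cder_id z)).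
  by rewrite add0r -[_ *: 1]/(_ * 1) mulr1.
have hz z : nrm z < k -> nrm (h z - z0) < d / 2.
  move=> zk; rewrite /h addrC addKr nrmM nrm_rC gtr0_norm ?invr_gt0//.
  rewrite mulrC ltr_pdivrMr //.
  by move: dl zk; clear; move: (nrm z) => *; lra.
have h12 z : nrm z < k -> nrm (h z) < 1 / 2.
  move: d0 => + /hz; have := nrm_tri (h z) z0 0; rewrite !subr0 dE; clear.
  by move: (nrm (h z)) (nrm (h z - z0)) (nrm z0) => *; lra.
have hf z : nrm z < k -> holo_at f (h z).
  by move=> /h12 hz2; apply: discMap_holo; move: hz2; clear; lra.
exists (f \o h); split.
  move=> z zk; split; first exact: holo_at_comp (hd z) (hf z zk).
  rewrite (dens_comp om (hd z) (hf z zk)) nrm_rC gtr0_norm ?invr_gt0// exprVn lam2.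
  rewrite ler_pdivrMl //.
  have h1 := h12 z zk; have h2 := hz z zk.
  have := zmax (h z) (ltW h1); rewrite !FE -dE.
  have : d / 2 < 1 / 2 - nrm (h z).
    have := nrm_tri (h z) z0 0; rewrite !subr0; move: h2 d0; rewrite dE; clear.
    by move: (nrm (h z)) (nrm (h z - z0)) (nrm z0) => *; lra.
  set a := 1 / 2 - nrm (h z); set D := dens om f (h z) => ad.
  have aa : d ^+ 2 / 4 <= a ^+ 2 by move: ad d0; clear; nra.
  have DD : 0 <= D := dens_ge0 _ _ _.
  have dd : 0 < d ^+ 2 by rewrite exprn_gt0.
  move=> H; have : d ^+ 2 / 4 * D <= d ^+ 2 * dens om f z0.
    by apply: le_trans H; rewrite ler_wpM2r.
  exact: quarter_bound.
have n0 : nrm (0 : C R) < k by rewrite nrm0.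
rewrite (dens_comp om (hd 0) (hf 0 n0)) nrm_rC gtr0_norm ?invr_gt0// exprVn lam2.
by rewrite /h mulr0 addr0 mulVf // gt_eqF.
Qed.

Hypothesis compactM : compact [set: M].

(** Density at most 4 makes the chart radius Lipschitz along the maps, so along [U] the [g k]
    eventually send one disc about [z] into one chart ball. There the coordinates are bounded, and
    [holo_limit] yields holomorphy of [G] and convergence of derivatives, hence of densities. *)
Lemma brody_limit (g : nat -> C R -> M) (U : set_system nat) (G : C R -> M) :
  UltraFilter U -> \oo `<=` U ->
  (forall k z, nrm z < k.+1%:R -> holo_at (g k) z /\ dens om (g k) z <= 4) ->
  (forall z, (fun k => g k z) @ U --> G z) ->
  forall z, holo_at G z /\ forall e : R, 0 < e -> \forall k \near U, `|dens om (g k) z - dens om G z| < e.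
Proof.
move=> UU Uoo gk gG z.
have PU : ProperFilter U := @ultra_proper _ _ UU.
have [phi [rho [m [K ad]]]] := adapted_chart om (G z).
have [aphi dp [rho0 m0 K0] _ _] := ad.
pose L := 4 / m + 1.
have L1 : 1 <= L by rewrite lerDr divr_ge0 // ltW.
have mL : 4 <= m * L ^+ 2.
  apply: (@le_trans _ _ (m * L)); last by rewrite ler_pM2l // expr2 ler_peMl // (le_trans ler01).
  by rewrite /L mulrDr mulr1 mulrCA mulfV ?gt_eqF// mulr1 lerDl ltW.
have L0 : 0 < L by rewrite (lt_le_trans ltr01).
(* From below rho / 4 at [z] the chart radius grows by at most L del <= rho / 4, so it stays within
   rho / 2. *)
pose del := Num.min 1 (rho / 4 / L).
have del0 : 0 < del by rewrite lt_min ltr01 !divr_gt0.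
have r2 : rho / 2 < rho by rewrite ltr_pdivrMr // mulr_natr mulr2n ltrDl.
have large : \forall k \near U, nrm z + 1 < k.+1%:R.
  apply: Uoo; exists (Num.truncn (nrm z + 1)).+1 => // k /= kk.
  apply: lt_trans (truncnS_gt _) _; rewrite ltr_nat ltnS; exact: kk.
have inball : \forall k \near U, nrm z + 1 < k.+1%:R /\
    forall w : C R, nrm (w - z) < del -> chart_ball phi (G z) (rho / 2) (g k w).
  have near0 : \forall k \near U, chart_radius phi (G z) rho (g k z) < rho / 4.
    apply: (cvg_near (B := [set x | chart_radius phi (G z) rho x < rho / 4]) (gG z)).
    apply: (continuous_preimage (B := [set t | t < rho / 4])).
      exact: (chart_radius_continuous ad).
    by apply: lt_nbhsl; rewrite (chart_radius_center ad) divr_gt0.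
  apply: filterS2 large near0 => k kz uk; split=> // w wz.
  apply/(chart_radius_ball phi (G z) (g k w) r2).
  have := @chart_radius_lipschitz _ _ _ _ _ _ _ _ _ ad (g k) z w L (ltW L0).
  have wd1 : nrm (w - z) < 1 by move: wz; rewrite lt_min => /andP[].
  have wd2 : L * nrm (w - z) <= rho / 4.
    move: wz; rewrite lt_min => /andP[_]; rewrite ltr_pdivlMr // mulrC; exact: ltW.
  have seg t : 0 <= t <= 1 -> holo_at (g k) (z + rC t * (w - z)) /\ dens om (g k) (z + rC t * (w - z)) <= m * L ^+ 2.
    move=> /andP[t0 t1]; have zk : nrm (z + rC t * (w - z)) < k.+1%:R.
      apply: le_lt_trans kz; apply: le_trans (nrmD _ _) _; rewrite lerD2l nrmM nrm_rC ger0_norm //.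
      by apply: le_trans (ltW wd1); rewrite ler_piMl ?nrm_ge0.
    have [h1 h2] := gk k _ zk; split; [exact: h1 | exact: le_trans h2 mL].
  by move=> /(_ seg); rewrite ler_norml => /andP[_ H]; lra.
have Gball (w : C R) : nrm (w - z) < del -> chart_ball phi (G z) (rho / 2) (G w).
  move=> wz; have [_ _ _ sub _] := ad; apply: closed_limit (chart_ball_closed sub (ltW r2)) _ (gG w).
  by apply: filterS inball => k [_]; exact.
have phicvg (w : C R) : nrm (w - z) < del -> (fun k => chart_map phi (g k w)) @ U --> chart_map phi (G w).
  move=> wz; have [dw _] := Gball w wz.
  by apply: cvg_comp (gG w) _; exact: chart_map_continuous.
have zz : nrm (z - z) < del by rewrite subrr nrm0.
have comp j : differentiable (fun w => (chart_map phi \o G) w 0 j : C R) z /\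
    forall h, (fun k => 'd (fun w => (chart_map phi \o g k) w 0 j : C R) z h) @ U -->
      'd (fun w => (chart_map phi \o G) w 0 j : C R) z h.
  apply: (@holo_limit R (C R) nat U (fun k w => (chart_map phi \o g k) w 0 j) _ z del (nrm (chart_map phi (G z)) + rho)) => //.
    apply: filterS inball => k [kz ib]; split=> w wz; have [dw wr] := ib w wz.
      have [_ H] : holo_at (g k) w.
        have [] // := gk k w.
        apply: le_lt_trans kz; rewrite -[w](subrK z) addrC; apply: le_trans (nrmD _ _) _.
        by rewrite lerD2l; move: wz; rewrite lt_min => /andP[/ltW].
      apply: diff_row_coord; apply/derivable1_diffP; exact: H.
    apply: le_trans (nrm_coord _ _) _ => /=.
    rewrite -[chart_map phi (g k w)](subrK (chart_map phi (G z))) addrC.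
    apply: le_trans (nrmD _ _) _; rewrite lerD2l; exact: le_trans wr (ltW r2).
  by move=> w /phicvg/cvg_rowP/(_ j).
have [dG dGv] := diff_row (fun j => (comp j).1).
have cG : {for z, continuous G}.
  have c1 : {for z, continuous (chart_inv phi \o (chart_map phi \o G))}.
    apply: continuous_comp; first exact: differentiable_continuous dG.
    by apply: chart_inv_continuous; exists (G z).
  apply: continuous_near_eq c1 _; apply/(@nrm_nbhsP R (C R)); exists del => // w /Gball[dw _] /=.
  by rewrite chart_mapK.
have derG : derivable (chart_map phi \o G) z 1 by apply/derivable1_diffP.
have hG : holo_at G z := holo_at_chart cG aphi dp derG.
split=> // e e0.
pose v k : 'rV[C R]_n := derive1 (chart_map phi \o g k) z.
have cv : v @ U --> derive1 (chart_map phi \o G) z.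
  apply/cvg_rowP => j.
  rewrite -(derive1_diff derG) dGv.
  have E : \forall k \near U, 'd (fun w => (chart_map phi \o g k) w 0 j : C R) z 1 = v k 0 j.
    apply: filterS inball => k [kz ib]; have [dw _] := ib z zz.
    have zk : nrm z < k.+1%:R by apply: lt_trans kz; rewrite ltrDl.
    have D := holo_at_is_cder (gk k z zk).1 aphi dw.
    have [dj ej] := (is_cderP _ _ _).1 ((is_cder_row _ _ _).1 D j).
    by rewrite /v -ej; exact: (@derive1_diff R (C R) _ z dj).
  exact: cvg_eventually_eq E ((comp j).2 1).
apply: filterS2 inball (qform_cvg aphi dp (gG z) cv e0) => k [kz ib] [dk].
have zk : nrm z < k.+1%:R by apply: lt_trans kz; rewrite ltrDl.
have hk := (gk k z zk).1.
by rewrite (dens_chart om cG aphi dp (derivable_is_cder derG))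
  (dens_chart om (holo_at_continuous hk) aphi dk (holo_at_is_cder hk aphi dk)).
Qed.

Theorem brody : ~ (exists K : R, forall f : discMap M, dens om f 0 <= K) ->
  exists G : C R -> M, (forall z, holo_at G z) /\ dens om G 0 = 1.
Proof.
move=> unb.
have /choice[g gP] : forall k : nat, exists g, (forall z, nrm z < k.+1%:R -> holo_at g z /\ dens om g z <= 4) /\ dens om g 0 = 1.
  move=> k; apply: contrapT => no; apply: unb.
  exists (16 * k.+1%:R ^+ 2) => f; rewrite leNgt; apply/negP => H.
  by apply: no; apply: (@rescaled_disc f) => //; rewrite ltr0n.
have [U [UU Uoo]] := ultraFilterLemma eventually_filter.
have /choice[G GP] : forall z, exists p : M, (fun k => g k z) @ U --> p.
  move=> z; have PU : ProperFilter U := @ultra_proper _ _ UU.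
  have [|p _ pP] := @ultra_compact_cvg nat M U (fun k => g k z) [set: M] UU compactM.
    exact: filterT.
  by exists p.
have lim := brody_limit UU Uoo (fun k => (gP k).1) GP.
exists G; split; first by move=> z; have [] := lim z.
have [_ H] := lim 0.
have PU : ProperFilter U := @ultra_proper _ _ UU.
apply/eqP; rewrite -subr_eq0 -normr_eq0 eq_le normr_ge0 andbT.
apply/ler_addgt0Pr => e e0; rewrite add0r.
have [k kP] := filter_ex (H e e0).
by rewrite distrC; move: kP; rewrite (gP k).2 => /ltW.
Qed.
End Brody.

(** * Integrability under a density bound *)

(** The integral of a nonnegative function is a supremum over simple functions below it, hence
    monotone for arbitrary functions. Comparisons with [pullback_density], whose definition chooses
    charts, go through this lemma. *)
Lemma ge0_le_integral_subset d (T : measurableType d) (R : realType) (mu : {measure set T -> \bar R})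
    (D E : set T) (f g : T -> \bar R) :
  (forall x, D x -> 0 <= f x)%E -> (forall x, E x -> 0 <= g x)%E ->
  (forall x, D x -> E x /\ (f x <= g x)%E) ->
  (\int[mu]_(x in D) f x <= \int[mu]_(x in E) g x)%E.
Proof.
move=> f0 g0 fg; rewrite (ge0_integralE _ f0) (ge0_integralE _ g0).
apply: ereal_sup_le => _ [h /= hf <-]; exists h => //= x.
apply: (le_trans (hf x)); rewrite /patch; case: ifPn => [|_].
  by rewrite inE => /fg[Ex fgx]; rewrite mem_set.
by case: ifPn => //; rewrite inE => /g0.
Qed.

Lemma integral_derive (R : realType) (f F : R -> R) (a b : R) : a < b ->
  (forall x, a <= x <= b -> is_derive x 1 F (f x)) ->
  (forall x, a <= x <= b -> {for x, continuous f}) ->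
  (\int[@lebesgue_measure R]_(x in `[a, b]) (f x)%:E)%E = (F b - F a)%:E.
Proof.
move=> ab dF cf; rewrite EFinB; apply: continuous_FTC2 => //.
- by apply/continuous_within_itvP => //; split=> [x /[!in_itv]/= /andP[xa xb]||];
    [apply: cf; rewrite !ltW | apply: cvg_at_right_filter; apply: cf |
     apply: cvg_at_left_filter; apply: cf]; rewrite ?lexx ?(ltW ab).
- have cF x : a <= x <= b -> {for x, continuous F}.
    by move=> /dF h; apply/differentiable_continuous/derivable1_diffP; apply: ex_derive.
  split=> [x /[!in_itv]/= /andP[xa xb]||].
  + by apply: (@ex_derive _ _ _ _ _ _ _ (dF x _)); rewrite !ltW.
  + by apply: cvg_at_right_filter; apply: cF; rewrite lexx ltW.
  + by apply: cvg_at_left_filter; apply: cF; rewrite lexx ltW.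
- move=> x /[!in_itv]/= /andP[xa xb]; rewrite derive1E; apply: derive_val; apply: dF.
  by rewrite !ltW.
Qed.

(** * An explicit bound for the hyperbolic area of the disc of radius t *)

Section DiscArea.
Variables (R : realType) (t : R).
Hypotheses (t0 : 0 < t) (t1 : t < 1).
Local Notation mu := (@lebesgue_measure R).

(* On the disc of radius [t] the truncation is invisible; it makes the weight measurable. *)
Let floor (u : R) : R := (Num.max u (1 - t ^+ 2))^-1.

Let t2 : 0 < 1 - t ^+ 2.
Proof. by rewrite subr_gt0 expr_lt1 // ltW. Qed.

Let floorE u : 1 - t ^+ 2 <= u -> floor u = u^-1.
Proof. by move=> h; rewrite /floor max_l. Qed.

Let continuous_floor : continuous floor.
Proof.
move=> u; apply: (@continuous_comp _ _ _ (fun u : R => Num.max u (1 - t ^+ 2)) GRing.inv).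
  by apply: continuous_max => //; exact: cst_continuous.
apply: inv_continuous; rewrite gt_eqF // lt_max t2 orbT //.
Qed.

(** With the bound 9/16 the strip and its mirror image cover the disc: x^2 > 9/16 forces y^2 <
    7/16. *)
Definition strip : set (R * R) := [set p | p.1 ^+ 2 <= 9 / 16 /\ p.1 ^+ 2 + p.2 ^+ 2 < t ^+ 2].

(** On the strip 1 - x^2 + y^2 >= 7/16, so 16/7 times this weight dominates the hyperbolic density
    (1 - |z|^2)^-2. *)
Definition strip_weight (p : R * R) : R :=
  (1 - p.1 ^+ 2 + p.2 ^+ 2) * floor (1 - p.1 ^+ 2 - p.2 ^+ 2) ^+ 2 * \1_strip p.

Lemma strip_weight_ge0 p : 0 <= strip_weight p.
Proof.
rewrite /strip_weight indicE; case: (boolP (p \in strip)) => [|_]; last by rewrite mulr0.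
rewrite inE => -[h1 h2]; rewrite mulr1 mulr_ge0 ?sqr_ge0 //.
by rewrite addr_ge0 ?sqr_ge0 // subr_ge0 (le_trans h1) //; lra.
Qed.

Lemma measurable_strip_weight : measurable_fun [set: R * R] strip_weight.
Proof.
have m1 : measurable_fun [set: R * R] (fun p : R * R => p.1 ^+ 2) by exact: measurable_funX.
have m2 : measurable_fun [set: R * R] (fun p : R * R => p.2 ^+ 2) by exact: measurable_funX.
apply: measurable_funM; last first.
  apply: measurable_indic; rewrite /strip.
  have -> : [set p : R * R | p.1 ^+ 2 <= 9 / 16 /\ p.1 ^+ 2 + p.2 ^+ 2 < t ^+ 2] =
    [set p : R * R | p.1 ^+ 2 <= 9 / 16] `&` [set p | p.1 ^+ 2 + p.2 ^+ 2 < t ^+ 2] by [].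
  apply: measurableI.
    rewrite -[X in measurable X]setTI; apply: measurable_fun_le => //; exact: measurable_cst.
  have -> : [set p : R * R | p.1 ^+ 2 + p.2 ^+ 2 < t ^+ 2] =
      [set: R * R] `&` (fun p => p.1 ^+ 2 + p.2 ^+ 2) @^-1` `]-oo, t ^+ 2[.
    by rewrite setTI; apply/seteqP; split => p /=; rewrite in_itv.
  exact: (measurable_funD m1 m2).
apply: measurable_funM.
  by apply: measurable_funD => //; apply: measurable_funB => //; exact: measurable_cst.
apply: measurable_funX.
apply: (@measurableT_comp _ _ _ _ _ _ floor); first exact: continuous_measurable_fun.
by apply: measurable_funB => //; apply: measurable_funB => //; exact: measurable_cst.
Qed.

(** The section of the disc is ]-b, b[ with b^2 = t^2 - x^2, so the primitive yields 2 b / (1 - t^2)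
    <= 2 / (1 - t). The indicator prepares the outer integration in x. *)
Lemma strip_weight_section (x : R) :
  (\int[mu]_y (strip_weight (x, y))%:E <= ((2 / (1 - t)) * \1_(`[(-1)%R, 1%R]) x)%:E)%E.
Proof.
case: (boolP ((x ^+ 2 <= 9 / 16) && (x ^+ 2 < t ^+ 2))) => [/andP[x1 x2]|nx]; last first.
  rewrite integral0_eq => [|y _].
    by rewrite lee_fin mulr_ge0 // divr_ge0 // subr_ge0 ltW.
  rewrite /strip_weight indicE; case: (boolP (_ \in _)) => [|_]; last by rewrite mulr0.
  rewrite inE => -[/= h1 h2]; case/negP: nx; rewrite h1 (le_lt_trans _ h2) //.
  by rewrite lerDl sqr_ge0.
pose b := Num.sqrt (t ^+ 2 - x ^+ 2).
have b0 : 0 < b by rewrite sqrtr_gt0 subr_gt0.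
have b2 : b ^+ 2 = t ^+ 2 - x ^+ 2 by rewrite sqr_sqrtr // subr_ge0 ltW.
have b1 : b <= 1.
  rewrite -(@ler_pXn2r _ 2) ?nnegrE ?ltW // b2 expr1n.
  by move: (sqr_ge0 x) t2; lra.
have yb y : - b <= y <= b -> y ^+ 2 <= b ^+ 2.
  by rewrite -ler_norml -[y ^+ 2]real_normK ?num_real // => h; rewrite lerXn2r ?nnegrE ?(ltW b0).
have pos y : - b <= y <= b -> 1 - t ^+ 2 <= 1 - x ^+ 2 - y ^+ 2.
  by move=> /yb; rewrite b2; lra.
(* The factor [1 - x^2 + y^2] in the weight is there to make [F] a primitive in [y]. *)
pose F y : R := y / (1 - x ^+ 2 - y ^+ 2).
pose f y : R := (1 - x ^+ 2 + y ^+ 2) * floor (1 - x ^+ 2 - y ^+ 2) ^+ 2.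
have -> : \1_(`[(-1)%R, 1%R]) x = 1 :> R.
  rewrite indicE mem_set //= in_itv /= -ler_norml -(@ler_pXn2r _ 2) ?nnegrE //.
  by rewrite real_normK ?num_real // expr1n; apply: (le_trans x1); lra.
have f0 y : 0 <= f y.
  rewrite mulr_ge0 ?sqr_ge0 // addr_ge0 ?sqr_ge0 // subr_ge0 (le_trans x1) //; lra.
apply: (@le_trans _ _ (\int[mu]_(y in `[(- b)%R, b]) (f y)%:E)%E).
  rewrite [leLHS](_ : _ = \int[mu]_(y in `](- b)%R, b[) (f y)%:E)%E.
    apply: ge0_le_integral_subset => y /=; rewrite ?lee_fin ?f0 //.
    by rewrite !in_itv /= => /andP[/ltW-> /ltW->].
  rewrite [RHS]integral_mkcond; apply: eq_integral => y _; rewrite /patch /strip_weight /= -/(f y).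
  rewrite indicE; case: ifPn => hy.
    rewrite mem_set ?mulr1 //; split => //=; move: hy; rewrite inE /= in_itv /= -ltr_norml => hy.
    rewrite -ltrBrDl -b2 -[y ^+ 2]real_normK ?num_real // ltr_pXn2r ?nnegrE //; exact: ltW.
  rewrite memNset ?mulr0 // => -[/= _ h]; case/negP: hy; rewrite inE /= in_itv /= -ltr_norml.
  by rewrite -(@ltr_pXn2r _ 2) ?nnegrE ?(ltW b0) // real_normK ?num_real // b2 ltrBrDl.
have -> : (\int[mu]_(y in `[(- b)%R, b]) (f y)%:E)%E = (F b - F (- b))%:E.
  apply: integral_derive.
  - by rewrite -subr_gt0 opprK addr_gt0.
  - move=> y yb'; have p := lt_le_trans t2 (pos _ yb').
    have ne : 1 - x ^+ 2 - y ^+ 2 != 0 by rewrite gt_eqF.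
    have dD : is_derive y 1 (fun y : R => 1 - x ^+ 2 - y ^+ 2 : R) (- (2 * y)).
      by apply: is_derive_eq; rewrite /GRing.scale/=; ring.
    have dV := @is_deriveV R (fun y : R => 1 - x ^+ 2 - y ^+ 2 : R) y _ 1 ne dD.
    have := @is_deriveM R R id _ y 1 _ _ (is_derive_id y 1) dV.
    rewrite /F /f floorE ?pos // => h; apply: is_derive_eq h _.
    by rewrite /GRing.scale /= exprVn; field.
  - move=> y _; apply: continuous_real_mul.
      by apply: cvgD; [exact: cvg_cst | exact: exprn_continuous].
    apply: (@continuous_comp _ _ _ (fun y : R => 1 - x ^+ 2 - y ^+ 2) (fun u => floor u ^+ 2)).
      by apply: continuous_real_sub; exact: exprn_continuous.
    by apply: (@continuous_comp _ _ _ floor (fun u => u ^+ 2));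
       [exact: continuous_floor | exact: exprn_continuous].
rewrite lee_fin /F sqrrN b2 mulr1.
have -> : 1 - x ^+ 2 - (t ^+ 2 - x ^+ 2) = 1 - t ^+ 2 by ring.
have t3 : 0 < 1 - t by rewrite subr_gt0.
rewrite -mulrBl opprK; apply: ler_pM.
- by rewrite addr_ge0 // ltW.
- by rewrite invr_ge0 ltW.
- by move: b1; lra.
- by rewrite lef_pV2 ?posrE // lerB // expr2 ger_pMl // ltW.
Qed.

Lemma strip_weight_integral :
  (\int[mu \x mu]_p (strip_weight p)%:E <= (4 / (1 - t))%:E)%E.
Proof.
rewrite fubini_tonelli1 //; last 2 first.
  by apply/measurable_EFinP; exact: measurable_strip_weight.
  by move=> p; rewrite lee_fin strip_weight_ge0.
apply: (@le_trans _ _ (\int[mu]_x ((2 / (1 - t)) * \1_(`[(-1)%R, 1%R]) x)%:E)%E).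
  apply: ge0_le_integral_subset => [x _|x _|x _]; last by split => //; exact: strip_weight_section.
    by apply: integral_ge0 => y _; rewrite lee_fin strip_weight_ge0.
  by rewrite lee_fin mulr_ge0 // divr_ge0 // subr_ge0 ltW.
under eq_integral do rewrite EFinM.
rewrite ge0_integralZl //; last by rewrite lee_fin divr_ge0 // subr_ge0 ltW.
  rewrite integral_indic // setIT [X in (_ * X)%E](_ : _ = (1 - - 1)%:E); last first.
    by rewrite [LHS]lebesgue_measure_itv /= lte_fin ifT // ; lra.
  rewrite -EFinM lee_fin opprK; have : 0 < 1 - t by rewrite subr_gt0.
  by move=> h; rewrite le_eqVlt; apply/orP; left; apply/eqP; field; rewrite gt_eqF.
by apply/measurable_EFinP; exact: measurable_indic.
Qed.

Lemma strip_weight_swap_integral :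
  (\int[mu \x mu]_p (strip_weight (p.2, p.1))%:E <= (4 / (1 - t))%:E)%E.
Proof.
have ms : measurable_fun [set: R * R] (fun p : R * R => strip_weight (p.2, p.1)).
  apply: (@measurableT_comp _ _ _ _ _ _ strip_weight _ (fun p : R * R => (p.2, p.1))).
    exact: measurable_strip_weight.
  by apply/measurable_fun_pair.
rewrite (@fubini_tonelli2 _ _ _ _ _ mu mu (fun p => (strip_weight (p.2, p.1))%:E)) //; last 2 first.
  by apply/measurable_EFinP.
  by move=> p; rewrite lee_fin strip_weight_ge0.
apply: le_trans strip_weight_integral; rewrite fubini_tonelli1 //.
  by apply/measurable_EFinP; exact: measurable_strip_weight.
by move=> p; rewrite lee_fin strip_weight_ge0.
Qed.

End DiscArea.

Section ExpIntegral.
Variables (R : realType) (n : nat) (M : complexManifold R n) (om : positiveForm M) (f : discMap M) (K : R).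
Hypotheses (K0 : 0 < K)
  (densK : forall z : C R, nrm z < 1 -> dens om f z <= K / (1 - nrm z ^+ 2) ^+ 2).
Local Notation mu := (@lebesgue_measure R).

Lemma disc_sqr (t : R) (p : R * R) : 0 < t -> disc t (mkC p.1 p.2) -> p.1 ^+ 2 + p.2 ^+ 2 < t ^+ 2.
Proof.
move=> t0 h; have := nrm_sqr (mkC p.1 p.2) => /= <-.
by rewrite ltrXn2r // nrm_ge0.
Qed.

Lemma pullback_integral_ge0 (t : R) : (0 <= pullback_integral om f t)%E.
Proof. by apply: integral_ge0 => p _; rewrite lee_fin pullback_densityE dens_ge0. Qed.

(** The disc lies in a square of area 4 t^2, and its density is at most 16/9 K <= 2 K. The factor
    t^2 absorbs the t^-1 of [characteristic] near 0. *)
Lemma pullback_integral_small (t : R) : 0 < t -> t <= 1 / 2 ->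
  (pullback_integral om f t <= (8 * K * t ^+ 2)%:E)%E.
Proof.
move=> t0 t2; pose I : set R := `[- t, t]%classic; pose S : set (R * R) := I `*` I.
have mI : measurable I by exact: measurable_itv.
have mS : measurable S by exact: measurableX.
apply: (@le_trans _ _ (\int[mu \x mu]_(p in S) (cst (2 * K)%:E) p)%E).
  apply: ge0_le_integral_subset => p.
  - by rewrite lee_fin pullback_densityE dens_ge0.
  - by rewrite lee_fin mulr_ge0 // ltW.
  move=> dp; have h := disc_sqr t0 dp; split.
    have b (x y : R) : x ^+ 2 + y ^+ 2 < t ^+ 2 -> I x.
      move=> xy; rewrite /I /= in_itv /= -ler_norml -(@ler_pXn2r _ 2) ?nnegrE ?(ltW t0) //.
      by rewrite real_normK ?num_real // ltW // (le_lt_trans _ xy) // lerDl sqr_ge0.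
    by split; [apply: (b _ p.2) | apply: (b _ p.1); rewrite addrC].
  have t4 : t ^+ 2 <= 1 / 4 by move: t0 t2; nra.
  have z1 : nrm (mkC p.1 p.2) < 1 by apply: (lt_trans dp); lra.
  rewrite lee_fin pullback_densityE (le_trans (densK z1)) //.
  rewrite mulrC ler_pM2r // -[2]invrK lef_pV2 ?posrE ?exprn_gt0 ?invr_gt0 // nrm_sqr /=.
      move: (lt_le_trans h t4); set u := _ + _ => u4; rewrite expr2; nra.
    by rewrite subr_gt0; lra.
have mt : mu I = (t - - t)%:E.
  by rewrite [LHS]lebesgue_measure_itv /= lte_fin ifT //; move: t0; lra.
rewrite integral_cst // [X in (_ * X)%E](_ : _ = mu I * mu I)%E.
  by rewrite mt -!EFinM lee_fin le_eqVlt; apply/orP; left; apply/eqP; ring.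
by rewrite [LHS]product_measure1E.
Qed.

(** The strip and its mirror image contribute 16/7 K (4 + 4) / (1 - t), that is 128/7 K / (1 - t),
    rounded up to 20 K / (1 - t). *)
Lemma pullback_integral_large (t : R) : 0 < t -> t < 1 ->
  (pullback_integral om f t <= (20 * K / (1 - t))%:E)%E.
Proof.
move=> t0 t1; have K7 : 0 <= 16 / 7 * K by rewrite mulr_ge0 // ltW.
have t2 : 0 < 1 - t ^+ 2 by rewrite subr_gt0 expr_lt1 // ltW.
pose G (p : R * R) := strip_weight t p + strip_weight t (p.2, p.1).
have G0 p : 0 <= G p by rewrite addr_ge0 // strip_weight_ge0.
have m1 := measurable_strip_weight t0 t1.
have m2 : measurable_fun [set: R * R] (fun p : R * R => strip_weight t (p.2, p.1)).
  by apply: (@measurableT_comp _ _ _ _ _ _ (strip_weight t) _ (fun p : R * R => (p.2, p.1))) => //;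
     apply/measurable_fun_pair.
apply: (@le_trans _ _ (\int[mu \x mu]_p ((16 / 7 * K) * G p)%:E)%E).
  apply: ge0_le_integral_subset => p.
  - by rewrite lee_fin pullback_densityE dens_ge0.
  - by rewrite lee_fin mulr_ge0.
  move=> dp; have h := disc_sqr t0 dp; split => //.
  have z1 : nrm (mkC p.1 p.2) < 1 by apply: (lt_trans dp).
  rewrite lee_fin pullback_densityE (le_trans (densK z1)) //.
  - rewrite nrm_sqr /=.
    have key (x y : R) : x ^+ 2 + y ^+ 2 < t ^+ 2 -> x ^+ 2 <= 9 / 16 ->
        K / (1 - (x ^+ 2 + y ^+ 2)) ^+ 2 <= 16 / 7 * K * strip_weight t (x, y).
      move=> xy x9; rewrite /strip_weight indicE mem_set // mulr1 max_l /=; last by move: xy; lra.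
      rewrite opprD addrA exprVn mulrA ler_pM2r; last by rewrite invr_gt0 exprn_gt0 //; move: xy t2; lra.
      rewrite mulrAC ler_peMl //; first exact: ltW.
      by move: (sqr_ge0 y) x9; lra.
    have [x9|x9] := leP (p.1 ^+ 2) (9 / 16).
      rewrite (le_trans (key _ _ h x9)) // ler_wpM2l // /G -surjective_pairing lerDl.
      exact: strip_weight_ge0.
    rewrite [p.1 ^+ 2 + _]addrC; apply: le_trans (key p.2 p.1 _ _) _; [by rewrite addrC | by move: h t1 t0 x9; nra |].
    by rewrite ler_wpM2l // /G lerDr; exact: strip_weight_ge0.
under eq_integral do rewrite EFinM.
rewrite ge0_integralZl //; last 2 first.
- by apply/measurable_EFinP; exact: measurable_funD.
- by move=> p _; rewrite lee_fin.
under eq_integral do rewrite EFinD.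
rewrite ge0_integralD //; last 4 first.
- by move=> p _; rewrite lee_fin strip_weight_ge0.
- exact/measurable_EFinP.
- by move=> p _; rewrite lee_fin strip_weight_ge0.
- exact/measurable_EFinP.
apply: (@le_trans _ _ ((16 / 7 * K)%:E * ((4 / (1 - t))%:E + (4 / (1 - t))%:E))%E).
  rewrite lee_pmul2l ?lte_fin // ; last by rewrite mulr_gt0.
  by apply: leeD; [exact: strip_weight_integral | exact: strip_weight_swap_integral].
rewrite -EFinD -EFinM lee_fin -mulrDl mulrA ler_pM2r ?invr_gt0 ?subr_gt0 //.
by move: K0; lra.
Qed.

Lemma pullback_integral_le (t : R) : 0 < t -> t < 1 ->
  (t^-1%:E * pullback_integral om f t <= (40 * K / (1 - t))%:E)%E.
Proof.
move=> t0 t1; have t3 : 0 < 1 - t by rewrite subr_gt0.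
have [t2|t2] := leP t (1 / 2).
  apply: (@le_trans _ _ (t^-1%:E * (8 * K * t ^+ 2)%:E)%E).
    by rewrite lee_pmul2l ?lte_fin ?invr_gt0 //; exact: pullback_integral_small.
  rewrite -EFinM lee_fin (_ : t^-1 * _ = 8 * K * t); last first.
    by field; rewrite gt_eqF.
  by rewrite ler_pdivlMr //; move: K0 t0 t3 t2; nra.
apply: (@le_trans _ _ (t^-1%:E * (20 * K / (1 - t))%:E)%E).
  by rewrite lee_pmul2l ?lte_fin ?invr_gt0 //; exact: pullback_integral_large.
rewrite -EFinM lee_fin mulrA ler_pM2r ?invr_gt0 // mulrC ler_pdivrMr //.
have : 0 <= K * (t - 1 / 2) by rewrite mulr_ge0 ?(ltW K0) // subr_ge0 ltW.
by lra.
Qed.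

End ExpIntegral.

Lemma is_derive_ln_onem (R : realType) (x : R) : x < 1 ->
  is_derive x 1 (fun r : R => ln (1 - r) : R) (- (1 - x)^-1).
Proof.
move=> x1; have x2 : 0 < 1 - x by rewrite subr_gt0.
have d1 : is_derive x 1 (fun r : R => 1 - r : R) (- 1).
  by apply: is_derive_eq; ring.
have d2 := @is_derive1_comp R (@ln R) (fun r : R => 1 - r : R) x _ _ (is_derive1_ln x2) d1.
by apply: is_derive_eq d2 _; rewrite mulrN mulr1.
Qed.

Lemma is_derive_continuous (R : realType) (f : R -> R) (x d : R) : is_derive x 1 f d ->
  {for x, continuous f}.
Proof. by move=> h; apply/differentiable_continuous/derivable1_diffP; apply: ex_derive. Qed.

(** The integrand is (1 - r)^(-1/2), with primitive -2 (1 - r)^(1/2), which is not differentiable at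
    1; hence the exhaustion by the segments [0, u i]. *)
Lemma inv_sqrt_integral (R : realType) :
  (\int[@lebesgue_measure R]_(r in `]0%R, 1%R[) (expR (- 2^-1 * ln (1 - r)))%:E <= 2%:E)%E.
Proof.
pose h (r : R) : R := expR (- 2^-1 * ln (1 - r)).
pose u (i : nat) : R := 1 - i.+2%:R^-1.
have u1 i : 0 < u i < 1 by rewrite subr_gt0 invf_lt1 ?ltr1n // ltrBlDr ltrDl invr_gt0 ltr0n.
have mh : measurable_fun [set: R] (EFin \o h).
  apply/measurable_EFinP; apply: measurableT_comp; first exact: measurable_expR.
  apply: measurable_funM; first exact: measurable_cst.
  apply: measurableT_comp; first exact: measurable_ln.
  by apply: measurable_funB => //; exact: measurable_cst.
have int i : (\int[@lebesgue_measure R]_(r in `[0%R, u i]) (h r)%:E <= 2%:E)%E.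
  have /andP[ui0 ui1] := u1 i; pose H (r : R) : R := - 2 * expR (2^-1 * ln (1 - r)).
  rewrite [leLHS](_ : _ = (H (u i) - H 0)%:E).
    rewrite lee_fin /H subr0 ln1 mulr0 expR0 mulr1 opprK.
    by rewrite gerDr mulNr oppr_le0 mulr_ge0 // expR_ge0.
  have dl (a x : R) : x < 1 -> is_derive x 1 (fun r : R => expR (a * ln (1 - r)) : R)
      (expR (a * ln (1 - x)) * (a * - (1 - x)^-1)).
    move=> x1; have d2 := @is_deriveZ R R R _ a x 1 _ (is_derive_ln_onem x1).
    exact: (@is_derive1_comp R (@expR R) (fun r : R => a * ln (1 - r) : R) x _ _ (is_derive_expR _) d2).
  apply: integral_derive.
  - by [].
  - move=> x /andP[_ xu]; have x1 : x < 1 by exact: le_lt_trans ui1.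
    have d2 := @is_deriveZ R R R _ (- 2) x 1 _ (dl 2^-1 x x1); apply: is_derive_eq d2 _.
    have -> : (1 - x)^-1 = expR (- ln (1 - x)) by rewrite expRN lnK // posrE subr_gt0.
    rewrite /h (_ : - 2^-1 * _ = 2^-1 * ln (1 - x) - ln (1 - x)); last by field.
    by rewrite expRD /GRing.scale /=; field.
  - move=> x /andP[_ xu]; have x1 : x < 1 by exact: le_lt_trans ui1.
    exact: is_derive_continuous (dl (- 2^-1) x x1).
pose S i := `[0%R, u i]%classic.
have cv : (\int[@lebesgue_measure R]_(r in S i) (h r)%:E)%E @[i --> \oo] -->
    (\int[@lebesgue_measure R]_(r in \bigcup_i S i) (h r)%:E)%E.
  apply: ge0_nondecreasing_set_cvg_integral => [i j ij|i|i|i x _].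
  - apply/subsetPset => x; rewrite /S /= !in_itv /= => /andP[-> /le_trans]; apply.
    by rewrite lerB // lef_pV2 ?posrE ?ltr0n // ler_nat.
  - exact: measurable_itv.
  - exact: measurable_funTS.
  - by rewrite lee_fin expR_ge0.
apply: (@le_trans _ _ (\int[@lebesgue_measure R]_(r in \bigcup_i S i) (h r)%:E)%E).
  apply: ge0_le_integral_subset => [r _|r _|r /=]; rewrite ?lee_fin ?expR_ge0 //.
  rewrite in_itv /= => /andP[r0 r1]; split => //.
  have r2 : 0 < 1 - r by rewrite subr_gt0.
  have rk := archi_boundP (ltW (_ : 0 < (1 - r)^-1)); rewrite invr_gt0 in rk.
  exists (Num.bound (1 - r)^-1) => //; rewrite /S /= in_itv /= (ltW r0) /= /u lerBrDr addrC -lerBrDr.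
  rewrite -[leRHS]invrK lef_pV2 ?posrE ?ltr0n ?invr_gt0 // ltW // (lt_trans (rk r2)) //.
  by rewrite ltr_nat.
rewrite -(cvg_lim _ cv) //; apply: lime_le; first by apply: cvgP cv.
by apply: nearW => i; exact: int.
Qed.

Section ExpIntegralBound.
Variables (R : realType) (n : nat) (M : complexManifold R n) (om : positiveForm M) (f : discMap M) (K : R).
Hypotheses (K0 : 0 < K)
  (densK : forall z : C R, nrm z < 1 -> dens om f z <= K / (1 - nrm z ^+ 2) ^+ 2).
Local Notation mu := (@lebesgue_measure R).

Lemma characteristic_ge0 r : (0 <= characteristic om f r)%E.
Proof.
apply: integral_ge0 => t /=; rewrite in_itv /= => /andP[t0 _].
by rewrite mule_ge0 ?pullback_integral_ge0 // lee_fin invr_ge0 ltW.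
Qed.

Lemma characteristic_le (r : R) : 0 < r -> r < 1 ->
  (characteristic om f r <= (40 * K * - ln (1 - r))%:E)%E.
Proof.
move=> r0 r1; pose F (t : R) : R := - (40 * K) * ln (1 - t).
apply: (@le_trans _ _ (\int[mu]_(t in `[0%R, r]) (40 * K / (1 - t))%:E)%E).
  apply: ge0_le_integral_subset => t /=; rewrite !in_itv /=.
  - move=> /andP[t0 _].
    by rewrite mule_ge0 ?pullback_integral_ge0 // lee_fin invr_ge0 ltW.
  - move=> /andP[t0 tr]; rewrite lee_fin divr_ge0 ?mulr_ge0 ?(ltW K0) //.
    by rewrite subr_ge0 (le_trans tr) // ltW.
  - move=> /andP[t0 tr]; rewrite (ltW t0) (ltW tr); split => //.
    by apply: pullback_integral_le => //; exact: lt_trans tr r1.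
rewrite [leLHS](_ : _ = (F r - F 0)%:E); last first.
  apply: integral_derive; first exact: r0.
    move=> x /andP[_ xr]; have x1 : x < 1 by exact: le_lt_trans r1.
    have d3 := @is_deriveZ R R R _ (- (40 * K)) x 1 _ (is_derive_ln_onem x1); apply: is_derive_eq d3 _.
    by rewrite /GRing.scale /=; ring.
  move=> x /andP[_ xr]; have x1 : 0 < 1 - x by rewrite subr_gt0 (le_lt_trans xr).
  apply: cvgM; first exact: cvg_cst.
  apply: cvgV; first by rewrite gt_eqF.
  by apply: cvgB; [exact: cvg_cst | exact: cvg_id].
by rewrite lee_fin /F subr0 ln1 mulr0 subr0 mulrN mulNr.
Qed.

(** For 0 <= c <= 1 / (80 K), c T(r) is at most half of - ln (1 - r), so the integrand is at most (1
    - r)^(-1/2). *)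
Lemma exp_integral_le (c : R) : c <= (80 * K)^-1 -> (exp_integral om f c <= 2%:E)%E.
Proof.
move=> cK; have [c0|c0] := leP 0 c; last first.
  apply: (@le_trans _ _ (\int[mu]_(r in `]0%R, 1%R[) cst 1%E r)%E).
    apply: ge0_le_integral_subset => [r _|r _|r ri]; rewrite ?expeR_ge0 //; split => //.
    rewrite -[1%E]expeR0 lee_expeR; apply: mule_le0_ge0; rewrite ?lee_fin ?(ltW c0) //.
    exact: characteristic_ge0.
  rewrite integral_cst //= mul1e lebesgue_measure_itv /= lte_fin ltr01 oppr0 adde0 lee_fin.
  by rewrite ler1n.
apply: le_trans (@inv_sqrt_integral R).
apply: ge0_le_integral_subset => [r _|r _|r /= ri]; rewrite ?expeR_ge0 ?lee_fin ?expR_ge0 //.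
split => //; move: ri; rewrite in_itv /= => /andP[r0 r1].
rewrite -[leRHS]/(expeR (- 2^-1 * ln (1 - r))%:E) lee_expeR.
apply: (@le_trans _ _ ((80 * K)^-1%:E * (40 * K * - ln (1 - r))%:E)%E).
  apply: lee_pmul; rewrite ?lee_fin //; first exact: characteristic_ge0.
  exact: characteristic_le.
rewrite -EFinM lee_fin le_eqVlt; apply/orP; left; apply/eqP; field.
by rewrite gt_eqF.
Qed.

End ExpIntegralBound.

(** * Divergence along an entire curve *)

Lemma half_close (R : realFieldType) (x y : R) : - (y / 2) < x - y -> y / 2 <= x.
Proof. lra. Qed.

Section PeriodicCurve.
Variables (R : realType) (n : nat) (M : complexManifold R n) (om : positiveForm M).

(** Subtracting 1 sends every point i j to 0, where [G] has density 1, and the derivative 2 pi there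
    is nonzero. Continuity at 0 and periodicity then give one [d] and one [m] for all j. *)
Lemma periodic_curve (G : C R -> M) : (forall z, holo_at G z) -> dens om G 0 = 1 ->
  exists (g : C R -> M) (d m : R), [/\ forall z, holo_at g z, 0 < d, 0 < m &
    forall (j : nat) (u : C R), nrm (u - mkC 0 j%:R) < d -> m <= dens om g u].
Proof.
move=> hG dG; pose e (u : C R) : C R := cexp (rC (2 * pi) * u) - 1.
have de (u : C R) : is_cder e u (cexp (rC (2 * pi) * u) * rC (2 * pi)).
  have D1 := is_cderM (is_cder_cst (rC (2 * pi)) u) (is_cder_id u).
  have D2 := is_cderB (is_cder_comp D1 (cexp_der _)) (is_cder_cst (1 : C R) u).
  by move: D2; rewrite mul0r add0r mulr1 subr0 [_ *: _]mulrC.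
have hg (z : C R) : holo_at (G \o e) z by apply: holo_at_comp (de z) (hG _).
have g0 : 0 < dens om (G \o e) 0.
  rewrite (dens_comp om (de 0) (hG _)) /e mulr0 cexp0 subrr dG mulr1 exprn_gt0 // nrm_gt0.
  by rewrite mul1r rC_eq0 mulf_neq0 // gt_eqF // pi_gt0.
have gper (j : nat) (u : C R) : (G \o e) (u + mkC 0 j%:R) = (G \o e) u.
  elim: j => [|j <-]; first by rewrite [mkC 0 0]rC0 addr0.
  rewrite /e /= (_ : rC (2 * pi) * (u + mkC 0 j.+1%:R) = rC (2 * pi) * (u + mkC 0 j%:R) + mkC 0 (2 * pi)).
    by rewrite cexp_2pi.
  by apply: mkCP; rewrite !(reCM, imCM, reCD, imCD) /= ?(reCM, imCM, reCD, imCD) /= -?natr1; ring.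
have m0 : 0 < dens om (G \o e) 0 / 2 by rewrite divr_gt0.
have cd := @dens_continuous R n M om (G \o e) 0 1 ltr01 (fun w _ => hg w).
have [d d0 dP] := (@continuous_realP R (C R) _ _).1 cd _ m0.
exists (G \o e), d, (dens om (G \o e) 0 / 2); split; [exact: hg | exact: d0 | exact: m0 | move=> j u uj].
have D : is_cder (fun u => u + mkC 0 j%:R) (u - mkC 0 j%:R) 1.
  by have := is_cderD (is_cder_id (u - mkC 0 j%:R)) (is_cder_cst (mkC 0 j%:R) _); rewrite addr0.
have := dens_comp om D (hg _); rewrite (_ : _ \o _ = G \o e); last by apply/funext => v; exact: gper.
rewrite nrm1 expr1n mul1r subrK => <-.
have := dP (u - mkC 0 j%:R); rewrite subr0 => /(_ uj); rewrite ltr_norml => /andP[+ _].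
exact: half_close.
Qed.

End PeriodicCurve.

(** * The double pole near one preimage of i j *)

Section Squares.
Variables (R : realType) (s k : R) (j : nat).
Hypotheses (s0 : 0 < s) (s1 : s <= 1 / 2) (sj : j%:R * (2 * s ^+ 2) = 1) (k0 : 0 < k) (k1 : k <= 1 / 4).

(** 1 minus this point is s (1 - i), whose inverse square is i / (2 s^2) = i j by [sj]. The approach
    to 1 is non-tangential, so the distance to the unit circle is comparable to s. *)
Definition bump_center : C R := mkC (1 - s) s.

Variable z : C R.
(** The derivative of (1 - z)^-2 is of order s^-3 there, so s^3 is the scale on which the image
    stays within a fixed distance of i j. *)
Hypothesis zc : nrm (z - bump_center) <= 2 * k * s ^+ 3.

Let a : C R := mkC s (- s).

Let an : nrm a ^+ 2 = 2 * s ^+ 2.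
Proof. by rewrite nrm_sqr /= sqrrN; ring. Qed.

Let a1 : s <= nrm a.
Proof. exact: (le_trans (ler_norm _) (re_le a)). Qed.

Let a2 : nrm a <= 2 * s.
Proof. by rewrite (le_trans (nrm_le a)) //= normrN gtr0_norm //; lra. Qed.

Let s3 : 2 * k * s ^+ 3 <= s / 8.
Proof.
have h : s ^+ 2 <= 1 / 4 by move: s0 s1; nra.
rewrite exprSr mulrA; apply: (@le_trans _ _ (1 / 8 * s)); last by lra.
by rewrite ler_pM2r //; move: (sqr_ge0 s) h k0 k1; nra.
Qed.

Let z1 : 1 - z = a - (z - bump_center).
Proof. by apply: mkCP; rewrite !(reCB, imCB) /=; ring. Qed.

Lemma bump_norm : nrm z < 1 - s / 4.
Proof.
have c1 : nrm bump_center <= 1 - s / 2.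
  rewrite -(@ler_pXn2r _ 2) ?nnegrE ?nrm_ge0 ?subr_ge0 //; last by move: s1; lra.
  by rewrite nrm_sqr /=; move: s0 s1; nra.
have := nrmD (z - bump_center) bump_center; rewrite subrK => h.
by move: h c1 zc s3 s0; lra.
Qed.

Let lo : s / 2 <= nrm (1 - z).
Proof.
have := nrmD (1 - z) (z - bump_center); rewrite {1}z1 subrK => h.
by move: h a1 zc s3 s0; lra.
Qed.

Let hi : nrm (1 - z) <= 3 * s.
Proof. by have := nrmB a (z - bump_center); rewrite z1 => h; move: h a2 zc s3 s0; lra. Qed.

Lemma bump_neq0 : 1 - z != 0.
Proof. by rewrite -nrm_gt0 (lt_le_trans _ lo) // divr_gt0. Qed.

(** Over a common denominator the difference of inverse squares is at most (2 k s^3) (5 s) / (2 s^2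
    (s / 2)^2) = 20 k. *)
Lemma bump_image : nrm ((1 - z) ^- 2 - mkC 0 j%:R) <= 20 * k.
Proof.
have a0 : a != 0 by rewrite -nrm_gt0 (lt_le_trans s0).
have -> : mkC 0 j%:R = a ^- 2.
  apply: (@mulfI _ (a ^+ 2)); first by rewrite expf_neq0.
  rewrite mulfV ?expf_neq0 // expr2; apply: mkCP; rewrite !(reCM, imCM) /=; first by transitivity (j%:R * (2 * s ^+ 2)); [ring | exact: sj].
  by ring.
have -> : (1 - z) ^- 2 - a ^- 2 = (z - bump_center) * (a + (1 - z)) / (a ^+ 2 * (1 - z) ^+ 2).
  have -> : z - bump_center = a - (1 - z) by rewrite z1; ring.
  field; rewrite bump_neq0 a0 //.
rewrite nrmM nrmV (nrmM (z - _)) (nrmM (a ^+ 2)) !nrmX an ler_pdivrMr; last first.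
  by rewrite !mulr_gt0 ?exprn_gt0 // (lt_le_trans _ lo) // divr_gt0.
have h : nrm (a + (1 - z)) <= 5 * s by rewrite (le_trans (nrmD _ _)) //; move: a2 hi; lra.
apply: (@le_trans _ _ (2 * k * s ^+ 3 * (5 * s))).
  by apply: ler_pM; rewrite ?nrm_ge0.
have : (s / 2) ^+ 2 <= nrm (1 - z) ^+ 2 by rewrite lerXn2r ?nnegrE ?nrm_ge0 // divr_ge0 // ltW.
have ks : 0 <= 40 * k * s ^+ 2 by rewrite !mulr_ge0 ?exprn_ge0 // ltW.
move=> /(ler_wpM2l ks); have -> : 40 * k * s ^+ 2 * (s / 2) ^+ 2 = 2 * k * s ^+ 3 * (5 * s) by field.
by move/le_trans; apply; rewrite le_eqVlt; apply/orP; left; apply/eqP; ring.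
Qed.

Lemma bump_deriv : 2 / (27 * s ^+ 3) <= nrm (rC 2 / (1 - z) ^+ 3).
Proof.
rewrite nrmM nrmV nrmX nrm_rC ger0_norm //.
rewrite ler_pM2l // lef_pV2 ?posrE; last 2 first.
- by rewrite mulr_gt0 // exprn_gt0.
- by rewrite exprn_gt0 // (lt_le_trans _ lo) // divr_gt0.
rewrite (_ : 27 * s ^+ 3 = (3 * s) ^+ 3); last by ring.
by rewrite lerXn2r ?nnegrE ?nrm_ge0 // mulr_ge0 // ltW.
Qed.

End Squares.

Lemma sum_disjoint_indic_le (R : realType) (T : Type) (N : nat) (c : 'I_N -> R) (Q : 'I_N -> set T) (x : T) (v : R) :
  0 <= v -> (forall i, Q i x -> c i <= v) -> (forall i j, Q i x -> Q j x -> i = j) ->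
  \sum_i c i * \1_(Q i) x <= v.
Proof.
move=> v0 cv dQ; have [[i Qi]|nQ] := pselect (exists i, Q i x); last first.
  rewrite big1 // => i _; rewrite indicE memNset ?mulr0 // => Qi; apply: nQ; by exists i.
rewrite (bigD1 i) //= big1 ?addr0 => [|j ji].
  by rewrite indicE mem_set // mulr1 cv.
rewrite indicE memNset ?mulr0 // => Qj; move/negP: ji; apply; apply/eqP; exact: dQ.
Qed.

(** * Area of the curve with a double pole *)

Section PoleCurve.
Variables (R : realType) (n : nat) (M : complexManifold R n) (om : positiveForm M).
Variables (g : C R -> M) (d m : R).
Hypotheses (hg : forall z, holo_at g z) (d0 : 0 < d) (m0 : 0 < m)
  (dg : forall (j : nat) (u : C R), nrm (u - mkC 0 j%:R) < d -> m <= dens om g u).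
Local Notation mu := (@lebesgue_measure R).

Definition double_pole (z : C R) : C R := (1 - z) ^- 2.

Lemma is_cder_double_pole (z : C R) : 1 - z != 0 -> is_cder double_pole z (rC 2 / (1 - z) ^+ 3).
Proof.
move=> z1; have D0 := is_cderB (is_cder_cst (1 : C R) z) (is_cder_id z).
have D1 := is_cderM D0 D0.
have z2 : (1 - z) * (1 - z) != 0 by rewrite mulf_neq0.
have D2 := is_cderV D1 z2; move: D2.
have -> // : - ((0 - 1) * (1 - z) + (1 - z) * (0 - 1)) / ((1 - z) * (1 - z)) ^+ 2 = rC 2 / (1 - z) ^+ 3.
have -> : rC 2 = 1 + 1 :> C R by apply: mkCP; rewrite ?reCD ?imCD /=; ring.
by field.
Qed.

Lemma pole_curve : exists f : discMap M, disc_map f = g \o double_pole.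
Proof.
apply: discMap_of_holo => z z1.
have : 1 - z != 0 by rewrite subr_eq0 eq_sym; apply: contraTneq z1 => ->; rewrite nrm1 ltxx.
by move=> /is_cder_double_pole D; exact: holo_at_comp D (hg _).
Qed.

Variable f : discMap M.
Hypothesis fE : disc_map f = g \o double_pole.

(* [bump_center (s i)] is mapped to [i (i + 2)] by [double_pole]; the squares [Q i] below are
   disjoint because their images lie near different points. *)
Let k : R := Num.min (1 / 80) (d / 40).

Let k0 : 0 < k.
Proof. by rewrite lt_min !divr_gt0. Qed.

(** 20 k <= 1/4 separates the neighbourhoods of distinct points i j; by [k40], 20 k < d keeps them
    where the density of [g] is at least [m]. *)
Let k80 : k <= 1 / 80.
Proof. by rewrite ge_min lexx. Qed.

Let k40 : k <= d / 40.
Proof. by rewrite ge_min lexx orbT. Qed.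

(** The shift by 2 gives [s i <= 1 / 2] already for i = 0. *)
Let s (i : nat) : R := (Num.sqrt (2 * i.+2%:R))^-1.

Let s0 i : 0 < s i.
Proof. by rewrite invr_gt0 sqrtr_gt0. Qed.

Let s2 i : s i ^+ 2 = (2 * i.+2%:R)^-1.
Proof. by rewrite /s exprVn sqr_sqrtr. Qed.

Let sj i : i.+2%:R * (2 * s i ^+ 2) = 1.
Proof. by rewrite s2; field; rewrite -natrD pnatr_eq0. Qed.

Let s1 i : s i <= 1 / 2.
Proof.
rewrite -(@ler_pXn2r _ 2) ?nnegrE ?(ltW (s0 i)) ?divr_ge0 // s2.
rewrite (_ : (1 / 2) ^+ 2 = (2 * 2%:R)^-1); last by field.
by rewrite lef_pV2 ?posrE // ler_pM2l // ler_nat.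
Qed.

(** It amounts to 2 (i + 2) <= 4 N^2. With [bump_norm] the first N^2 squares then lie in |z| < 1 - 1
    / (8 N). *)
Let slow i N : (0 < N)%N -> (i < N ^ 2)%N -> (2 * N%:R)^-1 <= s i.
Proof.
move=> N0 iN; rewrite -(@ler_pXn2r _ 2) ?nnegrE ?(ltW (s0 i)) ?invr_ge0 ?mulr_ge0 // s2 exprVn.
rewrite lef_pV2 ?posrE ?exprn_gt0 ?mulr_gt0 ?ltr0n //.
have : (i.+2%:R : R) <= (2 * N ^ 2)%:R.
  by rewrite ler_nat; move: iN; case: (N ^ 2)%N => // l; rewrite mul2n -addnn; lia.
by rewrite natrM natrX => h; move: h; lra.
Qed.

Let I (x r : R) : set R := `[x - r, x + r]%classic.
Let r i : R := k * s i ^+ 3.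
Let Q i : set (R * R) := I (1 - s i) (r i) `*` I (s i) (r i).

Let r0 i : 0 < r i.
Proof. by rewrite mulr_gt0 // exprn_gt0. Qed.

Let mI x y : measurable (I x y).
Proof. exact: measurable_itv. Qed.

Let mQ i : measurable (Q i).
Proof. exact: measurableX. Qed.

Let muQ i : (mu \x mu)%E (Q i) = ((2 * r i) ^+ 2)%:E.
Proof.
have mt x : mu (I x (r i)) = (2 * r i)%:E.
  by rewrite [LHS]lebesgue_measure_itv /= lte_fin ifT ?ltrD2l -?EFinB; [congr EFin; ring | move: (r0 i); lra].
have -> : ((2 * r i) ^+ 2)%:E = (mu (I (1 - s i) (r i)) * mu (I (s i) (r i)))%E.
  by rewrite !mt -EFinM expr2.
rewrite [LHS]product_measure1E; [by [] | exact: mI | exact: mI].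
Qed.

Let Qnear i (p : R * R) : Q i p -> nrm (mkC p.1 p.2 - bump_center (s i)) <= 2 * k * s i ^+ 3.
Proof.
move=> []; rewrite /I /= !in_itv /= => /andP[h1 h2] /andP[h3 h4].
rewrite (le_trans (nrm_le _)) // reCB imCB /= (_ : 2 * k * _ = r i + r i); last by rewrite /r; ring.
by apply: lerD; rewrite ler_norml; apply/andP; split; move: h1 h2 h3 h4; lra.
Qed.

Let k4 : k <= 1 / 4.
Proof. by move: k80; lra. Qed.

Let Qpole i (p : R * R) : Q i p -> nrm (double_pole (mkC p.1 p.2) - mkC 0 i.+2%:R) <= 20 * k.
Proof. by move=> /Qnear h; exact: (bump_image (s0 i) (s1 i) (sj i) k0 k4 h). Qed.

Let Qdisjoint i j p : Q i p -> Q j p -> i = j.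
Proof.
move=> /Qpole hi /Qpole hj; have h := nrm_tri (mkC 0 i.+2%:R) (double_pole (mkC p.1 p.2)) (mkC 0 j.+2%:R).
have h2 := le_trans (im_le _) h; rewrite imCB /= (nrmC _ (double_pole _)) in h2.
apply/eqP; apply: contraT => ij; have : 1 <= `|i.+2%:R - j.+2%:R : R|.
  wlog ij' : i j ij {hi hj h h2} / (i < j)%N.
    move=> H; have [l|l|e] := ltngtP i j; first exact: H.
      by rewrite distrC; apply: H; rewrite // eq_sym.
    by rewrite e eqxx in ij.
  by rewrite distrC -natrB ?ltnS 1?ltnW // normr_nat ler1n subSS subSS subn_gt0.
by move: h2 hi hj k80; lra.
Qed.

Let weight i : R := (2 / (27 * s i ^+ 3)) ^+ 2 * m.

Let Qdens i (p : R * R) : Q i p -> weight i <= dens om f (mkC p.1 p.2).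
Proof.
move=> Qp; have h := Qnear Qp.
have z1 := bump_neq0 (s0 i) (s1 i) k0 k4 h.
rewrite fE (dens_comp om (is_cder_double_pole z1) (hg _)).
apply: ler_pM.
- exact: sqr_ge0.
- exact: ltW.
- rewrite lerXn2r ?nnegrE ?nrm_ge0 ?divr_ge0 ?mulr_ge0 ?exprn_ge0 ?(ltW (s0 i)) //.
  exact: (bump_deriv (s0 i) (s1 i) k0 k4 h).
- apply: (dg (j := i.+2)); apply: le_lt_trans (Qpole Qp) _.
  by move: k40 d0; lra.
Qed.

(** Area (2 k s^3)^2 of a square times the density bound (2 / (27 s^3))^2 m: the powers of s cancel,
    so all squares contribute equally. *)
Definition bump_area : R := 16 * k ^+ 2 * m / 27 ^+ 2.

Lemma bump_area_gt0 : 0 < bump_area.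
Proof. by rewrite !(mulr_gt0, invr_gt0, exprn_gt0). Qed.

Lemma pullback_integral_pole (N : nat) (t : R) : (0 < N)%N -> 1 - (8 * N%:R)^-1 <= t ->
  ((bump_area * N%:R ^+ 2)%:E <= pullback_integral om f t)%E.
Proof.
move=> N0 tN.
have w0 i : 0 <= weight i by rewrite mulr_ge0 ?sqr_ge0 ?ltW.
apply: (@le_trans _ _ (\int[mu \x mu]_p (\sum_(i < N ^ 2) weight i * \1_(Q i) p)%:E)%E); last first.
  pose D := \bigcup_(i in [set i | (i < N ^ 2)%N]) Q i.
  rewrite [leLHS](_ : _ = \int[mu \x mu]_(p in D) (\sum_(i < N ^ 2) weight i * \1_(Q i) p)%:E)%E.
    apply: ge0_le_integral_subset => p.
    - by move=> _; rewrite lee_fin sumr_ge0 // => i _; rewrite mulr_ge0.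
    - by rewrite lee_fin pullback_densityE dens_ge0.
    move=> [i /= iN Qi]; split.
      have := bump_norm (s0 i) (s1 i) k0 k4 (Qnear Qi); rewrite /disc /= => h.
      apply: (lt_le_trans h); apply: le_trans tN; rewrite lerB //.
      by have := slow N0 iN; rewrite !invfM; lra.
    rewrite lee_fin pullback_densityE; apply: sum_disjoint_indic_le.
    - exact: dens_ge0.
    - by move=> j; exact: Qdens.
    - by move=> j l Qj Ql; apply: val_inj; exact: Qdisjoint Qj Ql.
  rewrite [RHS]integral_mkcond; apply: eq_integral => p _; rewrite /patch; case: ifPn => // pD.
  rewrite big1 // => i _; rewrite indicE memNset ?mulr0 // => Qi.
  by case/negP: pD; rewrite inE; exists i => /=.
under eq_integral do rewrite -sumEFin.
rewrite ge0_integral_sum //; last 2 first.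
- move=> i; apply/measurable_EFinP; apply: measurable_funM; first exact: measurable_cst.
  exact: measurable_indic (mQ i).
- by move=> i p _; rewrite lee_fin mulr_ge0.
have E (i : 'I_(N ^ 2)) : (\int[mu \x mu]_p (weight i * \1_(Q i) p)%:E = bump_area%:E)%E.
  under eq_integral do rewrite EFinM.
  rewrite ge0_integralZl ?lee_fin //; last first.
    by apply/measurable_EFinP; exact: measurable_indic (mQ i).
  rewrite [X in (_ * X)%E](_ : _ = ((2 * r i) ^+ 2)%:E); last first.
    by rewrite [LHS]integral_indic; [rewrite setIT; exact: muQ | exact: measurableT | exact: mQ].
  rewrite -EFinM /weight /bump_area /r; congr EFin.
  by field; rewrite gt_eqF.
under eq_bigr do rewrite E.
by rewrite sumEFin lee_fin sumr_const card_ord -[leRHS]mulr_natr natrX.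
Qed.

End PoleCurve.

Lemma expR_ge_sqr (R : realType) (x : R) : 0 <= x -> x ^+ 2 / 4 <= expR x.
Proof.
move=> x0; have -> : expR x = expR (x / 2) ^+ 2 by rewrite -expRM_natl; congr expR; field.
have h := expR_ge1Dx (x / 2); have -> : x ^+ 2 / 4 = (x / 2) ^+ 2 by field.
by rewrite lerXn2r ?nnegrE ?expR_ge0 ?divr_ge0 // (le_trans _ h) // lerDr.
Qed.

Section ExpIntegralInfinite.
Variables (R : realType) (n : nat) (M : complexManifold R n) (om : positiveForm M) (f : discMap M) (a : R).
Hypotheses (a0 : 0 < a) (If : forall (N : nat) (t : R), (0 < N)%N -> 1 - (8 * N%:R)^-1 <= t ->
  ((a * N%:R ^+ 2)%:E <= pullback_integral om f t)%E).
Local Notation mu := (@lebesgue_measure R).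

Lemma itv_co_measure (x y : R) : x < y -> mu `[x, y[%classic = (y - x)%:E.
Proof. by move=> xy; rewrite [LHS]lebesgue_measure_itv /= lte_fin xy EFinB. Qed.

(** The integrand is at least a N^2, since t^-1 >= 1, on the interval of length 1 / (16 N) that
    starts at 1 - 1 / (8 N). *)
Lemma characteristic_ge (N : nat) (r : R) : (0 < N)%N -> 1 - (16 * N%:R)^-1 <= r -> r < 1 ->
  ((a / 16 * N%:R)%:E <= characteristic om f r)%E.
Proof.
move=> N0 Nr r1; have n1 : 1 <= N%:R :> R by rewrite ler1n.
have n0 : 0 < N%:R :> R by rewrite ltr0n.
pose t0 : R := 1 - (8 * N%:R)^-1; pose t1 : R := 1 - (16 * N%:R)^-1.
have i0 : 0 < (N%:R : R)^-1 by rewrite invr_gt0.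
have i1 : (N%:R : R)^-1 <= 1 by rewrite invf_le1.
have t01 : t0 < t1 by rewrite /t0 /t1 !invfM; lra.
have t00 : 0 < t0 by rewrite /t0 !invfM; lra.
apply: (@le_trans _ _ (\int[mu]_(t in `[t0, t1[) cst (a * N%:R ^+ 2)%:E t)%E).
  rewrite integral_cst // [X in (_ * X)%E](itv_co_measure t01) -EFinM lee_fin le_eqVlt.
  by apply/orP; left; apply/eqP; rewrite /t0 /t1; field; rewrite gt_eqF.
apply: ge0_le_integral_subset => t /=; rewrite ?in_itv /=.
- by move=> _; rewrite lee_fin mulr_ge0 ?sqr_ge0 // ltW.
- by move=> /andP[t2 _]; rewrite mule_ge0 ?pullback_integral_ge0 // lee_fin invr_ge0 ltW.
move=> /andP[ta tb]; have tp := lt_le_trans t00 ta; split.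
  by rewrite tp (lt_le_trans tb).
rewrite -[leLHS]mul1e; apply: lee_pmul; rewrite ?lee_fin ?mulr_ge0 ?sqr_ge0 ?(ltW a0) //.
  by rewrite invf_ge1 // (le_trans (ltW tb)) // (le_trans Nr) // ltW.
exact: If.
Qed.

(** Over [1 - 1 / (16 N), 1[ the integrand is at least exp (b N) >= (b N)^2 / 4; times the length 1
    / (16 N) this is b^2 N / 64, unbounded in N. *)
Lemma exp_integral_infinite (c : R) : 0 < c -> exp_integral om f c = +oo%E.
Proof.
move=> c0; pose b := c * (a / 16); have b0 : 0 < b by rewrite mulr_gt0 // divr_gt0.
have low (N : nat) : (0 < N)%N -> ((b ^+ 2 / 64 * N%:R)%:E <= exp_integral om f c)%E.
  move=> N0; have n1 : 1 <= N%:R :> R by rewrite ler1n.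
  have n0 : 0 < N%:R :> R by rewrite ltr0n.
  pose t1 : R := 1 - (16 * N%:R)^-1.
  have i0 : 0 < (16 * N%:R : R)^-1 by rewrite invr_gt0 mulr_gt0.
  have i1 : (16 * N%:R : R)^-1 < 1 by rewrite invf_lt1 ?mulr_gt0 //; move: n1; lra.
  have t11 : t1 < 1 by rewrite /t1; move: i0; lra.
  have t10 : 0 < t1 by rewrite /t1; move: i1; lra.
  apply: (@le_trans _ _ (\int[mu]_(r in `[t1, 1%R[) cst (expR (b * N%:R))%:E r)%E).
    rewrite integral_cst // [X in (_ * X)%E](itv_co_measure t11) -EFinM lee_fin.
    rewrite /t1 opprB addrC subrK ler_pdivlMr ?mulr_gt0 //.
    apply: le_trans (expR_ge_sqr _); last by rewrite mulr_ge0 ?ltW.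
    by rewrite le_eqVlt; apply/orP; left; apply/eqP; field.
  apply: ge0_le_integral_subset => r /=; rewrite ?in_itv /=.
  - by move=> _; rewrite lee_fin expR_ge0.
  - by rewrite expeR_ge0.
  move=> /andP[rt r1]; split; first by rewrite r1 (lt_le_trans t10).
  rewrite -[leLHS]/(expeR (b * N%:R)%:E) lee_expeR /b -mulrA EFinM.
  by rewrite lee_pmul2l ?lte_fin //; exact: characteristic_ge.
apply/eqyP => A A0; have A1 : 0 <= A / (b ^+ 2 / 64) by rewrite divr_ge0 ?divr_ge0 ?sqr_ge0 ?ltW.
have h := archi_boundP A1; have N0 : (0 < Num.bound (A / (b ^+ 2 / 64)))%N.
  by rewrite -(ltr_nat R); exact: le_lt_trans h.
apply: le_trans (low _ N0); rewrite lee_fin mulrC -ler_pdivrMr ?ltW //.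
by rewrite divr_gt0 // exprn_gt0.
Qed.

End ExpIntegralInfinite.

Section Dichotomy.
Variables (R : realType) (n : nat) (M : complexManifold R n) (om : positiveForm M).

Lemma bounded_dens_exp_integral (K : R) : 0 < K -> (forall f : discMap M, dens om f 0 <= K) ->
  forall (f : discMap M) (c : R), c <= (80 * K)^-1 -> (exp_integral om f c <= 2%:E)%E.
Proof.
move=> K0 hK f c; apply: exp_integral_le => // z z1; exact: dens_disc_bound.
Qed.

Lemma unbounded_dens_exp_integral (compactM : compact [set: M]) :
  ~ (exists K : R, forall f : discMap M, dens om f 0 <= K) ->
  exists f : discMap M, forall c : R, 0 < c -> exp_integral om f c = +oo%E.
Proof.
move=> /(brody compactM)[G [hG dG]].
have [g [d [m [hg d0 m0 dg]]]] := periodic_curve hG dG.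
have [f fE] := pole_curve hg.
exists f => c c0; apply: (exp_integral_infinite (bump_area_gt0 d0 m0) _ c0).
move=> N t N0 Nt; exact: (pullback_integral_pole hg d0 m0 dg fE N0 Nt).
Qed.

End Dichotomy.

(** * Existence of positive forms *)

Section FlatBump.
Variable R : realType.

(** The negative powers make the span of the family closed under differentiation; the bump used for
    cutoffs is k = 0. *)
Definition flat_bump (k : nat) (s : R) : R := if 0 < s then s ^- k * expR (- s^-1) else 0.

Lemma flat_bump_ge0 k s : 0 <= flat_bump k s.
Proof.
rewrite /flat_bump; case: ifP => // s0.
by rewrite mulr_ge0 ?expR_ge0 // invr_ge0 exprn_ge0 // ltW.
Qed.

Lemma flat_bump_gt0 k s : 0 < s -> 0 < flat_bump k s.
Proof. by move=> s0; rewrite /flat_bump s0 mulr_gt0 ?expR_gt0 // invr_gt0 exprn_gt0. Qed.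

Lemma flat_bump_le0 k s : s <= 0 -> flat_bump k s = 0.
Proof. by rewrite /flat_bump leNgt => /negbTE ->. Qed.

(** For s > 0, exp (1 / s) is the (k + 2)-th power of exp (1 / ((k + 2) s)), which exceeds 1 / ((k +
    2) s). Quadratic vanishing gives the derivative 0 at the origin. *)
Lemma flat_bump_quadratic k s : `|flat_bump k s| <= k.+2%:R ^+ k.+2 * s ^+ 2.
Proof.
rewrite ger0_norm ?flat_bump_ge0 // /flat_bump; case: ifPn => [s0|_]; last first.
  by apply: mulr_ge0; [exact: exprn_ge0 | exact: sqr_ge0].
have k0 : 0 < k.+2%:R :> R by rewrite ltr0n.
have h : (k.+2%:R * s) ^- k.+2 <= expR s^-1.
  have -> : expR s^-1 = expR ((k.+2%:R * s)^-1) ^+ k.+2.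
    by rewrite -expRM_natl; congr expR; field; rewrite gt_eqF // gt_eqF.
  rewrite -exprVn lerXn2r ?nnegrE ?expR_ge0 ?invr_ge0 ?mulr_ge0 ?(ltW s0) //.
  by apply: le_trans (expR_ge1Dx _); rewrite lerDr.
have h2 : expR (- s^-1) <= (k.+2%:R * s) ^+ k.+2.
  rewrite expRN -[leRHS]invrK lef_pV2 ?posrE ?expR_gt0 ?invr_gt0 ?exprn_gt0 ?mulr_gt0 //.
rewrite mulrC ler_pdivrMr ?exprn_gt0 // (le_trans h2) // exprMn.
by rewrite -[leRHS]mulrA -exprD.
Qed.

Lemma is_derive_quadratic (f : R -> R) (B : R) : (forall h, `|f h| <= B * h ^+ 2) -> is_derive (0 : R) (1 : R) f 0.
Proof.
move=> fB; have f0 : f 0 = 0.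
  by apply/eqP; rewrite -normr_le0 (le_trans (fB 0)) // expr0n mulr0.
have [df dv] : is_diff (0 : R) f (\0 : R -> R).
  apply: (@diff_of_near R R R f 0 \0); first by move=> x; exact: cvg_cst.
  move=> e e0; have B1 : 0 < `|B| + 1 by rewrite ltr_wpDl.
  apply/real_nbhsP; exists (e / (`|B| + 1)); first by rewrite divr_gt0.
  move=> h; rewrite subr0 ltr_pdivlMr // => hB; rewrite add0r f0 !subr0 (le_trans (fB h)) //.
  rewrite -[h ^+ 2]real_normK ?num_real // expr2 mulrA ler_wpM2r // (le_trans _ (ltW hB)) //.
  by rewrite mulrC ler_wpM2l // (le_trans (ler_norm _)) // lerDl.
have dd : derivable f 0 1 by apply/derivable1_diffP.
by split => //; rewrite deriveE // dv.
Qed.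

Lemma is_derive_flat_bump k (s : R) :
  is_derive s (1 : R) (flat_bump k) (flat_bump k.+2 s - k%:R * flat_bump k.+1 s).
Proof.
have [s0|s0|->] := ltgtP s 0.
- rewrite !flat_bump_le0 ?ltW // mulr0 subr0.
  apply: (@near_eq_is_derive R R R (cst 0) (flat_bump k) s 1 0 _ (is_derive_cst 0 s 1)).
  by near=> x; rewrite flat_bump_le0 // ltW //; near: x; exact: lt_nbhsl.
- have dV : is_derive s 1 (fun x : R => x^-1 : R) (- s ^- 2).
    by have := @is_deriveV R id s _ 1 (lt0r_neq0 s0) (is_derive_id s 1); rewrite /GRing.scale /= mulr1.
  have dX := @is_deriveX R R (fun x : R => x^-1 : R) k s 1 _ dV.
  have dE := @is_derive1_comp R (@expR R) (fun x : R => - x^-1 : R) s _ _ (is_derive_expR _) (@is_deriveN R R R _ s 1 _ dV).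
  have dM := @is_deriveM R R _ _ s 1 _ _ dX dE.
  apply: (@near_eq_is_derive R R R _ (flat_bump k) s 1 _ _ (is_derive_eq dM _)).
    near=> x; rewrite /flat_bump ifT; first by rewrite mulrfctE exprfctE /= exprVn.
    by near: x; exact: lt_nbhsr.
  rewrite exprfctE /flat_bump s0 /GRing.scale /=.
  rewrite -(exprVn s 2) -(exprVn s k.+1) -(exprVn s k.+2); set E := expR (- s^-1); set t := s^-1; move: E t => E t.
  by case: k {dX dM} => [|k] /=; rewrite !exprS; ring.
- rewrite !flat_bump_le0 ?lexx // mulr0 subr0; apply: is_derive_quadratic; exact: flat_bump_quadratic.
Unshelve. all: by end_near.
Qed.

End FlatBump.

Lemma diff_is_derive (R : realType) (f : R -> R) (x d h : R) : is_derive x 1 f d -> 'd f x h = h * d.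
Proof.
move=> [df dv]; rewrite -dv deriveE; last exact/derivable1_diffP.
by rewrite -[X in 'd f x X = _](mulr1 h) -[h * 1]/(h *: (1 : R)) linearZ_LR.
Qed.

Lemma near_eq_differentiable (R : realType) (V W : normedModType R) (f g : V -> W) (x : V) :
  (\forall y \near x, f y = g y) -> differentiable f x -> differentiable g x.
Proof.
move=> /real_nbhsP[r r0 rP] df; have cL := diff_continuous df.
have [] // : is_diff x g ('d f x); apply: diff_of_near => // e e0.
have /real_nbhsP[d d0 dP] := diff_near df e0.
apply/real_nbhsP; exists (Num.min r d); first by rewrite lt_min r0.
move=> h; rewrite lt_min subr0 => /andP[hr hd].
rewrite -!rP ?subrr ?normr0 //; first by apply: dP; rewrite subr0.
by rewrite addrC addKr.
Qed.

(** * Real smoothness of functions built from holomorphic data *)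

Section SmoothClass.
Variables (R : realType) (n : nat).
Local Notation VR := ('rV[R]_n * 'rV[R]_n)%type.
Implicit Types (O : set 'rV[C R]_n) (f : 'rV[C R]_n -> C R) (u w : VR -> R) (p v : VR).

Lemma of_realsP (a : R) p v : of_reals (a *: p + v) = rC a *: of_reals p + of_reals v.
Proof. by apply/rowP => j; rewrite !mxE; apply: mkCP; rewrite ?(reCD, imCD, reCM, imCM) /= ?mxE; ring. Qed.

Lemma of_realsD p v : of_reals (p + v) = of_reals p + of_reals v.
Proof. by have := of_realsP 1 p v; rewrite scale1r rC1 scale1r. Qed.

Lemma of_realsB p v : of_reals (p - v) = of_reals p - of_reals v.
Proof. by apply/eqP; rewrite eq_sym subr_eq -of_realsD subrK. Qed.

Lemma nrm_of_reals p : nrm (of_reals p) <= 2 * `|p|.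
Proof.
apply: nrm_row_le => [|j]; first by rewrite mulr_ge0.
rewrite mxE (le_trans (nrm_le _)) //= mulr_natl mulr2n.
have -> : `|p| = Num.max `|p.1| `|p.2| by [].
by apply: lerD; rewrite le_max (normr_coord p.1, normr_coord p.2) ?orbT.
Qed.

Lemma continuous_of_reals : continuous (@of_reals R n).
Proof.
move=> p; apply/cvg_nrmP => e e0; apply/(@real_nbhsP R VR); exists (e / 2); first by rewrite divr_gt0.
move=> q qp; rewrite -of_realsB (le_lt_trans (nrm_of_reals _)) // mulrC -ltr_pdivlMr //.
Qed.

Definition part (b : bool) (z : C R) : R := if b then reC z else imC z.

Lemma partP (a : R) b (z w : C R) : part b (rC a * z + w) = a * part b z + part b w.
Proof. by case: b; rewrite /part ?(reCD, imCD, reCM, imCM) /=; ring. Qed.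

Lemma partB b (z w : C R) : part b (z - w) = part b z - part b w.
Proof. by case: b; rewrite /part ?(reCB, imCB). Qed.

Lemma part_le b (z : C R) : `|part b z| <= nrm z.
Proof. by case: b; [exact: re_le | exact: im_le]. Qed.

Lemma continuous_part b : continuous (part b : C R -> R).
Proof. by case: b; [exact: continuous_reC | exact: continuous_imC]. Qed.

(** The complex differential, precomposed with [of_reals] and followed by a real or imaginary part,
    is real linear; this carries holomorphic data into the real calculus of [smooth_on]. *)
Lemma diff_part b f p : differentiable f (of_reals p) ->
  differentiable (fun q => part b (f (of_reals q))) p /\
  forall v, 'D_v (fun q => part b (f (of_reals q))) p = part b ('d f (of_reals p) (of_reals v)).
Proof.
move=> df; pose L v : R := part b ('d f (of_reals p) (of_reals v)).
have linL : linear L.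
  by move=> a v w; rewrite /L of_realsP linearP [_ *: _]/(_ * _) partP.
pose LL : {linear VR -> R} := HB.pack L (GRing.isLinear.Build _ _ _ _ L linL).
have cL : continuous LL.
  move=> v; apply: (@continuous_comp _ _ _ (fun v => 'd f (of_reals p) (of_reals v)) (part b)).
    apply: (@continuous_comp _ _ _ (@of_reals R n) ('d f (of_reals p))).
      exact: continuous_of_reals.
    exact: (diff_continuous df).
  exact: continuous_part.
have [dF dv] : is_diff p (fun q => part b (f (of_reals q))) LL.
  apply: diff_of_near => // e e0; have e2 : 0 < e / 2 by rewrite divr_gt0.
  have [d d0 dP] := cdiffP df e2.
  apply/real_nbhsP; exists (d / 2); first by rewrite divr_gt0.
  move=> h; rewrite subr0 ltr_pdivlMr // mulrC => /(le_lt_trans (nrm_of_reals h))/dP H.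
  rewrite [LL h]/(part b ('d f (of_reals p) (of_reals h))) of_realsD -!partB (le_trans (part_le _ _)) //.
  rewrite (le_trans H) // -mulrA ler_pM2l // mulrC ler_pdivrMr // mulrC; exact: nrm_of_reals.
by split => // v; rewrite deriveE // dv.
Qed.

(* A class of functions that contains the real and imaginary parts of holomorphic functions and
   is closed under directional derivatives; its members are therefore smooth. *)
Inductive smooth_class O : (VR -> R) -> Prop :=
| SmoothCst c : smooth_class O (fun=> c)
| SmoothPart b f : (forall y, O y -> differentiable f y) ->
    smooth_class O (fun p => part b (f (of_reals p)))
| SmoothAdd u w : smooth_class O u -> smooth_class O w -> smooth_class O (fun p => u p + w p)
| SmoothMul u w : smooth_class O u -> smooth_class O w -> smooth_class O (fun p => u p * w p)
| SmoothBump k u : smooth_class O u -> smooth_class O (fun p => flat_bump k (u p)).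

Lemma smooth_class_subset O O' u : O `<=` O' -> smooth_class O' u -> smooth_class O u.
Proof.
move=> sub; elim=> [c|b f df|u1 u2 _ h1 _ h2|u1 u2 _ h1 _ h2|k u1 _ h1]; try by constructor.
by apply: SmoothPart => y /sub; exact: df.
Qed.

Lemma open_holo_derivative O f (c y : 'rV[C R]_n) : open O -> (forall y, O y -> differentiable f y) -> O y ->
  differentiable (fun y => 'd f y c) y.
Proof.
move=> oO df Oy; have /nrm_nbhsP[r r0 rP] : nbhs y O by exact: open_nbhs_nbhs.
by apply: (holo_derivative c r0) => z /rP; exact: df.
Qed.

(** In the holomorphic case the derivative in a real direction [v] is the same part of y |->
    ['d f y (of_reals v)], again holomorphic by [holo_derivative]; the bump case rests on the
    derivative formula of [flat_bump]. *)
Lemma smooth_class_derive O u : open O -> smooth_class O u ->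
  (forall p, O (of_reals p) -> differentiable u p) /\
  forall v, exists2 u', smooth_class O u' & forall p, O (of_reals p) -> 'D_v u p = u' p.
Proof.
move=> oO; elim=> [c|b f df|u1 u2 S1 [d1 h1] S2 [d2 h2]|u1 u2 S1 [d1 h1] S2 [d2 h2]|k u1 S1 [d1 h1]].
- split=> [p _|v]; first exact: differentiable_cst.
  by exists (fun=> 0); [exact: SmoothCst | move=> p _; exact: derive_cst].
- split=> [p /df/(diff_part b)[]//|v].
  exists (fun p => part b ('d f (of_reals p) (of_reals v))).
    apply: (@SmoothPart O b (fun y => 'd f y (of_reals v))) => y Oy.
    exact: open_holo_derivative oO df Oy.
  by move=> p /df/(diff_part b)[_ ->].
- split=> [p Op|v]; first exact: (differentiableD (d1 p Op) (d2 p Op)).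
  have [u1' S1' E1] := h1 v; have [u2' S2' E2] := h2 v.
  exists (fun p => u1' p + u2' p); first exact: SmoothAdd.
  move=> p Op; rewrite -E1 // -E2 //.
  exact: (deriveD (diff_derivable (d1 p Op)) (diff_derivable (d2 p Op))).
- split=> [p Op|v]; first exact: (differentiableM (d1 p Op) (d2 p Op)).
  have [u1' S1' E1] := h1 v; have [u2' S2' E2] := h2 v.
  exists (fun p => u1 p * u2' p + u2 p * u1' p).
    by apply: SmoothAdd; apply: SmoothMul.
  move=> p Op; rewrite -E1 // -E2 //.
  exact: (deriveM (diff_derivable (d1 p Op)) (diff_derivable (d2 p Op))).
have db x : differentiable (@flat_bump R k) x.
  by apply/derivable1_diffP; apply: (@ex_derive _ _ _ _ _ _ _ (is_derive_flat_bump k x)).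
split=> [p Op|v]; first exact: (@differentiable_comp _ _ _ _ u1 (@flat_bump R k) p (d1 p Op) (db _)).
have [u1' S1' E1] := h1 v.
exists (fun p => (flat_bump k.+2 (u1 p) + - k%:R * flat_bump k.+1 (u1 p)) * u1' p).
  apply: SmoothMul => //; apply: SmoothAdd; first exact: SmoothBump.
  by apply: SmoothMul; [exact: SmoothCst | exact: SmoothBump].
move=> p Op; rewrite -E1 // deriveE; last exact: (@differentiable_comp _ _ _ _ u1 (@flat_bump R k) p (d1 p Op) (db _)).
rewrite (@diff_comp _ _ _ _ u1 (@flat_bump R k) p (d1 p Op) (db _)) /= deriveE; last exact: d1.
by rewrite (diff_is_derive _ (is_derive_flat_bump k (u1 p))) [LHS]mulrC mulNr.
Qed.

Lemma iter_derive_eq (U : set VR) u w (s : seq VR) : open U -> (forall p, U p -> u p = w p) ->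
  forall p, U p -> foldr (fun v g => fun y => 'D_v g y) u s p = foldr (fun v g => fun y => 'D_v g y) w s p.
Proof.
move=> oU uw; elim: s => [//|v s IH] p Up /=; apply: near_eq_derive.
have : nbhs p U by exact: open_nbhs_nbhs.
by apply: filterS => q; exact: IH.
Qed.

(** Cutoffs obey different formulas inside and outside a chart, so agreement with a member of
    [smooth_class] is asked only near each point. *)
Definition locally_smooth (y : 'rV[C R]_n) u :=
  exists O w, [/\ open O, O y, smooth_class O w & forall p, O (of_reals p) -> u p = w p].

Lemma open_of_reals O : open O -> open (@of_reals R n @^-1` O).
Proof. by move=> oO; apply: open_comp => // p _; exact: continuous_of_reals. Qed.

Lemma locally_smooth_on O u : open O -> (forall y, O y -> locally_smooth y u) ->
  smooth_on (@of_reals R n @^-1` O) u.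
Proof.
move=> oO lu s p Op; have [ O' [w [oO' Oy Sw uw]]] := lu _ Op.
have oU := open_of_reals oO'.
have [w' Sw' ww'] : exists2 w', smooth_class O' w' &
    forall q, O' (of_reals q) -> foldr (fun v g => fun y => 'D_v g y) w s q = w' q.
  elim: s => [|v s [w1 S1 E1]]; first by exists w.
  have [_ /(_ v)[w2 S2 E2]] := smooth_class_derive oO' S1.
  exists w2 => // q Oq /=; rewrite -E2 //; apply: near_eq_derive.
  have : nbhs q (@of_reals R n @^-1` O') by apply: open_nbhs_nbhs.
  by apply: filterS => q'; exact: E1.
have [dw' _] := smooth_class_derive oO' Sw'.
apply: near_eq_differentiable (dw' p Oy).
have : nbhs p (@of_reals R n @^-1` O') by apply: open_nbhs_nbhs.
by apply: filterS => q Oq /=; rewrite (iter_derive_eq s oU uw) // ww'.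
Qed.

Lemma locally_smooth_cst y c : locally_smooth y (fun=> c).
Proof. by exists setT, (fun=> c); split => //; [exact: openT | exact: SmoothCst]. Qed.

Lemma locally_smooth2 (op : R -> R -> R) y u1 u2 :
  (forall O w1 w2, smooth_class O w1 -> smooth_class O w2 -> smooth_class O (fun p => op (w1 p) (w2 p))) ->
  locally_smooth y u1 -> locally_smooth y u2 -> locally_smooth y (fun p => op (u1 p) (u2 p)).
Proof.
move=> H [ O1 [w1 [ o1 y1 S1 E1]]] [ O2 [w2 [ o2 y2 S2 E2]]].
exists (O1 `&` O2), (fun p => op (w1 p) (w2 p)); split.
- exact: openI.
- by [].
- by apply: H; [apply: smooth_class_subset S1 | apply: smooth_class_subset S2] => z [].
- by move=> p [/E1 -> /E2 ->].
Qed.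

Lemma locally_smoothD y u1 u2 : locally_smooth y u1 -> locally_smooth y u2 ->
  locally_smooth y (fun p => u1 p + u2 p).
Proof. by apply: locally_smooth2 => O; exact: SmoothAdd. Qed.

Lemma locally_smoothM y u1 u2 : locally_smooth y u1 -> locally_smooth y u2 ->
  locally_smooth y (fun p => u1 p * u2 p).
Proof. by apply: locally_smooth2 => O; exact: SmoothMul. Qed.

Lemma locally_smoothB y u1 u2 : locally_smooth y u1 -> locally_smooth y u2 ->
  locally_smooth y (fun p => u1 p - u2 p).
Proof.
move=> S1 S2; have := locally_smoothD S1 (locally_smoothM (locally_smooth_cst y (-1)) S2).
by congr locally_smooth; apply/funext => p; rewrite mulN1r.
Qed.

Lemma locally_smooth_bump k y u : locally_smooth y u -> locally_smooth y (fun p => flat_bump k (u p)).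
Proof.
move=> [ O [w [oO Oy Sw uw]]]; exists O, (fun p => flat_bump k (w p)); split => //.
  exact: SmoothBump.
by move=> p /uw ->.
Qed.

Lemma locally_smooth_sum (I : Type) (r : seq I) (F : I -> VR -> R) y :
  (forall i, locally_smooth y (F i)) -> locally_smooth y (fun p => \sum_(i <- r) F i p).
Proof.
move=> SF; elim: r => [|i r IH].
  by have := locally_smooth_cst y 0; congr locally_smooth; apply/funext => p; rewrite big_nil.
by have := locally_smoothD (SF i) IH; congr locally_smooth; apply/funext => p; rewrite big_cons.
Qed.

Lemma locally_smooth_near O y u w : open O -> O y -> (forall p, O (of_reals p) -> u p = w p) ->
  locally_smooth y w -> locally_smooth y u.
Proof.
move=> oO Oy uw [ O' [w' [oO' Oy' Sw ww']]]; exists (O `&` O'), w'; split => //.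
- exact: openI.
- by apply: smooth_class_subset Sw => z [].
- by move=> p [/uw -> /ww'].
Qed.

Lemma locally_smooth_part b O f y : open O -> O y -> (forall z, O z -> differentiable f z) ->
  locally_smooth y (fun p => part b (f (of_reals p))).
Proof.
by move=> oO Oy df; exists O, (fun p => part b (f (of_reals p))); split => //; exact: SmoothPart.
Qed.

End SmoothClass.

Lemma near_eq_diff (K : numFieldType) (V W : normedModType K) (f g : V -> W) (x v : V) :
  (\forall y \near x, f y = g y) -> differentiable f x -> differentiable g x -> 'd f x v = 'd g x v.
Proof. by move=> fg df dg; rewrite -(deriveE v df) -(deriveE v dg); exact: near_eq_derive. Qed.

Lemma near_comp_diff (K : numFieldType) (V W X : normedModType K) (f : V -> W) (g : W -> X) (h : V -> X) (x v : V) :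
  (\forall y \near x, h y = g (f y)) -> differentiable f x -> differentiable g (f x) -> differentiable h x ->
  'd h x v = 'd g (f x) ('d f x v).
Proof.
move=> hgf df dg dh; rewrite (near_eq_diff v hgf dh (differentiable_comp df dg)).
by rewrite (diff_comp df dg).
Qed.

Lemma near_id_diff (K : numFieldType) (V : normedModType K) (f : V -> V) (x v : V) :
  (\forall y \near x, f y = y) -> differentiable f x -> 'd f x v = v.
Proof.
move=> fE df; have [did dE] := is_diff_id x.
by rewrite (near_eq_diff v fE df did) dE.
Qed.

Lemma jacobian_chain (K : numFieldType) (m n k : nat) (f : 'rV[K]_m -> 'rV[K]_n) (g : 'rV[K]_n -> 'rV[K]_k)
    (h : 'rV[K]_m -> 'rV[K]_k) x y : (forall v, 'd h x v = 'd g y ('d f x v)) ->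
  jacobian h x = jacobian f x *m jacobian g y.
Proof.
by move=> E; apply/row_matrixP => i; rewrite row_mul !rowE !mul_rV_lin1 E.
Qed.

(** * Transition maps and their jacobians *)

Section ChartOpen.
Variables (R : realType) (n : nat) (M : complexManifold R n).
Implicit Types (phi psi chi : chart R n M) (x : M) (N : set M).

Definition chart_image phi N : set 'rV[C R]_n :=
  [set y | (chart_map phi @` chart_dom phi) y /\ N (chart_inv phi y)].

Lemma open_chart_image phi N : open N -> open (chart_image phi N).
Proof.
move=> oN; rewrite openE => y [[x dx <-] Nx]; rewrite /interior.
apply: nbhsI; first exact: chart_img_nbhs.
apply: continuous_preimage; last exact: open_nbhs_nbhs.
by apply: chart_inv_continuous; exists x.
Qed.

Lemma transition_diff phi psi y : atlas phi -> atlas psi -> chart_image phi (chart_dom psi) y ->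
  differentiable (transition phi psi) y.
Proof.
move=> aphi apsi [[x dx <-]]; rewrite chart_mapK // => dpsi.
exact: atlas_holomorphic.
Qed.

Lemma transition_chain phi psi chi x v : atlas phi -> atlas psi -> atlas chi ->
  chart_dom phi x -> chart_dom psi x -> chart_dom chi x ->
  'd (transition phi chi) (chart_map phi x) v =
  'd (transition psi chi) (chart_map psi x) ('d (transition phi psi) (chart_map phi x) v).
Proof.
move=> aphi apsi achi dphi dpsi dchi.
have d1 := atlas_holomorphic aphi apsi dphi dpsi.
have d2 := atlas_holomorphic apsi achi dpsi dchi.
have d3 := atlas_holomorphic aphi achi dphi dchi.
have E : transition phi psi (chart_map phi x) = chart_map psi x by rewrite /transition /= chart_mapK.
rewrite -E in d2 *.
have near_comp : nbhs (chart_map phi x) [set y | transition phi chi y = transition psi chi (transition phi psi y)].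
  have : nbhs (chart_map phi x) (chart_image phi (chart_dom psi)).
    apply: open_nbhs_nbhs; split; first exact: (open_chart_image (chart_dom_open psi)).
    by split; [exists x | rewrite chart_mapK].
  by apply: nbhsS => y [_ dy]; rewrite /transition /= chart_mapK.
exact: near_comp_diff near_comp d1 d2 d3.
Qed.

Lemma transition_id phi x v : atlas phi -> chart_dom phi x ->
  'd (transition phi phi) (chart_map phi x) v = v.
Proof.
move=> aphi dphi; have d1 := atlas_holomorphic aphi aphi dphi dphi.
have near_id : nbhs (chart_map phi x) [set y | transition phi phi y = y].
  by apply: nbhsS (chart_img_nbhs dphi) => y [z dz <-]; rewrite /transition /= chart_mapK.
exact: near_id_diff near_id d1.
Qed.

Lemma jacobian_transition_chain phi psi chi x : atlas phi -> atlas psi -> atlas chi ->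
  chart_dom phi x -> chart_dom psi x -> chart_dom chi x ->
  jacobian (transition phi chi) (chart_map phi x) =
  jacobian (transition phi psi) (chart_map phi x) *m jacobian (transition psi chi) (chart_map psi x).
Proof. by move=> *; apply: jacobian_chain => v; exact: transition_chain. Qed.

Lemma jacobian_transition_id phi x : atlas phi -> chart_dom phi x ->
  jacobian (transition phi phi) (chart_map phi x) = 1%:M.
Proof.
move=> aphi dx; apply/row_matrixP => i; rewrite !rowE mulmx1 mul_rV_lin1.
exact: transition_id.
Qed.

Lemma jacobian_entry phi psi y j l : atlas phi -> atlas psi -> chart_image phi (chart_dom psi) y ->
  jacobian (transition phi psi) y j l = 'd (fun z => transition phi psi z 0 l : C R) y (delta_mx 0 j).
Proof.
move=> aphi apsi Oy; have d1 := transition_diff aphi apsi Oy.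
have [_ <-] := diff_row (fun j => diff_row_coord j d1).
by rewrite /jacobian mxE.
Qed.

End ChartOpen.

Lemma congruence_gram (R : realType) (m n k : nat) (V : 'M[C R]_(m, n)) (a : C R) (J : 'M[C R]_(n, k)) :
  V *m (a *: (J *m adjoint J)) *m adjoint V = a *: ((V *m J) *m adjoint (V *m J)).
Proof. by rewrite -scalemxAr -scalemxAl adjointM !mulmxA. Qed.

(** * Gluing the standard hermitian forms of charts *)

Section PositiveForm.
Variables (R : realType) (n : nat) (M : complexManifold R n).
Implicit Types (phi psi : chart R n M) (p x : M).
Variables (rho : M -> R) (D : seq M).
Hypotheses (rho0 : forall p, 0 < rho p)
  (rho_sub : forall p (y : 'rV[C R]_n), nrm (y - chart_map (chart_at p) p) <= rho p ->
     (chart_map (chart_at p) @` chart_dom (chart_at p)) y).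

(** The squared euclidean distance replaces the max norm because it is polynomial in real and
    imaginary parts, hence smooth. *)
Definition center_dist2 p x : R :=
  \sum_l nrm (chart_map (chart_at p) x 0 l - chart_map (chart_at p) p 0 l : C R) ^+ 2.

Definition cutoff p x : R :=
  if `[< chart_dom (chart_at p) x >] then flat_bump 0 (rho p ^+ 2 - center_dist2 p x) else 0.

Lemma cutoff_ge0 p x : 0 <= cutoff p x.
Proof. by rewrite /cutoff; case: ifP => // _; exact: flat_bump_ge0. Qed.

(** The euclidean norm dominates the max norm, so a positive argument of the bump places [x] in the
    coordinate ball. *)
Lemma cutoff_neq0 p x : cutoff p x != 0 -> chart_ball (chart_at p) p (rho p) x.
Proof.
rewrite /cutoff; case: asboolP => [dx|_]; last by rewrite eqxx.
move=> nz; split => //; apply: nrm_row_le => [|l]; first exact: ltW.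
rewrite -(@ler_pXn2r _ 2) ?nnegrE ?nrm_ge0 ?(ltW (rho0 p)) //.
have h : center_dist2 p x <= rho p ^+ 2.
  rewrite -subr_ge0; apply: contraNT nz; rewrite -ltNge => /ltW/(flat_bump_le0 0)->; exact: eqxx.
apply: le_trans h; rewrite /center_dist2 (bigD1 l) //= !mxE lerDl.
by apply: sumr_ge0 => i _; exact: sqr_ge0.
Qed.

Definition chart_jacobian phi p x : 'M[C R]_n := jacobian (transition phi (chart_at p)) (chart_map phi x).

(* The standard hermitian forms of finitely many charts, pulled back and weighted by cutoffs. *)
Definition glued_coef phi x : 'M[C R]_n :=
  \sum_(p <- D) rC (cutoff p x) *: (chart_jacobian phi p x *m adjoint (chart_jacobian phi p x)).

Lemma glued_coefE phi x j k : glued_coef phi x j k =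
  \sum_(p <- D) rC (cutoff p x) * \sum_l chart_jacobian phi p x j l * (chart_jacobian phi p x k l)^*.
Proof.
rewrite summxE; apply: eq_bigr => p _; rewrite !mxE; congr (_ * _).
by apply: eq_bigr => l _; rewrite !mxE.
Qed.

Lemma glued_coef_hermitian phi x : adjoint (glued_coef phi x) = glued_coef phi x.
Proof.
apply/matrixP => j k; rewrite mxE [LHS]/= mxE !glued_coefE rmorph_sum; apply: eq_bigr => p _.
rewrite rmorphM rmorph_sum; congr (_ * _).
  by apply: mkCP => //=; rewrite oppr0.
by apply: eq_bigr => l _; rewrite rmorphM /= conjCK mulrC.
Qed.

Lemma glued_coef_form phi x (v : 'rV[C R]_n) :
  (v *m glued_coef phi x *m adjoint v) 0 0 =
  rC (\sum_(p <- D) cutoff p x * \sum_l nrm ((v *m chart_jacobian phi p x) 0 l) ^+ 2).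
Proof.
have rCsum (I : Type) (r : seq I) (F : I -> R) : rC (\sum_(i <- r) F i) = \sum_(i <- r) rC (F i).
  by apply: big_morph => [a b|]; [exact: rCD | exact: rC0].
rewrite mulmx_sumr mulmx_suml summxE rCsum; apply: eq_bigr => p _.
rewrite congruence_gram [LHS]mxE rCM rCsum; congr (_ * _).
by rewrite mxE; apply: eq_bigr => l _; rewrite [adjoint _ l 0]mxE [(_^T)%R l 0]mxE mulC_conj.
Qed.

(** The chain rule for the passage to the chart at [p] and back exhibits a right inverse of the
    jacobian. *)
Lemma chart_jacobian_inj phi p x (v : 'rV[C R]_n) : atlas phi -> chart_dom phi x ->
  chart_dom (chart_at p) x -> v *m chart_jacobian phi p x = 0 -> v = 0.
Proof.
move=> aphi dx dpx vJ; have := jacobian_transition_chain aphi (chart_at_atlas p) aphi dx dpx dx.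
rewrite jacobian_transition_id // -/(chart_jacobian phi p x) => E.
by rewrite -[v]mulmx1 E mulmxA vJ mul0mx.
Qed.

Lemma glued_coef_positive phi x (v : 'rV[C R]_n) : (exists2 p, p \in D & 0 < cutoff p x) ->
  atlas phi -> chart_dom phi x -> v != 0 -> 0 < (v *m glued_coef phi x *m adjoint v) 0 0.
Proof.
move=> [p pD cp] aphi dx v0; rewrite glued_coef_form -rC0 ltrC.
have pos q : 0 <= cutoff q x * \sum_l nrm ((v *m chart_jacobian phi q x) 0 l) ^+ 2.
  by rewrite mulr_ge0 ?cutoff_ge0 // sumr_ge0 // => l _; exact: sqr_ge0.
rewrite (big_rem p) //= ltr_pwDl ?sumr_ge0 // mulr_gt0 //.
have [dpx _] := cutoff_neq0 (lt0r_neq0 cp).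
have : v *m chart_jacobian phi p x != 0.
  by apply: contra_neq v0; exact: chart_jacobian_inj.
move=> /rV0Pn[l nl]; rewrite (bigD1 l) //= ltr_pwDl ?exprn_gt0 ?nrm_gt0 //.
by apply: sumr_ge0 => i _; exact: sqr_ge0.
Qed.

Lemma glued_coef_change phi psi x : atlas phi -> atlas psi -> chart_dom phi x -> chart_dom psi x ->
  let J := jacobian (transition phi psi) (chart_map phi x) in
  glued_coef phi x = J *m glued_coef psi x *m adjoint J.
Proof.
move=> aphi apsi dphi dpsi J; rewrite mulmx_sumr mulmx_suml; apply: eq_bigr => p _.
rewrite congruence_gram.
(* Where the cutoff vanishes, [x] may lie outside the chart at [p], and the jacobian there has no
   meaning; the term is 0 in both charts. *)
have [->|c0] := eqVneq (cutoff p x) 0; first by rewrite rC0 !scale0r.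
have [dpx _] := cutoff_neq0 c0; congr (_ *: _).
have E : chart_jacobian phi p x = J *m chart_jacobian psi p x.
  exact: jacobian_transition_chain (chart_at_atlas p) dphi dpsi dpx.
by rewrite E.
Qed.

Section Smooth.
Variables (phi : chart R n M) (y : 'rV[C R]_n).
Hypotheses (aphi : atlas phi) (iy : (chart_map phi @` chart_dom phi) y).
Local Notation pt q := (chart_inv phi (of_reals q)).

Lemma locally_smooth_coord b p (l : 'I_n) : chart_dom (chart_at p) (chart_inv phi y) ->
  locally_smooth y (fun q => part b (transition phi (chart_at p) (of_reals q) 0 l : C R)).
Proof.
move=> dp; apply: (@locally_smooth_part _ _ b (chart_image phi (chart_dom (chart_at p)))
  (fun z => transition phi (chart_at p) z 0 l : C R)).
- exact: (open_chart_image (chart_dom_open _)).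
- by [].
- by move=> z Oz; apply: diff_row_coord; exact: transition_diff (chart_at_atlas p) Oz.
Qed.

Lemma locally_smooth_jacobian b p (j l : 'I_n) : chart_dom (chart_at p) (chart_inv phi y) ->
  locally_smooth y (fun q => part b (chart_jacobian phi p (pt q) j l)).
Proof.
move=> dp; have oO := open_chart_image (phi := phi) (chart_dom_open (chart_at p)).
have Oy : chart_image phi (chart_dom (chart_at p)) y by [].
pose f z := 'd (fun z => transition phi (chart_at p) z 0 l : C R) z (delta_mx 0 j).
have S : locally_smooth y (fun q => part b (f (of_reals q))).
  apply: (locally_smooth_part _ oO Oy) => z Oz; apply: (open_holo_derivative _ oO) Oz => w Ow.
  by apply: diff_row_coord; exact: transition_diff (chart_at_atlas p) Ow.
apply: locally_smooth_near oO Oy _ S => q Oq; congr part; have [iq _] := Oq.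
by rewrite /chart_jacobian chart_invK // jacobian_entry //; exact: chart_at_atlas.
Qed.

Lemma locally_smooth_cutoff p : chart_dom (chart_at p) (chart_inv phi y) ->
  locally_smooth y (fun q => cutoff p (pt q)).
Proof.
move=> dp; have oO := open_chart_image (phi := phi) (chart_dom_open (chart_at p)).
have Oy : chart_image phi (chart_dom (chart_at p)) y by [].
pose c (l : 'I_n) : C R := chart_map (chart_at p) p 0 l.
pose t b l (q : 'rV[R]_n * 'rV[R]_n) : R :=
  part b (transition phi (chart_at p) (of_reals q) 0 l : C R) - part b (c l).
have St b l : locally_smooth y (t b l).
  by apply: locally_smoothB; [exact: locally_smooth_coord | exact: locally_smooth_cst].
have S : locally_smooth y (fun q => flat_bump 0 (rho p ^+ 2 -
    \sum_l (t true l q * t true l q + t false l q * t false l q))).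
  apply: locally_smooth_bump; apply: locally_smoothB; first exact: locally_smooth_cst.
  by apply: locally_smooth_sum => l; apply: locally_smoothD; apply: locally_smoothM.
apply: locally_smooth_near oO Oy _ S => q [_ dq].
rewrite /cutoff asboolT //; congr (flat_bump 0 (_ - _)); apply: eq_bigr => l _.
by rewrite nrm_sqr reCB imCB !expr2.
Qed.

(** A point off the chart domain lies in the complement of the coordinate ball, which is open, and
    the cutoff vanishes there. *)
Lemma cutoff_locally0 p : ~ chart_dom (chart_at p) (chart_inv phi y) ->
  exists O : set 'rV[C R]_n, [/\ open O, O y & forall q, O (of_reals q) -> cutoff p (pt q) = 0].
Proof.
move=> ndp; have oN : open (~` chart_ball (chart_at p) p (rho p)).
  by apply: closed_openC; apply: chart_ball_closed (lexx _) => z; exact: rho_sub.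
exists (chart_image phi (~` chart_ball (chart_at p) p (rho p))); split.
- exact: open_chart_image.
- by split => // -[].
- by move=> q [_ nq]; apply/eqP; apply: contraT => /cutoff_neq0.
Qed.

(** One formula serves both parts; the power of -1 carries the sign in which they differ. *)
Lemma part_mul_conj b (z w : C R) : part b (z * w^*) =
  (part b z * part true w + (-1) ^+ b * - part (~~ b) z * part false w).
Proof. by case: b; rewrite /part ?(reCM, imCM) !(reC_conj, imC_conj) /=; ring. Qed.

Lemma part_sum b (I : Type) (r : seq I) (F : I -> C R) :
  part b (\sum_(i <- r) F i) = \sum_(i <- r) part b (F i).
Proof.
apply: (big_morph (part b)) => [z w|]; last by case: b.
by have := partP 1 b z w; rewrite rC1 !mul1r.
Qed.

Lemma locally_smooth_glued b (j k : 'I_n) :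
  locally_smooth y (fun q => part b (glued_coef phi (pt q) j k)).
Proof.
pose F p q := cutoff p (pt q) *
  \sum_l (part b (chart_jacobian phi p (pt q) j l) * part true (chart_jacobian phi p (pt q) k l) +
    (-1) ^+ b * - part (~~ b) (chart_jacobian phi p (pt q) j l) * part false (chart_jacobian phi p (pt q) k l)).
have -> : (fun q => part b (glued_coef phi (pt q) j k)) = (fun q => \sum_(p <- D) F p q).
  apply/funext => q; rewrite glued_coefE part_sum; apply: eq_bigr => p _.
  have := partP (cutoff p (pt q)) b (\sum_l chart_jacobian phi p (pt q) j l * (chart_jacobian phi p (pt q) k l)^* ) 0.
  rewrite addr0 => ->; rewrite (_ : part b 0 = 0) ?addr0; last by case: (b).
  by rewrite part_sum; congr (_ * _); apply: eq_bigr => l _; exact: part_mul_conj.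
apply: locally_smooth_sum => p.
have [dp|ndp] := pselect (chart_dom (chart_at p) (chart_inv phi y)).
  apply: locally_smoothM; first exact: locally_smooth_cutoff.
  apply: locally_smooth_sum => l; apply: locally_smoothD.
    by apply: locally_smoothM; exact: locally_smooth_jacobian.
  apply: locally_smoothM; last exact: locally_smooth_jacobian.
  have := locally_smoothM (locally_smooth_cst y (- (-1) ^+ b)) (locally_smooth_jacobian (~~ b) j l dp).
  by congr locally_smooth; apply/funext => q; rewrite mulNr mulrN.
have [ O [oO Oy O0]] := cutoff_locally0 ndp.
apply: locally_smooth_near oO Oy _ (locally_smooth_cst y 0) => q /O0; rewrite /F => ->.
exact: mul0r.
Qed.

End Smooth.

Hypothesis cover : forall x, exists2 p, p \in D & 0 < cutoff p x.

Lemma glued_coef_smooth phi (j k : 'I_n) : atlas phi ->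
  let U := @of_reals R n @^-1` (chart_map phi @` chart_dom phi) in
  let h q := glued_coef phi (chart_inv phi (of_reals q)) j k in
  smooth_on U (fun q => reC (h q)) /\ smooth_on U (fun q => imC (h q)).
Proof.
move=> aphi U h; split.
  apply: (@locally_smooth_on R n _ _ (@chart_img_open R n M phi)) => y iy.
  exact: (locally_smooth_glued aphi iy true).
apply: (@locally_smooth_on R n _ _ (@chart_img_open R n M phi)) => y iy.
exact: (locally_smooth_glued aphi iy false).
Qed.

Definition glued_form : positiveForm M :=
  PositiveForm glued_coef_smooth (fun phi x _ _ => glued_coef_hermitian phi x)
    (fun phi x v => glued_coef_positive (cover x)) glued_coef_change.

End PositiveForm.

Lemma exists_positiveForm (R : realType) (n : nat) (M : complexManifold R n) :
  compact [set: M] -> inhabited (positiveForm M).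
Proof.
move=> compactM.
have /choice[rho rhoP] : forall p : M, exists r : R, 0 < r /\
    forall y : 'rV[C R]_n, nrm (y - chart_map (chart_at p) p) <= r ->
      (chart_map (chart_at p) @` chart_dom (chart_at p)) y.
  move=> p; have /nrm_nbhsP[r r0 rP] := chart_img_nbhs (chart_at_dom p).
  exists (r / 2); split; first by rewrite divr_gt0.
  by move=> y yr; apply: rP; apply: le_lt_trans yr _; rewrite ltr_pdivrMr // mulr_natr mulr2n ltrDl.
have rho0 p : 0 < rho p by case: (rhoP p).
have rho_sub p := (rhoP p).2.
(* Finite sequences directed by inclusion: the covering form of compactness, applied to this filter,
   yields finitely many centres. *)
pose F : set_system (seq M) := [set P : set (seq M) | exists s : seq M, forall t : seq M, {subset s <= t} -> P t].
have FF : Filter F.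
  split.
  - by exists [::].
  - move=> P Q [s sP] [t tQ]; exists (s ++ t) => u su; split.
      by apply: sP => z zs; apply: su; rewrite mem_cat zs.
    by apply: tQ => z zt; apply: su; rewrite mem_cat zt orbT.
  - by move=> P Q PQ [s sP]; exists s => t /sP; exact: PQ.
have [s sP] : F [set s : seq M | [set: M] `<=` [set x : M | exists2 p : M, p \in s & 0 < cutoff rho p x]].
  apply: ((compact_near_coveringP [set: M]).1 compactM (seq M) F
    (fun (s : seq M) (x : M) => exists2 p : M, p \in s & 0 < cutoff rho p x) FF) => p _.
  have cp : nbhs p [set x | 0 < cutoff rho p x].
    have [d d0 dP] : exists2 d : R, 0 < d & n%:R * d ^+ 2 < rho p ^+ 2.
      (* The squared euclidean norm is at most n times the squared max norm, and n / (n + 1)^2 <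
         1. *)
      exists (rho p / n.+1%:R); first by rewrite divr_gt0 ?ltr0n.
      rewrite expr_div_n mulrA ltr_pdivrMr ?exprn_gt0 ?ltr0n // mulrC ltr_pM2l ?exprn_gt0 //.
      by rewrite -natrX ltr_nat -mulnn mulSn; lia.
    have := chart_map_continuous (chart_at_dom p) => /(@cvg_nrmP R)/(_ d d0) near_d.
    have := nbhsI (chart_dom_nbhs (chart_at_dom p)) near_d; apply: nbhsS => x [dx /= xd].
    rewrite /cutoff asboolT //; apply: flat_bump_gt0; rewrite subr_gt0; apply: le_lt_trans dP.
    rewrite mulr_natl -[X in _ *+ X]card_ord -sumr_const; apply: ler_sum => l _.
    rewrite lerXn2r ?nnegrE ?nrm_ge0 ?(ltW d0) //; apply: le_trans (ltW xd).
    by have := nrm_coord (chart_map (chart_at p) x - chart_map (chart_at p) p) l; rewrite !mxE.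
  exists ([set x | 0 < cutoff rho p x], [set s : seq M | p \in s]); first split => //.
    by exists [:: p] => t; apply; rewrite mem_head.
  by move=> [x t] /= [cx pt]; exists p.
constructor; apply: (glued_form rho0 rho_sub (D := s)) => x.
exact: (sP s (fun _ => id) x I).
Qed.

Theorem theorem2p1 (R : realType) (n : nat) (M : complexManifold R n)
    (compactM : compact [set: M]) :
  (kobayashi_hyperbolic M <->
   forall omega : positiveForm M, exists c0 A : R,
     [/\ 0 < c0, 0 < A &
       forall (f : discMap M) (c : R), c < c0 ->
         (exp_integral omega f c <= A%:E)%E]) /\
  (forall omega : positiveForm M,
     kobayashi_hyperbolic M <-> class_E0 omega = set0).
Proof.
(* The range includes c = c0, because emptiness of [class_E0] is tested at c0 itself. *)
have bounded_exp (om : positiveForm M) : kobayashi_hyperbolic M -> exists2 c0 : R, 0 < c0 &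
    forall (f : discMap M) (c : R), c <= c0 -> (exp_integral om f c <= 2%:E)%E.
  move=> /(hyperbolic_bounded_dens om compactM)[K K0 hK].
  exists (80 * K)^-1; first by rewrite invr_gt0 mulr_gt0.
  exact: bounded_dens_exp_integral.
have infinite_exp (om : positiveForm M) : ~ kobayashi_hyperbolic M ->
    exists f : discMap M, forall c : R, 0 < c -> exp_integral om f c = +oo%E.
  move=> nhyp; apply: (unbounded_dens_exp_integral compactM) => -[K hK].
  by apply: nhyp; exact: bounded_dens_hyperbolic hK.
split=> [|om]; split.
- move=> hyp om; have [c0 c00 hc] := bounded_exp om hyp.
  by exists c0, 2; split => // f c /ltW; exact: hc.
- move=> hb; have [om] := exists_positiveForm compactM.
  have [c0 [A [c00 A0 hA]]] := hb om; apply: contrapT => /(infinite_exp om)[f fE].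
  have := hA f (c0 / 2); rewrite ltr_pdivrMr // ltr_pMr // ltr1n => /(_ isT).
  by rewrite fE ?divr_gt0 // leye_eq.
- move=> hyp; have [c0 c00 hc] := bounded_exp om hyp.
  by apply/seteqP; split => // f /(_ c0 c00) fE; have := hc f c0 (lexx _); rewrite fE leye_eq.
- move=> E0; apply: contrapT => /(infinite_exp om)[f fE].
  by have : class_E0 om f by []; rewrite E0.
Qed.
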